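(* Let $\nu>1/2$. There is a constant $c>0$ depending only on $\nu$ such that the following holds. Suppose the kernel $K$ has $\nu$-polynomially decaying eigenvalues, i.e. $\mu_j\le C\,j^{-2\nu}$ for all $j=1,2,\ldots$, where $C$ is a universal constant. Suppose $f^*\in\mathcal H$ and $\mathbb E[(Y-f^*(x))^2\mid X=x]\le\sigma^2$ for $x\in\mathcal X$. Let $\bar f$ be the averaged divide-and-conquer kernel ridge regression estimate with $\lambda=(1/N)^{\frac{2\nu}{2\nu+1}}$, based on $N$ i.i.d. samples split into $m$ equal subsets. Suppose that either (i) for some $k>2$ there is $\rho<\infty$ with $\mathbb E[\phi_j(X)^{2k}]\le\rho^{2k}$ for all $j$, and $$m\le c\left(\frac{N^{\frac{2(k-4)\nu-k}{2\nu+1}}}{\rho^{4k}\log^kN}\right)^{\frac1{k-2}};$$ or (ii) there is $\rho<\infty$ with $\sup_{x\in\mathcal X}|\phi_j(x)|\le\rho$ for all $j$, and $$m\le c\,\frac{N^{\frac{2\nu-1}{2\nu+1}}}{\rho^4\log N}.$$ Then the mean-squared error is bounded as $$\mathbb E\big[\|\bar f-f^*\|_2^2\big]=O\left(\Big(\frac{\sigma^2}{N}\Big)^{\frac{2\nu}{2\nu+1}}\right).$$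
   Context: Setting. $(X,Y)$ is a random pair with values in $\mathcal X\times\mathbb R$ and joint distribution $\mathbb P$ (the marginal law of $X$ is also denoted $\mathbb P$); $f^*(x)=\mathbb E[Y\mid X=x]$; $\|g\|_2=(\int_{\mathcal X}g^2\,d\mathbb P)^{1/2}$. $K:\mathcal X\times\mathcal X\to\mathbb R$ is a symmetric positive semidefinite kernel with reproducing kernel Hilbert space $\mathcal H\subset L^2(\mathbb P)$ and norm $\|\cdot\|_{\mathcal H}$. It has the Mercer expansion $K(x,x')=\sum_{j\ge1}\mu_j\phi_j(x)\phi_j(x')$ with $\mu_1\ge\mu_2\ge\cdots\ge0$ and $\{\phi_j\}$ an orthonormal basis of $L^2(\mathbb P)$. Algorithm. Given $N$ i.i.d. samples $(x_i,y_i)$ from $\mathbb P$, divide them evenly and uniformly at random into $m$ disjoint subsets $S_1,\ldots,S_m$ of equal size $N/m$. For each $i$ compute $\hat f_i=\arg\min_{f\in\mathcal H}\big\{\frac1{|S_i|}\sum_{(x,y)\in S_i}(f(x)-y)^2+\lambda\|f\|_{\mathcal H}^2\big\}$, and output $\bar f=\frac1m\sum_{i=1}^m\hat f_i$. The expectation is over the samples (and the random partition). Convention. $O(\cdot)$ is an asymptotic statement as $N\to\infty$ for a fixed problem (kernel, distribution, $f^*$, $\sigma$, $k$, $\rho$, $\nu$): the implied constant does not depend on $N$ or $m$.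
   Formalization: The noise level is assumed to satisfy σ > 0; for σ = 0 and f* ≠ 0 the claimed bound would be 0, while the ridge penalty makes the mean-squared error strictly positive. *)

(* Defs.v *)
From HB Require Import structures.
From mathcomp Require Export all_boot all_order all_algebra.
From mathcomp Require Export all_classical all_reals all_analysis.
Set Implicit Arguments.
Unset Strict Implicit.
Unset Printing Implicit Defensive.
Import Order.TTheory GRing.Theory Num.Theory.
Import numFieldNormedType.Exports.
Local Open Scope classical_set_scope.
Local Open Scope ring_scope.

HB.instance Definition _ (d d' : measure_display)
  (T : measurableType d) (T' : measurableType d') :=
  @isMeasurableFun.Build _ _ _ _ (@fst T T') (@measurable_fst _ _ T T').

Definition marginal (d : measure_display) (T : measurableType d) (R : realType)
    (P : probability (T * R)%type R) : probability T R :=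
  distribution P (@fst T R).

(* [g] is a version of the regression function x |-> E[W | X = x]. *)
Definition is_cond_exp (d d' : measure_display) (Om : measurableType d)
    (T : measurableType d') (R : realType) (P : probability Om R)
    (X : {RV P >-> T}) (W : Om -> R) (g : T -> R) : Prop :=
  [/\ P.-integrable setT (EFin \o W),
      (distribution P X).-integrable setT (EFin \o g) &
      forall A : set T, measurable A ->
        (\int[P]_(w in X @^-1` A) (W w)%:E =
         \int[distribution P X]_(x in A) (g x)%:E)%E].

Definition L2norm (d : measure_display) (T : measurableType d) (R : realType)
    (P : probability T R) (f : T -> R) : \bar R := 'N[P]_2%:E[EFin \o f]%E.

(* Basis elements are indexed from 0. *)
Record is_orthonormal_basis (d : measure_display) (T : measurableType d)
    (R : realType) (P : probability T R) (phi : nat -> T -> R) : Prop := {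
  onb_L2 : forall j, phi j \in Lfun P 2%:E;
  onb_orthonormal : forall i j,
    (\int[P]_x (phi i x * phi j x)%:E)%E = ((i == j)%:R)%:E;
  onb_expansion : forall f, f \in Lfun P 2%:E ->
    L2norm P (fun x =>
      f x - \sum_(j < n) (\int[P]_u (f u * phi j u)) * phi j x)
      @[n --> \oo] --> 0%E
}.

Definition psd_kernel (T : Type) (R : realType) (K : T -> T -> R) : Prop :=
  (forall x x', K x x' = K x' x) /\
  (forall (n : nat) (x : 'I_n -> T) (a : 'I_n -> R),
     0 <= \sum_(i < n) \sum_(j < n) a i * a j * K (x i) (x j)).

Definition has_mercer_expansion (T : Type) (R : realType) (K : T -> T -> R)
    (mu : nat -> R) (phi : nat -> T -> R) : Prop :=
  forall x x',
    series (fun j => mu j * phi j x * phi j x') @ \oo --> K x x'.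

Definition ip_norm (T : Type) (R : realType) (ip : (T -> R) -> (T -> R) -> R)
    (f : T -> R) : R := Num.sqrt (ip f f).

(* [H] with inner product [ip] is a Hilbert space of functions in which [K] is
   reproducing. The values of [ip] outside [H] are irrelevant. *)
Record is_rkhs (T : Type) (R : realType) (K : T -> T -> R)
    (H : set (T -> R)) (ip : (T -> R) -> (T -> R) -> R) : Prop := {
  rkhs_zero : H (fun=> 0);
  rkhs_lin : forall (a : R) f g, H f -> H g -> H (fun x => a * f x + g x);
  rkhs_ip_lin : forall (a : R) f g h, H f -> H g -> H h ->
    ip (fun x => a * f x + g x) h = a * ip f h + ip g h;
  rkhs_ip_sym : forall f g, H f -> H g -> ip f g = ip g f;
  rkhs_ip_ge0 : forall f, H f -> 0 <= ip f f;
  rkhs_ip_eq0 : forall f, H f -> ip f f = 0 -> f = (fun=> 0);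
  rkhs_complete : forall u : nat -> T -> R, (forall n, H (u n)) ->
    (forall e : R, 0 < e -> exists n0 : nat, forall m n : nat,
       (n0 <= m)%N -> (n0 <= n)%N ->
       ip_norm ip (fun x => u m x - u n x) < e) ->
    exists2 f, H f & ip_norm ip (fun x => u n x - f x) @[n --> \oo] --> (0 : R);
  rkhs_kernel : forall x, H (K x);
  rkhs_reproducing : forall f x, H f -> ip f (K x) = f x
}.

Record is_iid_sample (d d' : measure_display) (Om : measurableType d)
    (E : measurableType d') (R : realType) (Q : probability Om R)
    (P : probability E R) (N : nat) (Z : 'I_N -> {RV Q >-> E}) : Prop := {
  iid_law : forall i (B : set E), measurable B -> distribution Q (Z i) B = P B;
  iid_indep : forall (J : {set 'I_N}) (B : 'I_N -> set E),
    (forall i, measurable (B i)) ->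
    Q (\bigcap_(i in [set i | i \in J]) Z i @^-1` B i) =
    (\prod_(i in J) Q (Z i @^-1` B i))%E
}.

(* Subsets of the sample are sets of indices, so that repeated sample points
   are counted with multiplicity. *)
Definition krr_objective (T : Type) (R : realType)
    (ip : (T -> R) -> (T -> R) -> R) (N : nat) (z : 'I_N -> T * R)
    (S : {set 'I_N}) (lambda : R) (f : T -> R) : R :=
  #|S|%:R^-1 * \sum_(i in S) (f (z i).1 - (z i).2) ^+ 2
  + lambda * ip_norm ip f ^+ 2.

Definition krr (T : Type) (R : realType) (H : set (T -> R))
    (ip : (T -> R) -> (T -> R) -> R) (N : nat) (z : 'I_N -> T * R)
    (S : {set 'I_N}) (lambda : R) : T -> R :=
  xget (fun=> 0)
    [set f | H f /\ forall g, H g ->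
       krr_objective ip z S lambda f <= krr_objective ip z S lambda g].

(* A partition S_1, ..., S_m into equal parts is encoded by the map sending an
   index to the part containing it. *)
Definition equal_partitions (N m : nat) : {set {ffun 'I_N -> 'I_m}} :=
  [set s : {ffun 'I_N -> 'I_m} |
     [forall i, #|[set j | s j == i]| == (N %/ m)%N]]%SET.

Definition dc_krr (T : Type) (R : realType) (H : set (T -> R))
    (ip : (T -> R) -> (T -> R) -> R) (N m : nat) (s : {ffun 'I_N -> 'I_m})
    (z : 'I_N -> T * R) (lambda : R) : T -> R :=
  fun x => m%:R^-1 * \sum_(i < m) krr H ip z [set j | s j == i]%SET lambda x.

(* The partition is uniform and independent of the sample, so the expectation
   over it is the average over [equal_partitions]. *)
Definition dc_krr_mse (d d' : measure_display) (Om : measurableType d)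
    (T : measurableType d') (R : realType) (Q : probability Om R)
    (PX : probability T R) (H : set (T -> R))
    (ip : (T -> R) -> (T -> R) -> R) (fstar : T -> R) (N m : nat)
    (Z : 'I_N -> Om -> T * R) (lambda : R) : \bar R :=
  ((#|equal_partitions N m|%:R^-1)%:E *
   \sum_(s in equal_partitions N m)
     \int[Q]_w (L2norm PX (fun x =>
        dc_krr H ip s (fun i => Z i w) lambda x - fstar x)%R ^+ 2))%E.

(* Main.v *)
From HB Require Import structures.
Require Import Defs.
From mathcomp Require Import all_boot all_order all_algebra.
From mathcomp Require Import all_classical all_reals all_analysis.
From mathcomp Require Import measurable_realfun ring lra.
Set Implicit Arguments.
Unset Strict Implicit.
Unset Printing Implicit Defensive.
Import Order.TTheory GRing.Theory Num.Theory.
Import numFieldNormedType.Exports.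
Local Open Scope classical_set_scope.
Local Open Scope ring_scope.

(** Put D = N^(1/(2 nu + 1)), so that lambda = D^(-2 nu) = D / N, and let
n = N / m be the size of a part. Ridge regression is given by an explicit
linear formula ([krrE]), so the estimate computed on a part splits into a bias,
obtained by feeding the responses fstar(x), and a noise term, obtained by
feeding the residuals y - fstar(x). The error of the averaged estimate is the
average of the biases plus the average of the noise terms.

Everything rests on the notion of a well-conditioned design. With the shrinkage
weights w_j = mu_j / (mu_j + tau lambda), a design is good when the deviation of
the empirical Gram matrix of the phi_j from the identity has w-weighted
Frobenius norm at most 1/2 ([good_design] bounds its square). For a good design
the squared L2 norm of any h in H is at most twice its squared empirical norm
plus tau lambda |h|_H^2 ([good_L2_le]). Hence the squared norm of the bias
is at most (1 + tau) lambda |fstar|_H^2 ([ridge_bias_le]), and that of the noise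
term is at most 2 tau^2 times the sum of w_j eta_j^2, where eta_j is the empirical
coefficient of the residuals along phi_j ([good_ridge_noise]). The expectation of eta_j^2 is at
most sigma^2 / n and, by the decay of the eigenvalues, the sum of the w_j is at
most e D ([effective_dim]). Noise terms of different parts are uncorrelated, so
averaging over the m parts divides their mean square by m
([integral_avg_noise_ridge]), which leaves a multiple of
e D sigma^2 / (m n) = e sigma^2 lambda.

For a bad design only crude bounds on the squared norms are available:
mu_0 |fstar|_H^2 for the bias, and a bound of order sigma^2 / lambda in the mean
for the noise. They are harmless
as soon as bad designs have probability O(lambda) and O(m lambda^2); this is the
property [mostly_good]. By Jensen's and Markov's inequalities the probability
of a bad design is controlled by a moment of the entries of the Gram matrix
([bad_prob]). Under the moment condition on the phi_j the moment of order k of a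
sum of n centered variables is O(n^(k/2)) ([gram_moment]), and the bound on m is
exactly what makes the result O(m lambda^2) ([moment_tail_le]). For bounded phi_j
the order of the moment is taken to be 6 ln N, and exponential moments give a
probability at most 2 N^(-3) ([exp_tail_le]), provided that e is small compared
with rho^2. The factor e can be made as small as desired by enlarging tau, at the
expense of the constant hidden in O; this is why the constant c may be taken to
be 1, whatever C and rho are.

The map from samples to squared errors is not known to be measurable a priori.
It is dominated by a measurable function of the sample, which is enough because
the integral of nonnegative functions is monotone without any measurability
([ge0_le_integral_any]). *)

(** * Product laws and resampling of one coordinate *)

Section Resampling.
Context (d : measure_display) (E : measurableType d) (R : realType)
  (P : probability E R) (N : nat).
Local Open Scope ereal_scope.

Definition upd (a : 'I_N) (z : E) (t : N.-tuple E) : N.-tuple E :=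
  [tuple if i == a then z else tnth t i | i < N].

Lemma tnth_upd a z t i : tnth (upd a z t) i = if i == a then z else tnth t i.
Proof. exact: tnth_mktuple. Qed.

Lemma measurable_upd (a : 'I_N) :
  measurable_fun [set: N.-tuple E * E]
    (fun u : N.-tuple E * E => upd a u.2 u.1).
Proof.
apply/measurable_fun_tnthP => i.
have [ia|ia] := eqVneq i a.
  rewrite (_ : _ \o _ = snd)//.
  by apply/funext => u /=; rewrite tnth_mktuple ia eqxx.
rewrite (_ : _ \o _ = (@tnth N E ^~ i) \o fst); last first.
  by apply/funext => u /=; rewrite tnth_mktuple (negbTE ia).
by apply: measurableT_comp => //; exact: measurable_tnth.
Qed.

Definition box (B : 'I_N -> set E) : set (N.-tuple E) :=
  [set t | forall i, B i (tnth t i)].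

(** Independence and the common law of the coordinates are only used through the
measure of boxes, which determines the law because boxes form a pi-system
generating the sigma-algebra of tuples. *)
Definition is_product_law (mu : probability (N.-tuple E) R) : Prop :=
  forall B : 'I_N -> set E, (forall i, measurable (B i)) ->
    mu (box B) = \prod_(i < N) P (B i).

Let boxes := [set box B | B in [set B | forall i, measurable (B i)]].

Lemma measurable_box B : (forall i, measurable (B i)) -> measurable (box B).
Proof.
move=> mB.
rewrite (_ : box B = \bigcap_(i in [set: 'I_N]) (@tnth N E ^~ i @^-1` B i)).
  apply: fin_bigcap_measurable => // i _; rewrite -[X in measurable X]setTI.
  exact: measurable_tnth.
by apply/seteqP; split => t /= Bt i; [move=> _|]; apply: Bt.
Qed.

Lemma sigma_boxes : @measurable _ (N.-tuple E) = <<s boxes >>.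
Proof.
apply/seteqP; split; last first.
  apply: smallest_sub; first exact: sigma_algebra_measurable.
  by move=> _ [B mB <-]; exact: measurable_box.
apply: smallest_sub; first exact: smallest_sigma_algebra.
rewrite -bigcup_seq => A [i _ [B mB <-]]; apply: sub_sigma_algebra.
exists (fun j => if j == i then B else setT).
  by move=> j /=; case: ifP.
apply/seteqP; split => t /=.
  by move=> /(_ i); rewrite eqxx.
by move=> [_ Bt] j; case: eqP => // ->.
Qed.

Lemma setI_closed_boxes : setI_closed boxes.
Proof.
move=> _ _ [A mA <-] [B mB <-]; exists (fun i => A i `&` B i).
  by move=> i; exact: measurableI.
apply/seteqP; split => t /=.
  by move=> AB; split => i; have [] := AB i.
by move=> [At Bt] i; split.
Qed.

Variables (mu : probability (N.-tuple E) R) (hmu : is_product_law mu).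

(** Replacing one coordinate by an independent draw does not change the measure of
a box, hence does not change the law. *)
Lemma pushforward_upd (a : 'I_N) A : measurable A ->
  pushforward (mu \x P) (fun u : N.-tuple E * E => upd a u.2 u.1) A = mu A.
Proof.
move=> mA; pose mf := isMeasurableFun.Build _ _ _ _ _ (measurable_upd a).
pose f : {mfun _ >-> _} := HB.pack (fun u : N.-tuple E * E => upd a u.2 u.1) mf.
pose nu := pushforward (mu \x P) f.
rewrite -[LHS]/(nu A).
apply: (measure_unique boxes (fun=> setT)) => //.
- exact: sigma_boxes.
- exact: setI_closed_boxes.
- by move=> i; exists (fun=> setT) => //; apply/seteqP; split.
- by rewrite bigcup_const//; exists 0%N.
- move=> _ [B mB <-]; rewrite -[LHS]/(pushforward (mu \x P) f (box B)) /pushforward; transitivity (\prod_(i < N) P (B i)); last exact/esym/hmu.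
  rewrite (_ : _ @^-1` _ =
    box (fun i => if i == a then setT else B i) `*` B a); last first.
    apply/seteqP; split => -[t z] /=.
      move=> H; split; last by have := H a; rewrite tnth_upd eqxx.
      by move=> i; have := H i; rewrite tnth_upd; case: eqP.
    move=> [H Ba] i; rewrite tnth_upd; case: eqP => [->//|ia].
    by have := H i; case: eqP.
  rewrite product_measure1E//; last first.
    by apply: measurable_box => i; case: ifP.
  rewrite [X in X * _](hmu _); last by move=> i; case: ifP.
  rewrite (bigD1 a)//= eqxx probability_setT mul1e [RHS](bigD1 a)//= muleC.
  by congr (_ * _); apply: eq_bigr => i /negbTE ->.
- by move=> _; rewrite /nu /= /pushforward preimage_setT probability_setT ltry.
Qed.

(** This is Fubini's theorem for a single coordinate, and the only form in which
independence is used below: conditioning on all coordinates but one. *)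
Lemma resample (a : 'I_N) (F : N.-tuple E -> \bar R) :
  measurable_fun [set: N.-tuple E] F -> (forall t, 0 <= F t) ->
  \int[mu]_t F t = \int[mu]_t \int[P]_z F (upd a z t).
Proof.
move=> mF F0.
pose mf := isMeasurableFun.Build _ _ _ _ _ (measurable_upd a).
pose u : {mfun _ >-> _} := HB.pack (fun u : N.-tuple E * E => upd a u.2 u.1) mf.
rewrite -(@eq_measure_integral _ _ _ setT mu (pushforward (mu \x P) u)); last first.
  by move=> A mA _; exact: pushforward_upd.
rewrite (ge0_integral_pushforward (measurable_upd a) (mu \x P))//.
rewrite preimage_setT fubini_tonelli1//.
  exact: (measurableT_comp mF (measurable_upd a)).
by move=> x; exact: F0.
Qed.

(** Subtraction of integrals needs integrability, so the positive and negative parts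
of [F] are resampled separately; their inner integrals agree pointwise. *)
Lemma resample_eq0 (a : 'I_N) (F : N.-tuple E -> R) :
  mu.-integrable setT (EFin \o F) ->
  (forall t, \int[P]_z (F (upd a z t))%:E = 0) ->
  \int[mu]_t (F t)%:E = 0.
Proof.
move=> iF F0; have mF := measurable_int _ iF.
have eqF t : \int[P]_z (EFin \o F)^\+ (upd a z t) =
             \int[P]_z (EFin \o F)^\- (upd a z t).
  have := F0 t; rewrite integralE => /eqP.
  have p0 : 0 <= \int[P]_z (fun z => (F (upd a z t))%:E)^\+ z.
    by apply: integral_ge0.
  have n0 : 0 <= \int[P]_z (fun z => (F (upd a z t))%:E)^\- z.
    by apply: integral_ge0.
  have -> : \int[P]_z (EFin \o F)^\+ (upd a z t) =
      \int[P]_z (fun z => (F (upd a z t))%:E)^\+ z.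
    by apply: eq_integral => z _; rewrite !funeposE.
  have -> : \int[P]_z (EFin \o F)^\- (upd a z t) =
      \int[P]_z (fun z => (F (upd a z t))%:E)^\- z.
    by apply: eq_integral => z _; rewrite !funenegE.
  move: (\int[P]_z _) (\int[P]_z _) p0 n0 => [p| |] [n| |]//= _ _.
  by rewrite eqe subr_eq0 => /eqP ->.
rewrite integralE (resample a)//; last exact: measurable_funepos.
rewrite [X in _ - X](resample a)//; last exact: measurable_funeneg.
under eq_integral do rewrite eqF.
rewrite subee// -(resample a)//; last exact: measurable_funeneg.
exact: integrable_neg_fin_num.
Qed.

End Resampling.

(** * Integrals of functions of the input and the noise *)

Section LowerIntegral.
Context (d : measure_display) (T : measurableType d) (R : realType).
Local Open Scope ereal_scope.

(** The integral of a nonnegative function is the supremum of the integrals of the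
simple functions below it, and this supremum is monotone. *)
Lemma ge0_le_integral_any (mu : {measure set T -> \bar R}) (f g : T -> \bar R) :
  (forall x, 0 <= f x) -> (forall x, f x <= g x) ->
  \int[mu]_x f x <= \int[mu]_x g x.
Proof.
move=> f0 fg; have g0 x : 0 <= g x by exact: le_trans (fg x).
rewrite !ge0_integralTE//; apply: le_ereal_sup => _ [h /= hf <-].
by exists h => //= x; apply: le_trans (fg x).
Qed.

End LowerIntegral.

Section ConditionalComparison.
Context (d d' : measure_display) (E : measurableType d) (T : measurableType d')
  (R : realType) (P : probability E R) (X : E -> T) (h h' : E -> R).
Local Open Scope ereal_scope.
Hypotheses (mX : measurable_fun setT X)
  (mh : measurable_fun setT h) (mh' : measurable_fun setT h').
Hypotheses (h0 : forall w, (0 <= h w)%R) (h'0 : forall w, (0 <= h' w)%R).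
Hypothesis hh' : forall A, measurable A ->
  \int[P]_(w in X @^-1` A) (h w)%:E <= \int[P]_(w in X @^-1` A) (h' w)%:E.

Import HBNNSimple.

Let mXA A : measurable A -> measurable (X @^-1` A).
Proof. by move=> mA; rewrite -[X in measurable X]setTI; exact: mX. Qed.

(** For a simple weight the integral is a combination of integrals over preimages of
measurable sets, that is, of the quantities compared in the hypothesis. *)
Let integral_nnsfunE (k : E -> R) (g : {nnsfun T >-> R}) :
  measurable_fun setT k -> (forall w, 0 <= k w)%R ->
  \int[P]_w (k w * g (X w))%:E =
  \sum_(y \in range g)
    (y%:E * \int[P]_(w in X @^-1` (g @^-1` [set y])) (k w)%:E).
Proof.
move=> mk k0.
transitivity (\int[P]_w \sum_(y \in range g)
   ((Num.max y 0)%:E * ((k w)%:E * (\1_(X @^-1` (g @^-1` [set y])) w)%:E))).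
  apply: eq_integral => w _; rewrite fimfunE mulr_fsumr -fsumEFin//.
  apply: eq_fsbigr => y /[!inE] -[x _ <-].
  by rewrite max_l// -!EFinM mulrCA.
rewrite ge0_integral_fsum//.
- apply: eq_fsbigr => y /[!inE] -[x _ gxy].
  have my : measurable (g @^-1` [set y]) by [].
  rewrite max_l -?gxy// ge0_integralZl_EFin//.
  + by rewrite [in RHS]integral_mkcond epatch_indic gxy.
  + by move=> w _; rewrite mule_ge0// lee_fin// .
  + apply/measurable_EFinP; apply: measurable_funM => //.
    by apply: measurable_indic; apply: mXA; rewrite gxy.
- move=> y; apply/measurable_EFinP; apply: measurable_funM => //.
  apply: measurable_funM => //.
  by apply: measurable_indic; apply: mXA.
- move=> y w _; rewrite -!EFinM lee_fin mulr_ge0// ?le_max ?lexx ?orbT//.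
  by rewrite mulr_ge0.
Qed.

(** A comparison of conditional expectations given [X], tested on events, extends to
nonnegative weights depending on [X]: it holds for simple weights and passes to
monotone limits. *)
Lemma le_integral_cond (g : T -> R) :
  measurable_fun setT g -> (forall x, 0 <= g x)%R ->
  \int[P]_w (h w * g (X w))%:E <= \int[P]_w (h' w * g (X w))%:E.
Proof.
move=> mg g0.
have mg' : measurable_fun setT (EFin \o g) by exact/measurable_EFinP.
pose g_ := nnsfun_approx measurableT mg'.
have mgX n : measurable_fun setT (g_ n \o X) by exact: measurableT_comp.
have cvgk (k : E -> R) : measurable_fun setT k -> (forall w, 0 <= k w)%R ->
    \int[P]_w (k w * g_ n (X w))%:E @[n --> \oo] -->
    \int[P]_w (k w * g (X w))%:E.
  move=> mk k0.
  rewrite [X in _ --> X](_ : _ =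
      \int[P]_w limn (fun n => (k w * g_ n (X w))%:E)); last first.
    apply: eq_integral => w _; apply/esym/cvg_lim => //.
    under eq_fun do rewrite EFinM; rewrite EFinM.
    apply: cvgeZl => //; apply: cvg_nnsfun_approx => //.
    by move=> x _; rewrite lee_fin.
  apply: cvg_monotone_convergence => //.
  - by move=> n; apply/measurable_EFinP; exact: (measurable_funM mk (mgX n)).
  - by move=> n w _; rewrite lee_fin mulr_ge0.
  - move=> w _ a b ab; rewrite lee_fin ler_wpM2l//.
    by have /lefP := nd_nnsfun_approx measurableT mg' ab; apply.
apply: (lee_cvg_to (cvgk h mh h0) (cvgk h' mh' h'0)).
near=> n; rewrite !integral_nnsfunE//; apply: lee_fsum => //.
move=> y [x _ <-]; apply: lee_wpmul2l; first by rewrite lee_fin.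
by apply: hh'.
Unshelve. all: by end_near. Qed.

End ConditionalComparison.

(** The positive part of a product in terms of the positive and negative parts of
the factors; it reduces signed weights to nonnegative ones. *)
Lemma max0M (R : realDomainType) (a b : R) :
  Num.max (a * b) 0 =
  Num.max a 0 * Num.max b 0 + Num.max (- a) 0 * Num.max (- b) 0.
Proof.
rewrite /Num.max !oppr_lt0.
case: (ltgtP a 0) => [ha|ha|->]; case: (ltgtP b 0) => [hb|hb|->];
  case: (ltP (_ * _) 0) => hab; rewrite ?(mul0r, mulr0, addr0, add0r)//; nra.
Qed.

Section Noise.
Context (d : measure_display) (T : measurableType d) (R : realType)
  (P : probability (T * R)%type R) (fstar var : T -> R) (sigma : R).
Local Open Scope ereal_scope.

Hypothesis mfstar : measurable_fun setT fstar.
Hypothesis hfstar : is_cond_exp (P := P) (@fst T R) snd fstar.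
Hypothesis hvar :
  is_cond_exp (P := P) (@fst T R) (fun w => (w.2 - fstar w.1) ^+ 2)%R var.
Hypothesis hsigma : forall x, (var x <= sigma ^+ 2)%R.

Definition noise (f : T -> R) (w : T * R) : R := (w.2 - f w.1)%R.
Local Notation eps := (noise fstar).

Let mXA A : measurable A -> measurable (@fst T R @^-1` A).
Proof. by move=> mA; rewrite -[X in measurable X]setTI; exact: measurable_fst. Qed.

Lemma measurable_noise : measurable_fun [set: T * R] eps.
Proof.
apply: measurable_funB; first exact: measurable_snd.
exact: measurableT_comp.
Qed.

Lemma integrable_noise_sqr : P.-integrable setT (EFin \o (fun w => eps w ^+ 2)%R).
Proof. by case: hvar. Qed.

Let ifstar : P.-integrable setT (EFin \o (fstar \o fst)).
Proof.
have [_ /integrableP[mf ifin] _] := hfstar.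
apply/integrableP; split.
  by apply/measurable_EFinP; apply: measurableT_comp.
move: ifin; rewrite ge0_integral_pushforward//.
by apply: measurableT_comp.
Qed.

Lemma integrable_noise : P.-integrable setT (EFin \o eps).
Proof.
have [i2 _ _] := hfstar.
have := @integrableB _ _ _ P setT measurableT _ _ i2 ifstar.
by apply: eq_integrable => // w _.
Qed.

Let noise0 A : measurable A -> \int[P]_(w in fst @^-1` A) (eps w)%:E = 0.
Proof.
move=> mA; have mA' := mXA mA.
have [i2 _ /(_ A mA) E2] := hfstar.
have i2A : P.-integrable (fst @^-1` A) (EFin \o snd).
  exact: integrableS i2.
have ifA : P.-integrable (fst @^-1` A) (EFin \o (fstar \o fst)).
  exact: integrableS ifstar.
rewrite [LHS](_ : _ = \int[P]_(w in fst @^-1` A)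
   ((snd w)%:E - (fstar (fst w))%:E)); last exact: eq_integral.
rewrite (integralB_EFin _ i2A ifA)// E2 integral_pushforward//.
- by rewrite subee// integrable_fin_num.
- exact/measurable_EFinP.
Qed.

Let ep w := Num.max (eps w) 0%R.
Let en w := Num.max (- eps w)%R 0%R.

Let mep : measurable_fun [set: T * R] ep.
Proof. by apply: measurable_maxr => //; exact: measurable_noise. Qed.
Let men : measurable_fun [set: T * R] en.
Proof. by apply: measurable_maxr => //; apply: measurableT_comp => //; exact: measurable_noise. Qed.
Let ep0 w : (0 <= ep w)%R. Proof. by rewrite le_max lexx orbT. Qed.
Let en0 w : (0 <= en w)%R. Proof. by rewrite le_max lexx orbT. Qed.

(** The residual has zero mean on every event determined by the input, so its
positive and negative parts have the same integral there. *)
Let epn A : measurable A ->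
  \int[P]_(w in fst @^-1` A) (ep w)%:E = \int[P]_(w in fst @^-1` A) (en w)%:E.
Proof.
move=> mA; have mA' := mXA mA.
have iA : P.-integrable (fst @^-1` A) (EFin \o eps).
  by apply: integrableS integrable_noise.
have := noise0 mA; rewrite integralE.
rewrite -[X in X - _](_ : \int[P]_(w in fst @^-1` A) (ep w)%:E = _); last first.
  by apply: eq_integral => w _; rewrite funeposE /ep -EFin_max.
rewrite -[X in _ - X](_ : \int[P]_(w in fst @^-1` A) (en w)%:E = _); last first.
  by apply: eq_integral => w _; rewrite funenegE /en -EFin_max.
have p0 : 0 <= \int[P]_(w in fst @^-1` A) (ep w)%:E.
  by apply: integral_ge0 => w _; rewrite lee_fin.
have n0 : 0 <= \int[P]_(w in fst @^-1` A) (en w)%:E.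
  by apply: integral_ge0 => w _; rewrite lee_fin.
move: (\int[P]_(w in _) _) (\int[P]_(w in _) _) p0 n0 => [p| |] [n| |]//= _ _ /eqP.
by rewrite eqe subr_eq0 => /eqP ->.
Qed.

(** Positive and negative parts of the residual have the same conditional mean, hence
the same integral against any nonnegative function of the input. *)
Lemma noise_centered (g : T -> R) : measurable_fun setT g ->
  P.-integrable setT (EFin \o (fun w => eps w * g w.1)%R) ->
  \int[P]_w (eps w * g w.1)%:E = 0.
Proof.
move=> mg ig.
have key (k : T -> R) : measurable_fun setT k -> (forall x, 0 <= k x)%R ->
    \int[P]_w (ep w * k w.1)%:E = \int[P]_w (en w * k w.1)%:E.
  move=> mk k0; apply/eqP; rewrite eq_le; apply/andP; split.
    apply: (le_integral_cond (@measurable_fst _ _ T R) mep men ep0 en0) => //.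
    by move=> A mA; rewrite epn.
  apply: (le_integral_cond (@measurable_fst _ _ T R) men mep en0 ep0) => //.
  by move=> A mA; rewrite epn.
pose gp x := Num.max (g x) 0%R; pose gn x := Num.max (- g x)%R 0%R.
have mgp : measurable_fun setT gp by exact: measurable_maxr.
have mgn : measurable_fun setT gn.
  by apply: measurable_maxr => //; exact: measurableT_comp.
have gp0 x : (0 <= gp x)%R by rewrite le_max lexx orbT.
have gn0 x : (0 <= gn x)%R by rewrite le_max lexx orbT.
have ig' := ig; move: ig' => /integrableP[_].
have mM (a : T * R -> R) (k : T -> R) : measurable_fun setT a ->
    measurable_fun setT k -> measurable_fun setT (fun w => (a w * k w.1)%:E).
  move=> ma mk; apply/measurable_EFinP; apply: measurable_funM => //.
  exact: measurableT_comp.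
have posE : \int[P]_w (EFin \o (fun w => eps w * g w.1)%R)^\+ w =
    \int[P]_w (ep w * gp w.1)%:E + \int[P]_w (en w * gn w.1)%:E.
  rewrite -ge0_integralD//; first last.
  - exact: mM.
  - by move=> w _; rewrite lee_fin mulr_ge0.
  - exact: mM.
  - by move=> w _; rewrite lee_fin mulr_ge0.
  by apply: eq_integral => w _; rewrite funeposE -EFin_max max0M EFinD.
have negE : \int[P]_w (EFin \o (fun w => eps w * g w.1)%R)^\- w =
    \int[P]_w (en w * gp w.1)%:E + \int[P]_w (ep w * gn w.1)%:E.
  rewrite -ge0_integralD//; first last.
  - exact: mM.
  - by move=> w _; rewrite lee_fin mulr_ge0.
  - exact: mM.
  - by move=> w _; rewrite lee_fin mulr_ge0.
  apply: eq_integral => w _; rewrite funenegE -EFin_max -mulNr max0M EFinD.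
  by rewrite opprK.
move=> _; rewrite integralE posE negE !key// subee//.
by rewrite -(key gn)// -negE integrable_neg_fin_num.
Qed.

Lemma noise_variance (g : T -> R) :
  measurable_fun setT g -> (forall x, 0 <= g x)%R ->
  \int[P]_w (eps w ^+ 2 * g w.1)%:E <= \int[P]_w (sigma ^+ 2 * g w.1)%:E.
Proof.
move=> mg g0; have me := measurable_noise.
apply: (le_integral_cond (@measurable_fst _ _ T R)) => //.
- exact: measurable_funX.
- by move=> w; exact: sqr_ge0.
- by move=> w; exact: sqr_ge0.
move=> A mA; have [_ iv /(_ A mA) ->] := hvar.
have := ge0_integral_pushforward (@measurable_fst _ _ T R) P mA
   (f := fun=> (sigma ^+ 2)%:E).
move=> /(_ _ _)/= <-//; last by move=> x _; rewrite lee_fin sqr_ge0.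
apply: le_integral => //.
- exact: integrableS iv.
- apply: (@integrableS _ _ _ _ setT) => //.
  exact: finite_measure_integrable_cst.
- by move=> x _; rewrite lee_fin.
Qed.

Section ProductLaw.
Context (N : nat) (mu : probability (N.-tuple (T * R)%type) R).
Hypothesis hmu : is_product_law P mu.

(** [G] sees the response at coordinate [a] only through the input, so that, with the
other coordinates fixed, it can be treated as a function of the input alone. *)
Definition thru_input (a : 'I_N) (G : N.-tuple (T * R) -> R) : Prop :=
  forall z z' t, z.1 = z'.1 -> G (upd a z t) = G (upd a z' t).

Lemma measurable_tnth_comp (a : 'I_N) d' (U : measurableType d') (f : T * R -> U) :
  measurable_fun setT f ->
  measurable_fun [set: N.-tuple (T * R)] (fun t => f (tnth t a)).
Proof. by move=> mf; apply: measurableT_comp mf (measurable_tnth a). Qed.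

Lemma integral_tnth (a : 'I_N) (F : T * R -> \bar R) :
  measurable_fun setT F -> (forall z, 0 <= F z) ->
  \int[mu]_t F (tnth t a) = \int[P]_z F z.
Proof.
move=> mF F0; rewrite (resample hmu a)//; last exact: measurable_tnth_comp.
under eq_integral do under eq_integral do rewrite tnth_upd eqxx.
by rewrite integral_cst// [X in _ * X]probability_setT mule1.
Qed.

Let pt (x : T) : (T * R)%type := (x, 0%R).

Let measurable_slice (a : 'I_N) (t : N.-tuple (T * R)) (G : N.-tuple (T * R) -> R) :
  measurable_fun setT G -> measurable_fun setT (fun x : T => G (upd a (pt x) t)).
Proof.
move=> mG; apply: (measurableT_comp mG).
have mu1 := measurable_upd (E := (T * R)%type) a.
apply: (measurableT_comp (measurable_fun_pair2 t mu1)).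
exact: pair2_measurable.
Qed.

Let slice_input a t (G : N.-tuple (T * R) -> R) (z : T * R) : thru_input a G ->
  G (upd a z t) = G (upd a (pt z.1) t).
Proof. by move=> hG; apply: hG. Qed.

Lemma noise_centered_tuple (a : 'I_N) (G : N.-tuple (T * R) -> R) :
  measurable_fun setT G -> thru_input a G ->
  (forall t, P.-integrable setT (EFin \o (fun z => eps z * G (upd a z t))%R)) ->
  mu.-integrable setT (EFin \o (fun t => eps (tnth t a) * G t)%R) ->
  \int[mu]_t (eps (tnth t a) * G t)%:E = 0.
Proof.
move=> mG hG iz it; apply: (resample_eq0 hmu (a := a)) => // t.
under eq_integral do rewrite tnth_upd eqxx (slice_input _ _ hG).
apply: (noise_centered (g := fun x => G (upd a (pt x) t))).
  exact: measurable_slice.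
apply: eq_integrable (iz t) => // z _ /=.
by rewrite (slice_input _ _ hG).
Qed.

Lemma noise_variance_tuple (a : 'I_N) (G : N.-tuple (T * R) -> R) :
  measurable_fun setT G -> thru_input a G -> (forall t, 0 <= G t)%R ->
  \int[mu]_t (eps (tnth t a) ^+ 2 * G t)%:E <=
  (sigma ^+ 2)%:E * \int[mu]_t (G t)%:E.
Proof.
move=> mG hG G0; have me := measurable_noise.
have me2 : measurable_fun [set: N.-tuple (T * R)] (fun t => eps (tnth t a) ^+ 2)%R.
  by apply: measurable_funX; exact: measurable_tnth_comp.
have mGE : measurable_fun setT (EFin \o G) by exact/measurable_EFinP.
rewrite -ge0_integralZl_EFin//; first last.
- by rewrite sqr_ge0.
- by move=> t _; rewrite lee_fin.
rewrite (resample hmu a); last 2 first.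
- by apply/measurable_EFinP; exact: measurable_funM.
- by move=> t; rewrite lee_fin mulr_ge0// sqr_ge0.
rewrite [leRHS](resample hmu a); last 2 first.
- by apply: measurable_funeM.
- by move=> t; rewrite mule_ge0// lee_fin// sqr_ge0.
apply: ge0_le_integral_any => t.
  by apply: integral_ge0 => z _; rewrite lee_fin mulr_ge0// sqr_ge0.
under eq_integral do rewrite tnth_upd eqxx (slice_input _ _ hG).
under [leRHS]eq_integral do rewrite (slice_input _ _ hG).
exact: (noise_variance (measurable_slice a t mG)).
Qed.

End ProductLaw.
End Noise.

(** * Reproducing kernel Hilbert spaces *)

Lemma cvg_sqrt_harmonic (R : realType) :
  (Num.sqrt n.+1%:R^-1 : R) @[n --> \oo] --> (0 : R).
Proof.
rewrite -[X in _ --> X](sqrtr0 R).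
exact: continuous_cvg (@sqrt_continuous R 0) (@cvg_harmonic R).
Qed.

Section RKHS.
Context (T : Type) (R : realType) (K : T -> T -> R) (H : set (T -> R))
  (ip : (T -> R) -> (T -> R) -> R).
Hypothesis hH : is_rkhs K H ip.

Let H0 := rkhs_zero hH.

Lemma rkhsD f g : H f -> H g -> H (fun x => f x + g x).
Proof.
move=> Hf Hg; have := rkhs_lin hH 1 Hf Hg.
by congr H; apply/funext => x; rewrite mul1r.
Qed.

Lemma rkhsZ a f : H f -> H (fun x => a * f x).
Proof.
move=> Hf; have := rkhs_lin hH a Hf H0.
by congr H; apply/funext => x; rewrite addr0.
Qed.

Lemma rkhsB f g : H f -> H g -> H (fun x => f x - g x).
Proof.
move=> Hf Hg; have := rkhsD Hf (rkhsZ (-1) Hg).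
by congr H; apply/funext => x; rewrite mulN1r.
Qed.

Lemma rkhs_ipD f g h : H f -> H g -> H h ->
  ip (fun x => f x + g x) h = ip f h + ip g h.
Proof.
move=> Hf Hg Hh; rewrite -[ip f h]mul1r -(rkhs_ip_lin hH)//.
by congr ip; apply/funext => x; rewrite mul1r.
Qed.

Lemma rkhs_ip0l h : H h -> ip (fun=> 0) h = 0.
Proof.
move=> Hh; have := rkhs_ipD H0 H0 Hh.
rewrite (_ : (fun x : T => 0 + 0) = fun=> 0 :> R); last first.
  by apply/funext => x; rewrite addr0.
by move/eqP; rewrite -subr_eq subrr eq_sym => /eqP.
Qed.

Lemma rkhs_ipZ a f h : H f -> H h -> ip (fun x => a * f x) h = a * ip f h.
Proof.
move=> Hf Hh; have := rkhs_ip_lin hH a Hf H0 Hh.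
by rewrite rkhs_ip0l// addr0 => <-; congr ip; apply/funext => x; rewrite addr0.
Qed.

Lemma rkhs_ipB f g h : H f -> H g -> H h ->
  ip (fun x => f x - g x) h = ip f h - ip g h.
Proof.
move=> Hf Hg Hh; rewrite -[- ip g h]mulN1r -rkhs_ipZ// -rkhs_ipD//; last first.
  exact: rkhsZ.
by congr ip; apply/funext => x; rewrite mulN1r.
Qed.

Lemma rkhs_sqrB f g : H f -> H g ->
  ip (fun x => f x - g x) (fun x => f x - g x) = ip f f - 2 * ip f g + ip g g.
Proof.
move=> Hf Hg; have HB := rkhsB Hf Hg.
rewrite rkhs_ipB// (rkhs_ip_sym hH Hf HB) (rkhs_ip_sym hH Hg HB).
by rewrite !rkhs_ipB// (rkhs_ip_sym hH Hg Hf); ring.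
Qed.

Lemma rkhs_sqrD f g : H f -> H g ->
  ip (fun x => f x + g x) (fun x => f x + g x) = ip f f + 2 * ip f g + ip g g.
Proof.
move=> Hf Hg; have HB := rkhsD Hf Hg.
rewrite rkhs_ipD// (rkhs_ip_sym hH Hf HB) (rkhs_ip_sym hH Hg HB).
by rewrite !rkhs_ipD// (rkhs_ip_sym hH Hg Hf); ring.
Qed.

Lemma ip_normE f : H f -> ip_norm ip f ^+ 2 = ip f f.
Proof. by move=> Hf; rewrite sqr_sqrtr// (rkhs_ip_ge0 hH). Qed.

(** The quadratic polynomial t |-> |r - t h|^2 is at least |r|^2 - e; evaluating it at
its minimizer t = <r, h> / |h|^2 gives the bound. For e = |r|^2 this is the
Cauchy-Schwarz inequality, and for a near-minimizer of a distance to a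
subspace it is approximate orthogonality. *)
Lemma rkhs_near_minimal r h e : H r -> H h ->
  (forall t, ip r r - e <= ip (fun x => r x - t * h x) (fun x => r x - t * h x)) ->
  ip r h ^+ 2 <= e * ip h h.
Proof.
move=> Hr Hh min.
have {}min t : 2 * t * ip r h <= t ^+ 2 * ip h h + e.
  have := min t; rewrite rkhs_sqrB//; last exact: rkhsZ.
  have HZ := rkhsZ t Hh.
  rewrite (rkhs_ip_sym hH Hr HZ) !rkhs_ipZ// (rkhs_ip_sym hH Hh HZ).
  by rewrite rkhs_ipZ// (rkhs_ip_sym hH Hh Hr) => ?; lra.
have [h0|h0] := eqVneq (ip h h) 0.
  have h00 := rkhs_ip_eq0 hH Hh h0.
  by rewrite h0 mulr0 h00 (rkhs_ip_sym hH Hr H0) rkhs_ip0l// expr0n.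
have {h0} : 0 < ip h h by rewrite lt_neqAle eq_sym h0 (rkhs_ip_ge0 hH).
move=> hp; have := min (ip r h / ip h h).
rewrite -(ler_pM2r hp).
have -> : 2 * (ip r h / ip h h) * ip r h * ip h h = 2 * ip r h ^+ 2.
  by field; rewrite gt_eqF.
have -> : ((ip r h / ip h h) ^+ 2 * ip h h + e) * ip h h =
  ip r h ^+ 2 + e * ip h h by field; rewrite gt_eqF.
lra.
Qed.

Lemma rkhs_cauchy_schwarz f h : H f -> H h -> ip f h ^+ 2 <= ip f f * ip h h.
Proof.
move=> Hf Hh; apply: rkhs_near_minimal => // t; rewrite subrr.
by apply: (rkhs_ip_ge0 hH); apply: rkhsB => //; exact: rkhsZ.
Qed.

Definition kernel_comb (s : seq (R * T)) : T -> R :=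
  fun y => \sum_(p <- s) p.1 * K p.2 y.

Lemma kernel_combH s : H (kernel_comb s).
Proof.
elim: s => [|p s IH].
  by rewrite (_ : kernel_comb [::] = fun=> 0)//; apply/funext => y; rewrite /kernel_comb big_nil.
have := rkhs_lin hH p.1 (rkhs_kernel hH p.2) IH.
by congr H; apply/funext => y; rewrite /kernel_comb big_cons.
Qed.

Lemma ip_kernel_comb s h : H h ->
  ip (kernel_comb s) h = \sum_(p <- s) p.1 * h p.2.
Proof.
move=> Hh; elim: s => [|p s IH].
  rewrite big_nil (_ : kernel_comb [::] = fun=> 0) ?rkhs_ip0l//.
  by apply/funext => y; rewrite /kernel_comb big_nil.
rewrite big_cons -IH (_ : kernel_comb (p :: s) = fun y => p.1 * K p.2 y + kernel_comb s y).
  rewrite (rkhs_ip_lin hH)//; [|exact: (rkhs_kernel hH)|exact: kernel_combH].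
  by rewrite (rkhs_ip_sym hH (rkhs_kernel hH _) Hh) (rkhs_reproducing hH).
by apply/funext => y; rewrite /kernel_comb big_cons.
Qed.

Lemma rkhs_eval_le f x : H f -> f x ^+ 2 <= ip f f * K x x.
Proof.
move=> Hf; rewrite -(rkhs_reproducing hH x Hf).
apply: le_trans (rkhs_cauchy_schwarz Hf (rkhs_kernel hH x)) _.
by rewrite (rkhs_reproducing hH x (rkhs_kernel hH x)).
Qed.

(** Let s_n almost minimize |f - g|_H^2 over kernel combinations g, up to 1/(n+1). By
[rkhs_near_minimal] the residual is almost orthogonal to every K_x, which gives
pointwise convergence, and to g itself, which bounds |g|_H. *)
Lemma kernel_comb_dense f : H f -> exists s : nat -> seq (R * T),
  (forall x, (kernel_comb (s n) x @[n --> \oo] --> f x)) /\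
  (forall n, ip (kernel_comb (s n)) (kernel_comb (s n)) <=
             (ip_norm ip f + Num.sqrt n.+1%:R^-1) ^+ 2).
Proof.
move=> Hf; pose r s x := f x - kernel_comb s x.
have Hr s : H (r s) by exact: rkhsB (kernel_combH s).
pose D := [set ip (r s) (r s) | s in [set: seq (R * T)]].
have hD : has_inf D.
  split; first by exists (ip (r [::]) (r [::])); exists [::].
  by exists 0 => _ [s _ <-]; exact: (rkhs_ip_ge0 hH).
have hs n : {s | ip (r s) (r s) < inf D + n.+1%:R^-1}.
  apply: cid; have n0 : (0 : R) < n.+1%:R^-1 by rewrite invr_gt0.
  by have [_ [s _ <-] ?] := inf_adherent n0 hD; exists s.
pose s n := sval (hs n).
have near n t : ip (r (s n)) (kernel_comb t) ^+ 2 <=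
    n.+1%:R^-1 * ip (kernel_comb t) (kernel_comb t).
  apply: rkhs_near_minimal; [exact: Hr|exact: kernel_combH|] => c.
  have -> : (fun x => r (s n) x - c * kernel_comb t x) =
      r (s n ++ [seq (c * p.1, p.2) | p <- t]).
    apply/funext => x; rewrite /r /kernel_comb big_cat big_map/= mulr_sumr opprD addrA.
    by congr (_ - _); apply: eq_bigr => p _; rewrite mulrA.
  rewrite lerBlDr; apply: le_trans (ltW (svalP (hs n))) _.
  by rewrite lerD2r; apply: ge_inf; [have [] := hD|exists (s n ++ [seq (c * p.1, p.2) | p <- t])].
exists s; split=> [x|n].
- have bnd n : `|kernel_comb (s n) x - f x| <= Num.sqrt (K x x) * Num.sqrt n.+1%:R^-1.
    have := near n [:: (1, x)].
    have -> : kernel_comb [:: (1, x)] = K x.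
      by apply/funext => y; rewrite /kernel_comb big_seq1 mul1r.
    rewrite !(rkhs_reproducing hH)//; last exact: (rkhs_kernel hH).
    rewrite -sqrtrM ?invr_ge0//; last first.
      by rewrite -(rkhs_reproducing hH x (rkhs_kernel hH x)) (rkhs_ip_ge0 hH)//; exact: (rkhs_kernel hH).
    by rewrite distrC -[`|_|]sqrtr_sqr => le; apply: ler_wsqrtr; rewrite mulrC.
  apply/subr_cvg0; apply/norm_cvg0P.
  apply: (@squeeze_cvgr _ _ _ _ (fun=> 0) (fun n => Num.sqrt (K x x) * Num.sqrt n.+1%:R^-1)).
  - by near=> n; rewrite normr_ge0/=.
  - exact: cvg_cst.
  - rewrite -[X in _ --> X](mulr0 (Num.sqrt (K x x))); apply: cvgMl_tmp.
    exact: cvg_sqrt_harmonic.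
- set g := kernel_comb _; have Hg : H g by exact: kernel_combH.
  have G0 := rkhs_ip_ge0 hH Hg; have F0 := rkhs_ip_ge0 hH Hf.
  have := near n (s n); rewrite -/g => le1.
  have le2 := rkhs_cauchy_schwarz Hf Hg.
  have E : ip g g = ip f g - ip (r (s n)) g.
    by rewrite rkhs_ipB//; ring.
  have [->|gn0] := eqVneq (ip g g) 0; first exact: sqr_ge0.
  set G := Num.sqrt (ip g g); set e := Num.sqrt _.
  have GG : G ^+ 2 = ip g g by rewrite sqr_sqrtr.
  have Gp : 0 < G by rewrite sqrtr_gt0 lt_neqAle eq_sym gn0.
  have leabs a b : a ^+ 2 <= b * ip g g -> 0 <= b -> `|a| <= Num.sqrt b * G.
    by move=> ab b0; rewrite -sqrtr_sqr -sqrtrM// ler_wsqrtr.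
  have l2 := leabs _ _ le2 F0.
  have l1 : `|ip (r (s n)) g| <= e * G by apply: leabs le1 _; rewrite invr_ge0.
  rewrite -GG ler_sqr ?nnegrE ?addr_ge0 ?sqrtr_ge0// -(ler_pM2r Gp) -expr2 GG E.
  move: l1 l2; rewrite /ip_norm !ler_norml => /andP[? ?] /andP[? ?].
  by rewrite mulrDl; lra.
Unshelve. all: by end_near. Qed.

End RKHS.

(** * Mercer series and L2 norms of elements of the RKHS *)

Section SquareIntegrable.
Context (d : measure_display) (T : measurableType d) (R : realType)
  (P : probability T R).

Lemma Lfun_measurable (p : \bar R) (f : T -> R) :
  f \in Lfun P p -> measurable_fun setT f.
Proof. by rewrite inE => /andP[/[!inE]]. Qed.

Lemma sqr_L2norm (f : T -> R) :
  (L2norm P f ^+ 2 = \int[P]_x (f x ^+ 2)%:E)%E.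
Proof.
rewrite /L2norm.
have := @poweR_Lnorm _ _ _ P (EFin \o f) 2 (lt0r_neq0 (ltr0n R 2)).
rewrite (_ : poweR _ _ = 'N[P]_2%:E [EFin \o f] ^+ 2)%E; last first.
  have := Lnorm_ge0 P 2%:E (EFin \o f).
  case: ('N[P]_2%:E [EFin \o f])%E => [r| |]//=.
    by rewrite lee_fin => r0; rewrite powR_mulrn// expr2 expe2 EFinM.
  by move=> _; rewrite gt_eqF// expe2 mulyy.
move=> ->; apply: eq_integral => x _ /=.
by rewrite powR_mulrn// -normrX ger0_norm// sqr_ge0.
Qed.

(** Lower semicontinuity of the L2 norm under pointwise convergence. *)
Lemma fatou_sqr (u : nat -> T -> R) (f : T -> R) (r : nat -> R) (l : R) :
  (forall n, measurable_fun setT (u n)) ->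
  (forall x, u n x @[n --> \oo] --> f x) ->
  (forall n, (\int[P]_x (u n x ^+ 2)%:E <= (r n)%:E)%E) ->
  r n @[n --> \oo] --> l ->
  (\int[P]_x (f x ^+ 2)%:E <= l%:E)%E.
Proof.
move=> mu uf ur rl.
rewrite (_ : \int[P]_x _ = \int[P]_x limn_einf (fun n => (u n x ^+ 2)%:E))%E; last first.
  apply: eq_integral => x _; apply/esym.
  have ufx : (u n x ^+ 2)%:E @[n --> \oo] --> (f x ^+ 2)%:E.
    apply: cvg_EFin; first by near=> n.
    rewrite /comp /= expr2; under eq_fun do rewrite expr2.
    by apply: cvgM.
  by have [-> _] := cvg_limn_einf_sup ufx.
apply: le_trans.
  apply: fatou => //.
  - by move=> n; apply/measurable_EFinP; exact: measurable_funX.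
  - by move=> n x _; rewrite lee_fin sqr_ge0.
rewrite limn_einf_lim.
have rl' : (r n)%:E @[n --> \oo] --> l%:E by apply: cvg_EFin => //; near=> n.
rewrite -(cvg_lim _ rl')//; apply: lee_lim.
- exact: is_cvg_einfs.
- by apply/cvg_ex; eexists; exact: rl'.
- near=> n; apply: le_trans (ur n); apply: ereal_inf_lbound => /=.
  by exists n => /=.
Unshelve. all: by end_near. Qed.

Variable phi : nat -> T -> R.
Hypothesis hphi : is_orthonormal_basis P phi.

Lemma integral_sqr_sum (a : nat -> R) J :
  (\int[P]_x ((\sum_(0 <= j < J) a j * phi j x) ^+ 2)%:E =
   (\sum_(0 <= j < J) a j ^+ 2)%:E)%E.
Proof.
have iphi i j : P.-integrable setT (EFin \o (phi i \* phi j)).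
  apply/Lfun1_integrable; apply: Lfun2_mul_Lfun1; exact: (onb_L2 hphi).
have iZ c i j : P.-integrable setT (fun x => c%:E * (phi i x * phi j x)%:E)%E.
  exact: (@integrableZl _ _ _ P setT measurableT c _ (iphi i j)).
transitivity (\int[P]_x (\sum_(0 <= i < J) \sum_(0 <= j < J)
    (a i * a j)%:E * (phi i x * phi j x)%:E))%E.
  apply: eq_integral => x _; rewrite expr2 big_distrl/= -sumEFin.
  apply: eq_bigr => i _; rewrite big_distrr/= -sumEFin.
  by apply: eq_bigr => j _; rewrite -EFinM mulrACA.
rewrite integral_sum//; last first.
  by move=> i; apply: integrable_sum => // j _; exact: iZ.
rewrite -sumEFin; apply: eq_big_nat => i /andP[_ iJ].
rewrite integral_sum//.
rewrite (bigD1_seq i) ?iota_uniq ?mem_index_iota//=.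
rewrite big1 ?adde0 => [|j /negbTE ji].
  by rewrite (integralZl measurableT (iphi _ _)) (onb_orthonormal hphi) eqxx -EFinM mulr1.
by rewrite (integralZl measurableT (iphi _ _)) (onb_orthonormal hphi) eq_sym ji -EFinM mulr0.
Qed.

Variables (K : T -> T -> R) (H : set (T -> R))
  (ip : (T -> R) -> (T -> R) -> R) (mu : nat -> R).
Hypotheses (hH : is_rkhs K H ip) (hL2 : forall f, H f -> f \in Lfun P 2%:E)
  (hK : has_mercer_expansion K mu phi) (mu0 : forall j, 0 <= mu j).

(** mu_j times this number is the j-th coefficient of the kernel combination on the
basis phi, and its square times mu_j is the j-th term of the squared RKHS norm. *)
Definition mercer_coef (s : seq (R * T)) (j : nat) : R :=
  \sum_(p <- s) p.1 * phi j p.2.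

Lemma cvg_kernel_comb s x :
  \sum_(0 <= j < J) mu j * mercer_coef s j * phi j x @[J --> \oo] -->
  kernel_comb K s x.
Proof.
elim: s => [|p s IH].
  rewrite /kernel_comb big_nil /mercer_coef.
  under eq_fun do under eq_bigr do rewrite big_nil mulr0 mul0r.
  under eq_fun do rewrite big1//; exact: cvg_cst.
rewrite /kernel_comb big_cons -/(kernel_comb K s x).
rewrite (_ : (fun J => _) = (fun J =>
    p.1 * series (fun j => mu j * phi j p.2 * phi j x) J +
    \sum_(0 <= j < J) mu j * mercer_coef s j * phi j x)); last first.
  apply/funext => J; rewrite /series/= mulr_sumr -big_split/=.
  by apply: eq_bigr => j _; rewrite /mercer_coef big_cons; ring.
by apply: cvgD => //; apply: cvgMl_tmp; exact: hK.
Qed.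

Lemma cvg_kernel_comb_norm s :
  \sum_(0 <= j < J) mu j * mercer_coef s j ^+ 2 @[J --> \oo] -->
  ip (kernel_comb K s) (kernel_comb K s).
Proof.
rewrite (ip_kernel_comb hH)//; last exact: kernel_combH hH _.
rewrite (_ : (fun J => _) = (fun J => \sum_(p <- s) p.1 *
    \sum_(0 <= j < J) mu j * mercer_coef s j * phi j p.2)); last first.
  apply/funext => J; under [RHS]eq_bigr do rewrite mulr_sumr.
  rewrite exchange_big/=; apply: eq_bigr => j _.
  rewrite expr2 mulrA {2}/mercer_coef mulr_sumr.
  by apply: eq_bigr => p _; ring.
apply: cvg_big => //; first exact: add_continuous.
by move=> p _; apply: cvgMl_tmp; exact: cvg_kernel_comb.
Qed.

(** An inequality between the L2 norm, finitely many point evaluations and the RKHS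
norm that holds for finite combinations of the phi_j holds on all of H. It passes
to kernel combinations along their Mercer series, and then to H along the
approximations of [kernel_comb_dense]; both times the left-hand side is handled
by Fatou's lemma and the right-hand side converges. *)
Lemma rkhs_L2_le (A B : R) (xs : seq T) : 0 <= A -> 0 <= B ->
  (forall (c : nat -> R) J, \sum_(0 <= j < J) (mu j * c j) ^+ 2 <=
     A * (\sum_(x <- xs) (\sum_(0 <= j < J) mu j * c j * phi j x) ^+ 2) +
     B * \sum_(0 <= j < J) mu j * c j ^+ 2) ->
  forall f, H f -> (\int[P]_x (f x ^+ 2)%:E <=
    (A * (\sum_(x <- xs) f x ^+ 2) + B * ip f f)%:E)%E.
Proof.
move=> A0 B0 AB f Hf.
have mphi j : measurable_fun setT (phi j) by apply: Lfun_measurable (onb_L2 hphi j).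
have spanle s : (\int[P]_x (kernel_comb K s x ^+ 2)%:E <=
    (A * (\sum_(x <- xs) kernel_comb K s x ^+ 2) +
     B * ip (kernel_comb K s) (kernel_comb K s))%:E)%E.
  pose c := mercer_coef s.
  apply: (fatou_sqr (u := fun J x => \sum_(0 <= j < J) mu j * c j * phi j x)
    (r := fun J => A * (\sum_(x <- xs) (\sum_(0 <= j < J) mu j * c j * phi j x) ^+ 2)
     + B * \sum_(0 <= j < J) mu j * c j ^+ 2)).
  - by move=> J; apply: measurable_sum => j; exact: measurable_funM.
  - exact: cvg_kernel_comb.
  - by move=> J; rewrite integral_sqr_sum lee_fin.
  - apply: cvgD; apply: cvgMl_tmp; last exact: cvg_kernel_comb_norm.
    apply: cvg_big => //; first exact: add_continuous.
    move=> x _; rewrite expr2; under eq_fun do rewrite expr2.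
    by apply: cvgM; exact: cvg_kernel_comb.
have [s [sf sn]] := kernel_comb_dense hH Hf.
apply: (fatou_sqr (u := fun n => kernel_comb K (s n))
  (r := fun n => A * (\sum_(x <- xs) kernel_comb K (s n) x ^+ 2) +
     B * (ip_norm ip f + Num.sqrt n.+1%:R^-1) ^+ 2)) => //.
- by move=> n; apply: Lfun_measurable (hL2 (kernel_combH hH _)).
- by move=> n; apply: le_trans (spanle _) _; rewrite lee_fin lerD2l ler_wpM2l.
- apply: cvgD; apply: cvgMl_tmp.
    apply: cvg_big => //; first exact: add_continuous.
    move=> x _; rewrite expr2; under eq_fun do rewrite expr2.
    by apply: cvgM.
  rewrite -(ip_normE hH Hf) -[X in (X ^+ 2)]addr0 expr2.
  under eq_fun do rewrite expr2.
  by apply: cvgM; apply: cvgD; (exact: cvg_cst || exact: cvg_sqrt_harmonic).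
Qed.

End SquareIntegrable.

(** * Kernel ridge regression in closed form *)

Section Ridge.
Context (T : Type) (R : realType) (K : T -> T -> R) (H : set (T -> R))
  (ip : (T -> R) -> (T -> R) -> R).
Hypotheses (hH : is_rkhs K H ip) (hpsd : psd_kernel K).
Variables (N : nat) (S : {set 'I_N}) (lam : R).
Hypotheses (lam0 : 0 < lam) (S0 : (0 < #|S|)%N).
Local Notation n := (#|S|%:R : R).

Let n0 : 0 < n. Proof. by rewrite ltr0n. Qed.
Let nlam0 : 0 < n * lam. Proof. by rewrite mulr_gt0. Qed.

(** The system of kernel ridge regression, extended to all indices by a multiple of
the identity outside [S], so that the matrix has the fixed size N. *)
Definition ridge_mx (x : 'I_N -> T) : 'M[R]_N :=
  \matrix_(a, b) ((a \in S)%:R * (b \in S)%:R * K (x a) (x b) +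
                  #|S|%:R * lam * (a == b)%:R).

Definition ridge_coef (x : 'I_N -> T) (y : 'I_N -> R) (b : 'I_N) : R :=
  \sum_(a < N) invmx (ridge_mx x) b a * ((a \in S)%:R * y a).

Definition ridge (x : 'I_N -> T) (y : 'I_N -> R) : T -> R :=
  kernel_comb K [seq (ridge_coef x y b, x b) | b <- enum S].

(** The matrix is positive definite: the kernel part is semidefinite and the diagonal
part is a positive multiple of the identity. *)
Lemma ridge_mx_unit x : ridge_mx x \in unitmx.
Proof.
rewrite -row_free_unit; apply: inj_row_free => v vM.
have E : \sum_(a < N) v 0 a ^+ 2 = 0.
  have := congr1 (fun w => (w *m v^T) 0 0) vM; rewrite mul0mx [RHS]mxE.
  rewrite mxE => E.
  have := hpsd.2 N x (fun a => (a \in S)%:R * v 0 a).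
  have {}E : \sum_(i < N) \sum_(j < N) (i \in S)%:R * v 0 i * ((j \in S)%:R * v 0 j) *
      K (x i) (x j) + #|S|%:R * lam * \sum_(a < N) v 0 a ^+ 2 = 0.
    rewrite -[RHS]E exchange_big mulr_sumr -big_split/=; apply: eq_bigr => j _.
    rewrite [in RHS]mxE [v^T _ _]mxE mulr_suml.
    under [RHS]eq_bigr do rewrite mxE mulrDr mulrDl.
    rewrite big_split/=; congr (_ + _); first by apply: eq_bigr => i _; ring.
    rewrite (bigD1 j)//= eqxx big1 => [|i /negbTE ->]; last by rewrite !(mulr0, mul0r).
    by rewrite addr0 mulr1; ring.
  move=> psd; apply/eqP; rewrite eq_le sumr_ge0 ?andbT; last first.
    by move=> a _; exact: sqr_ge0.
  by rewrite -(pmulr_rle0 _ nlam0); move: psd E; set A := \sum_(i < N) _; set B := _ * _; lra.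
apply/rowP => a; rewrite mxE; apply/eqP; rewrite -sqrf_eq0.
move/eqP: E; rewrite psumr_eq0; last by move=> b _; exact: sqr_ge0.
by move=> /allP/(_ a); rewrite mem_index_enum => /(_ isT).
Qed.

Lemma ridgeH x y : H (ridge x y).
Proof. exact: kernel_combH hH _. Qed.

Lemma ridgeE x y u : ridge x y u = \sum_(b in S) ridge_coef x y b * K (x b) u.
Proof. by rewrite /ridge /kernel_comb big_map big_enum. Qed.

Lemma ridge_system x y a : a \in S ->
  ridge x y (x a) + n * lam * ridge_coef x y a = y a.
Proof.
move=> aS; pose Y := \col_a ((a \in S)%:R * y a).
have /(congr1 (fun w : 'cV[R]_N => w a 0)) := mulKVmx (ridge_mx_unit x) Y.
rewrite [RHS]mxE aS mul1r => <-; rewrite mxE.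
have cE b : (invmx (ridge_mx x) *m Y) b 0 = ridge_coef x y b.
  by rewrite mxE; apply: eq_bigr => c _; rewrite [Y _ _]mxE.
under [RHS]eq_bigr do rewrite cE mxE aS mul1r mulrDl.
rewrite big_split/= ridgeE; congr (_ + _).
  rewrite big_mkcond; apply: eq_bigr => b _; rewrite hpsd.1.
  by case: (b \in S); rewrite ?mul1r ?mul0r// mulrC.
rewrite (bigD1 a)//= eqxx big1 => [|b]; first by rewrite addr0 mulr1.
by rewrite eq_sym => /negbTE ->; rewrite mulr0 mul0r.
Qed.

(** The first-order condition for the ridge objective, tested in the direction h. *)
Lemma ridge_normal_eq x y h : H h ->
  \sum_(a in S) (ridge x y (x a) - y a) * h (x a) + n * lam * ip (ridge x y) h = 0.
Proof.
move=> Hh; rewrite (ip_kernel_comb hH)// big_map big_enum/= mulr_sumr -big_split/=.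
by apply: big1 => a aS; rewrite -(ridge_system x y aS); ring.
Qed.

(** By the first-order condition the objective at g exceeds its value at the explicit
solution by a quadratic form in the difference, which vanishes only when g is that
solution. Hence the minimizer exists, is unique and is given by the formula. *)
Lemma krrE (z : 'I_N -> T * R) :
  krr H ip z S lam = ridge (fun i => (z i).1) (fun i => (z i).2).
Proof.
set x := fun i => (z i).1; set y := fun i => (z i).2; set f := ridge x y.
have Hf : H f by exact: ridgeH.
have J g : H g -> krr_objective ip z S lam g = krr_objective ip z S lam f +
    (n^-1 * \sum_(a in S) (g (x a) - f (x a)) ^+ 2 +
     lam * ip (fun u => g u - f u) (fun u => g u - f u)).
  move=> Hg; have Hh := rkhsB hH Hg Hf; pose h u := g u - f u.
  have E : \sum_(a in S) (f (x a) - y a) * h (x a) = - (n * lam * ip f h).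
    by have := ridge_normal_eq x y Hh => /eqP; rewrite addr_eq0 => /eqP.
  have -> : krr_objective ip z S lam g = n^-1 * (\sum_(a in S) (f (x a) - y a) ^+ 2 +
      2 * (\sum_(a in S) (f (x a) - y a) * h (x a)) + \sum_(a in S) h (x a) ^+ 2) +
      lam * (ip f f + 2 * ip f h + ip h h).
    rewrite /krr_objective (ip_normE hH)//; congr (_ * _ + _ * _).
      rewrite mulr_sumr -!big_split/=; apply: eq_bigr => a _.
      by rewrite -/(x a) -/(y a) /h; ring.
    rewrite -(rkhs_sqrD hH)//; congr ip; apply/funext => u; rewrite /h; ring.
  rewrite /krr_objective (ip_normE hH)// -/(h) E.
  by field; rewrite gt_eqF.
have D0 h : H h -> 0 <= n^-1 * (\sum_(a in S) h (x a) ^+ 2) + lam * ip h h.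
  move=> Hh; rewrite addr_ge0// mulr_ge0// ?(ltW lam0) ?invr_ge0 ?(ltW n0)//.
    by apply: sumr_ge0 => a _; exact: sqr_ge0.
  exact: (rkhs_ip_ge0 hH).
rewrite /krr; apply: xget_unique.
  by split=> // g Hg; rewrite (J g Hg) lerDl; exact: D0 (rkhsB hH Hg Hf).
move=> g [Hg gmin]; have := gmin f Hf; rewrite (J g Hg) gerDl => le0.
have Hh := rkhsB hH Hg Hf.
have hh : ip (fun u => g u - f u) (fun u => g u - f u) = 0.
  apply/eqP; rewrite eq_le (rkhs_ip_ge0 hH)// andbT -(pmulr_rle0 _ lam0).
  apply: le_trans le0; rewrite lerDr mulr_ge0// ?invr_ge0 ?(ltW n0)//.
  by apply: sumr_ge0 => a _; exact: sqr_ge0.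
have /funeqP gf := rkhs_ip_eq0 hH Hh hh.
by apply/funext => u; apply/eqP; rewrite -subr_eq0 gf.
Qed.

Lemma ridgeD x y y' u :
  ridge x (fun a => y a + y' a) u = ridge x y u + ridge x y' u.
Proof.
rewrite !ridgeE -big_split/=; apply: eq_bigr => b _; rewrite -mulrDl.
congr (_ * _); rewrite -big_split/=; apply: eq_bigr => a _.
by rewrite !mulrDr.
Qed.

(** The first-order condition in the direction of the solution itself. *)
Lemma ridge_energy x y :
  \sum_(a in S) ridge x y (x a) ^+ 2 + n * lam * ip (ridge x y) (ridge x y) =
  \sum_(a in S) y a * ridge x y (x a).
Proof.
have := ridge_normal_eq x y (ridgeH x y).
rewrite (eq_bigr (fun a => ridge x y (x a) ^+ 2 - y a * ridge x y (x a))).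
  by rewrite sumrB => /eqP; rewrite addrAC subr_eq0 => /eqP.
by move=> a _; ring.
Qed.

(** Combine [ridge_energy] with y v <= y^2 + v^2. *)
Lemma ridge_norm_le x y :
  n * lam * ip (ridge x y) (ridge x y) <= \sum_(a in S) y a ^+ 2.
Proof.
have := ridge_energy x y; set A := \sum_(a in S) _; set B := n * _ * _ => E.
have : \sum_(a in S) y a * ridge x y (x a) <= \sum_(a in S) y a ^+ 2 + A.
  rewrite -big_split/=; apply: ler_sum => a _.
  have := sqr_ge0 (y a - ridge x y (x a)); have := sqr_ge0 (y a); have := sqr_ge0 (ridge x y (x a)).
  by nra.
lra.
Qed.

(** The first-order condition in the direction e, together with the polarization
identity for b = e + f; the leftover term |b|_H^2 is dropped. *)
Lemma ridge_bias_le x f e : H f ->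
  e = (fun u => ridge x (fun a => f (x a)) u - f u) ->
  2 * (\sum_(a in S) e (x a) ^+ 2) + n * lam * ip e e <= n * lam * ip f f.
Proof.
set b := ridge x _ => Hf eE; have Hb : H b by exact: ridgeH.
have He : H e by rewrite eE; exact: (rkhsB hH).
have := ridge_normal_eq x (fun a => f (x a)) He; rewrite -/b.
have -> : \sum_(a in S) (b (x a) - f (x a)) * e (x a) = \sum_(a in S) e (x a) ^+ 2.
  by apply: eq_bigr => a _; rewrite eE expr2.
have -> : ip e e = ip b b - 2 * ip b f + ip f f by rewrite eE; exact: (rkhs_sqrB hH).
have -> : ip b e = ip b b - ip b f.
  by rewrite (rkhs_ip_sym hH Hb He) eE (rkhs_ipB hH)// (rkhs_ip_sym hH Hf Hb).
have := mulr_ge0 (ltW nlam0) (rkhs_ip_ge0 hH Hb).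
by rewrite !(mulrBr, mulrDr); lra.
Qed.

End Ridge.

(** * Well-conditioned designs *)

(** A weighted AM-GM inequality for a product given through its square, which spares
the use of square roots. *)
Lemma amgm_prod (R : realFieldType) (p X Y t : R) :
  0 <= X -> 0 <= Y -> 0 < t -> p ^+ 2 = X * Y -> 2 * p <= t * X + Y / t.
Proof.
move=> X0 Y0 t0 pE; have tn : t != 0 by rewrite gt_eqF.
have Z0 : 0 <= t * X + Y / t by rewrite addr_ge0// ?divr_ge0 ?mulr_ge0 ?(ltW t0).
have [p0|p0] := leP p 0; first by apply: le_trans Z0; nra.
rewrite -ler_sqr ?nnegrE ?mulr_ge0 ?(ltW p0)//.
have -> : (2 * p) ^+ 2 = (t * X + Y / t) ^+ 2 - (t * X - Y / t) ^+ 2.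
  by rewrite exprMn pE; field.
by rewrite lerBlDr lerDl sqr_ge0.
Qed.

Section GoodEvent.
Context (T : Type) (R : realType) (phi : nat -> T -> R) (mu : nat -> R)
  (N : nat) (S : {set 'I_N}).
Hypothesis mu0 : forall j, 0 <= mu j.
Hypothesis S0 : (0 < #|S|)%N.
Local Notation n := (#|S|%:R : R).

(** The sum over j of these weights is the effective dimension at level [l]. *)
Definition shrink (l : R) (j : nat) : R := mu j / (mu j + l).

Definition gram_dev (i j : nat) (x : 'I_N -> T) : R :=
  n^-1 * (\sum_(a in S) (phi i (x a) * phi j (x a) - (i == j)%:R)).

Definition gram_dev_frob (l : R) (J : nat) (x : 'I_N -> T) : R :=
  \sum_(0 <= i < J) \sum_(0 <= j < J)
    shrink l i * shrink l j * gram_dev i j x ^+ 2.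

(** The condition is on all finite sections, which avoids the infinite Gram operator. *)
Definition good_design (l : R) (x : 'I_N -> T) : Prop :=
  forall J, gram_dev_frob l J x <= 4^-1.

Let n0 : 0 < n. Proof. by rewrite ltr0n. Qed.

Lemma shrink_ge0 l j : 0 < l -> 0 <= shrink l j.
Proof. by move=> l0; rewrite divr_ge0// addr_ge0// ltW. Qed.

Lemma shrink_le1 l j : 0 < l -> shrink l j <= 1.
Proof.
move=> l0; have := mu0 j => m0.
by rewrite ler_pdivrMr ?mul1r ?lerDl ?(ltW l0)// ltr_wpDl.
Qed.

Variables (l : R) (x : 'I_N -> T).
Hypotheses (l0 : 0 < l) (good : good_design l x).

Let v (c : nat -> R) j := mu j * c j ^+ 2 * (mu j + l).

Let v0 c j : 0 <= v c j.
Proof.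
have m0 := mu0 j; apply: mulr_ge0; last by rewrite addr_ge0 // ltW.
by apply: mulr_ge0 => //; exact: sqr_ge0.
Qed.

Let vw c j : (mu j * c j) ^+ 2 = v c j * shrink l j.
Proof.
have m0 := mu0 j; rewrite /v /shrink; field.
by rewrite gt_eqF// ltr_wpDl.
Qed.

Let vE c J : \sum_(0 <= j < J) v c j =
  \sum_(0 <= j < J) (mu j * c j) ^+ 2 + l * \sum_(0 <= j < J) mu j * c j ^+ 2.
Proof.
by rewrite mulr_sumr -big_split/=; apply: eq_bigr => j _; rewrite /v; ring.
Qed.

(** For g = sum of b_j phi_j with b_j = mu_j c_j, the empirical norm differs from the
L2 norm by the quadratic form of [gram_dev]. With v_j = b_j^2 / w_j, whose sum V is
|g|_2^2 + l |g|_H^2, the Cauchy-Schwarz inequality bounds this form by V times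
the weighted Frobenius norm, hence by V / 2. *)
Lemma good_lower_isometry (c : nat -> R) J :
  \sum_(0 <= j < J) (mu j * c j) ^+ 2 <=
  2 * n^-1 * (\sum_(a in S) (\sum_(0 <= j < J) mu j * c j * phi j (x a)) ^+ 2) +
  l * \sum_(0 <= j < J) mu j * c j ^+ 2.
Proof.
pose b j := mu j * c j; pose V := \sum_(0 <= j < J) v c j.
set B := \sum_(0 <= j < J) _; set Q := \sum_(a in S) _; set M := \sum_(0 <= j < J) _.
have Q0 : 0 <= Q by apply: sumr_ge0 => a _; exact: sqr_ge0.
have V0 : 0 <= V by apply: sumr_ge0.
have VE : V = B + l * M by exact: vE.
have QE : n^-1 * Q = B + \sum_(0 <= i < J) \sum_(0 <= j < J) b i * b j * gram_dev i j x.
  have -> : B = \sum_(0 <= i < J) \sum_(0 <= j < J) b i * b j * (i == j)%:R.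
    apply: eq_big_nat => i iJ.
    rewrite (bigD1_seq i) ?iota_uniq ?mem_index_iota//= eqxx mulr1 -expr2.
    by rewrite big1 ?addr0// => j /negbTE; rewrite eq_sym => ->; rewrite mulr0.
  rewrite -big_split/=; under [RHS]eq_bigr do rewrite -big_split/=.
  rewrite /Q mulr_sumr.
  have dE i j : b i * b j * (i == j)%:R + b i * b j * gram_dev i j x =
      \sum_(a in S) n^-1 * (b i * phi i (x a) * (b j * phi j (x a))).
    rewrite /gram_dev sumrB sumr_const -mulr_natr.
    rewrite -mulrDr (_ : _ + _ = n^-1 * \sum_(a in S) phi i (x a) * phi j (x a)).
      by rewrite mulrCA !mulr_sumr; apply: eq_bigr => a _; ring.
    by field; rewrite gt_eqF.
  under [RHS]eq_bigr do under eq_bigr do rewrite dE.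
  under [RHS]eq_bigr do rewrite exchange_big/=.
  rewrite exchange_big/=; apply: eq_bigr => a _.
  rewrite expr2 big_distrl/= mulr_sumr; apply: eq_bigr => i _.
  by rewrite big_distrr/= mulr_sumr.
have BV : B <= V.
  apply: ler_sum => j _; rewrite vw ler_piMr//; exact: shrink_le1.
have [Vle|Vgt] := leP V 0.
  have B0 : B <= 0 by exact: le_trans Vle.
  have M0 : 0 <= M by apply: sumr_ge0 => j _; rewrite mulr_ge0// sqr_ge0.
  apply: (le_trans B0); rewrite addr_ge0// ?mulr_ge0 ?invr_ge0 ?(ltW n0) ?(ltW l0)//.
have cross : - (2 * \sum_(0 <= i < J) \sum_(0 <= j < J) b i * b j * gram_dev i j x) <= V.
  (* with this weight, t V^2 = V / 2 and (1/4) / t = V / 2 *)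
  pose t := (2 * V)^-1.
  have t0 : 0 < t by rewrite invr_gt0 mulr_gt0.
  have : - (2 * \sum_(0 <= i < J) \sum_(0 <= j < J) b i * b j * gram_dev i j x) <=
     t * V ^+ 2 + gram_dev_frob l J x / t.
    rewrite mulr_sumr -sumrN /gram_dev_frob mulr_suml expr2 big_distrl/= mulr_sumr -big_split/=.
    apply: ler_sum => i _; rewrite mulr_sumr -sumrN big_distrr/= mulr_sumr mulr_suml -big_split/=.
    apply: ler_sum => j _; rewrite -mulrN.
    apply: amgm_prod => //; first by rewrite mulr_ge0.
      by rewrite mulr_ge0 ?sqr_ge0 // mulr_ge0 ?shrink_ge0.
    by rewrite sqrrN 2!exprMn /b !vw; ring.
  move/le_trans; apply.
  have -> : t * V ^+ 2 = V / 2 by rewrite /t; field; rewrite gt_eqF.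
  rewrite /t invrK; have := good J => gJ.
  by have : gram_dev_frob l J x * V <= 4^-1 * V; [rewrite ler_pM2r|lra].
rewrite -mulrA QE; lra.
Qed.

End GoodEvent.

Section GoodEventRKHS.
Context (d : measure_display) (T : measurableType d) (R : realType)
  (P : probability T R) (phi : nat -> T -> R) (mu : nat -> R)
  (K : T -> T -> R) (H : set (T -> R)) (ip : (T -> R) -> (T -> R) -> R).
Hypotheses (hphi : is_orthonormal_basis P phi) (hH : is_rkhs K H ip)
  (hpsd : psd_kernel K) (hL2 : forall f, H f -> f \in Lfun P 2%:E)
  (hK : has_mercer_expansion K mu phi) (mu0 : forall j, 0 <= mu j)
  (mudec : forall j, mu j.+1 <= mu j).
Context (N : nat) (S : {set 'I_N}).
Hypothesis S0 : (0 < #|S|)%N.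
Local Notation n := (#|S|%:R : R).

Let n0 : 0 < n. Proof. by rewrite ltr0n. Qed.

(** The embedding of H into L2 has norm sqrt(mu_0): this is [rkhs_L2_le] with no
point evaluation. *)
Lemma rkhs_L2_le_norm f : H f -> (\int[P]_x (f x ^+ 2)%:E <= (mu 0%N * ip f f)%:E)%E.
Proof.
move=> Hf.
have := rkhs_L2_le hphi hH hL2 hK (xs := [::]) (lexx 0) (mu0 0%N) _ Hf.
rewrite big_nil mulr0 add0r; apply => c J.
rewrite mul0r add0r mulr_sumr; apply: ler_sum => j _.
have mj : mu j <= mu 0%N by elim: j => // j; exact: le_trans.
rewrite exprMn expr2 -mulrA; apply: ler_wpM2r => //.
by apply: mulr_ge0 => //; exact: sqr_ge0.
Qed.

Lemma good_L2_le (l : R) (x : 'I_N -> T) f : 0 < l -> good_design phi mu S l x ->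
  H f -> (\int[P]_u (f u ^+ 2)%:E <=
    (2 * n^-1 * (\sum_(a in S) f (x a) ^+ 2) + l * ip f f)%:E)%E.
Proof.
move=> l0 good Hf.
have A0 : 0 <= 2 * n^-1 by rewrite mulr_ge0// invr_ge0 ltW.
have := rkhs_L2_le hphi hH hL2 hK (xs := [seq x a | a <- enum S]) A0 (ltW l0) _ Hf.
rewrite big_map big_enum/=; apply => c J; rewrite big_map big_enum/=.
exact: good_lower_isometry.
Qed.

Definition noise_coef (x : 'I_N -> T) (y : 'I_N -> R) (j : nat) : R :=
  n^-1 * \sum_(a in S) y a * phi j (x a).

(** By [ridge_energy], |v|_n^2 + lam |v|_H^2 is the empirical product of v and y, which
is the sum of mu_j c_j eta_j when v has Mercer coefficients c_j and eta_j is
[noise_coef]. AM-GM splits it into the sum of w_j eta_j^2 and the sum of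
mu_j c_j^2 (mu_j + t lam) = |v|_2^2 + t lam |v|_H^2; the latter is at most
2 |v|_n^2 + 2 t lam |v|_H^2 on a good design, and is absorbed by the left-hand side. *)
Lemma good_ridge_noise (lam t : R) (x : 'I_N -> T) (y : 'I_N -> R) (X : R) :
  0 < lam -> 2 <= t -> good_design phi mu S (t * lam) x ->
  (forall J, \sum_(0 <= j < J) shrink mu (t * lam) j * noise_coef x y j ^+ 2 <= X) ->
  (\int[P]_u (ridge K S lam x y u ^+ 2)%:E <= (2 * t ^+ 2 * X)%:E)%E.
Proof.
move=> lam0 t2 good leX; set v := ridge K S lam x y.
have t0 : 0 < t by lra.
have l0 : 0 < t * lam by rewrite mulr_gt0.
have Hv : H v by exact: (ridgeH hH).
apply: le_trans (good_L2_le l0 good Hv) _; rewrite lee_fin.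
pose s := [seq (ridge_coef K S lam x y b, x b) | b <- enum S].
pose c := mercer_coef phi s; pose vJ J u := \sum_(0 <= j < J) mu j * c j * phi j u.
have vJv u : vJ J u @[J --> \oo] --> v u by exact: cvg_kernel_comb.
have hJ : \sum_(0 <= j < J) mu j * c j ^+ 2 @[J --> \oo] --> ip v v.
  exact: (cvg_kernel_comb_norm hH).
set h := ip v v in hJ *; set Q := \sum_(a in S) _.
have h0 : 0 <= h by exact: (rkhs_ip_ge0 hH).
have Q0 : 0 <= Q by apply: sumr_ge0 => a _; exact: sqr_ge0.
pose X1 := n^-1 * \sum_(a in S) y a * v (x a).
have X1E : X1 = n^-1 * Q + lam * h.
  rewrite /X1 -(ridge_energy hH hpsd lam0 S0) -/v -/Q -/h; field.
  by rewrite gt_eqF.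
have le1 : X1 <= (4 * t)^-1 * (2 * n^-1 * Q + 2 * (t * lam) * h) + t * X.
  have c1 : n^-1 * (\sum_(a in S) y a * vJ J (x a)) @[J --> \oo] --> X1.
    apply: cvgMl_tmp; apply: cvg_big => //; first exact: add_continuous.
    by move=> a _; apply: cvgMl_tmp; exact: vJv.
  have c2 : (4 * t)^-1 * (2 * n^-1 * (\sum_(a in S) vJ J (x a) ^+ 2) +
      2 * (t * lam) * \sum_(0 <= j < J) mu j * c j ^+ 2) + t * X @[J --> \oo] -->
      (4 * t)^-1 * (2 * n^-1 * Q + 2 * (t * lam) * h) + t * X.
    apply: cvgD; last exact: cvg_cst.
    apply: cvgMl_tmp; apply: cvgD; apply: cvgMl_tmp; last exact: hJ.
    apply: cvg_big => //; first exact: add_continuous.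
    move=> a _; rewrite expr2; under eq_fun do rewrite expr2.
    by apply: cvgM; exact: vJv.
  apply: (ler_cvg_to c1 c2); near=> J.
  have := good_lower_isometry mu0 S0 l0 good c J.
  set B := \sum_(0 <= j < J) _; set M := \sum_(0 <= j < J) _.
  rewrite -[\sum_(a in S) (\sum_(0 <= j < J) _) ^+ 2]/(\sum_(a in S) vJ J (x a) ^+ 2).
  set QJ := \sum_(a in S) _ => iso.
  have -> : n^-1 * (\sum_(a in S) y a * vJ J (x a)) =
      \sum_(0 <= j < J) mu j * c j * noise_coef x y j.
    rewrite /noise_coef /vJ; under [RHS]eq_bigr do rewrite mulrCA mulr_sumr.
    rewrite -mulr_sumr exchange_big/=; congr (_ * _); apply: eq_bigr => a _.
    by rewrite mulr_sumr; apply: eq_bigr => j _; ring.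
  apply: (@le_trans _ _ ((4 * t)^-1 * (B + t * lam * M) +
      t * \sum_(0 <= j < J) shrink mu (t * lam) j * noise_coef x y j ^+ 2)).
    rewrite /B /M [t * lam * _]mulr_sumr -big_split/= [(4 * t)^-1 * _]mulr_sumr.
    rewrite [t * \sum_(0 <= j < J) _]mulr_sumr -big_split/=; apply: ler_sum => j _.
    have mj := mu0 j.
    have ml : 0 < mu j + t * lam by rewrite ltr_wpDl.
    rewrite -(ler_pM2l (ltr0n R 2)).
    have := @amgm_prod R (mu j * c j * noise_coef x y j)
      (mu j * c j ^+ 2 * (mu j + t * lam)) (shrink mu (t * lam) j * noise_coef x y j ^+ 2)
      (2 * t)^-1.
    rewrite invrK => /(_ _ _ _ _)/le_trans; apply.
    - by apply: mulr_ge0; [apply: mulr_ge0 => //; exact: sqr_ge0|exact: ltW].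
    - by apply: mulr_ge0; [exact: shrink_ge0|exact: sqr_ge0].
    - by rewrite invr_gt0 mulr_gt0.
    - by rewrite /shrink; field; rewrite gt_eqF.
    rewrite le_eqVlt; apply/orP; left; apply/eqP; field.
    by rewrite gt_eqF.
  by apply: lerD; rewrite ler_wpM2l ?(ltW t0) ?invr_ge0 ?mulr_ge0 ?(ltW t0)//; lra.
have le2 : X1 <= 2 * t * X.
  have : (4 * t)^-1 * (2 * n^-1 * Q + 2 * (t * lam) * h) <= X1 / 2.
    have -> : (4 * t)^-1 * (2 * n^-1 * Q + 2 * (t * lam) * h) =
      (n^-1 * Q) / (2 * t) + lam * h / 2 by field; rewrite ?gt_eqF.
    suff : n^-1 * Q / (2 * t) <= n^-1 * Q / 2 by rewrite X1E; lra.
    rewrite ler_wpM2l ?mulr_ge0 ?invr_ge0 ?(ltW n0)//.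
    by rewrite lef_pV2 ?posrE ?mulr_gt0//; lra.
  lra.
apply: (@le_trans _ _ (t * X1)); last by rewrite expr2; nra.
rewrite X1E mulrDr lerD//; last by rewrite mulrA.
rewrite -mulrA ler_wpM2r// mulr_ge0// invr_ge0 ltW.
Unshelve. all: by end_near. Qed.

End GoodEventRKHS.

(** * Moments of sums of independent variables *)

Section RealInequalities.
Context (R : realType).
Implicit Types (a b x y k s : R).

(** A second-order Taylor bound valid for all arguments; it serves both for powers and
for moment generating functions. *)
Lemma expR_le_quad y : expR y <= 1 + y + y ^+ 2 * expR `|y|.
Proof.
have h (z : R) : expR z - 1 <= z * expR z.
  have /(ler_wpM2r (expR_ge0 z)) := expR_ge1Dx (- z).
  by rewrite expRN mulVf ?gt_eqF ?expR_gt0// mulrDl mul1r mulNr; lra.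
have hy := h y; have e1 := expR_ge1Dx y; have ep := expR_gt0 y.
have [y0|y0] := leP 0 y.
  rewrite ger0_norm//; set e := expR y in hy e1 ep *; nra.
have eN1 : 1 <= expR `|y| by have := expR_ge1Dx `|y|; have := normr_ge0 y; lra.
have : y ^+ 2 <= y ^+ 2 * expR `|y| by rewrite ler_peMr ?sqr_ge0.
set e := expR y in hy e1 ep *; nra.
Qed.

Lemma powR_norm2 x k : 2 < k -> `|x| `^ k = `|x| `^ (k - 2) * x ^+ 2.
Proof.
move=> k2; have h : (k - 2 + 2 == 0) ==> (`|x| != 0).
  by rewrite subrK gt_eqF//; lra.
have := powRD h; rewrite subrK => ->.
by rewrite powR_mulrn// real_normK ?num_real.
Qed.

(** When |a| <= 2 |b| every term is at most a multiple of |b|^k. Otherwise the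
estimate is homogeneous, and reduces to (1 + x)^k <= exp(k x) with |x| <= 1/2 and
the second-order bound on the exponential. *)
Lemma powR_taylor k : 2 < k -> exists2 C, 0 <= C & forall a b,
  `|a + b| `^ k <= `|a| `^ k + k * `|a| `^ (k - 2) * a * b +
    C * (`|a| `^ (k - 2) * b ^+ 2 + `|b| `^ k).
Proof.
move=> k2; have k0 : 0 < k by lra.
have q0 : 0 <= k - 2 by lra.
pose C1 := 3 `^ k + 2 * k * 2 `^ (k - 2).
pose C2 := k ^+ 2 * expR (k / 2).
have C10 : 0 <= C1 by rewrite addr_ge0 ?powR_ge0// !mulr_ge0 ?powR_ge0// ltW.
have C20 : 0 <= C2 by rewrite mulr_ge0 ?sqr_ge0// expR_ge0.
exists (C1 + C2) => [|a b]; first exact: addr_ge0.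
have pq0 : 0 <= `|a| `^ (k - 2) by exact: powR_ge0.
have pb0 : 0 <= `|b| `^ k by exact: powR_ge0.
have b20 := sqr_ge0 b.
have [ab|ab] := leP `|a| (2 * `|b|).
  have nn : 0 <= `|b| := normr_ge0 b.
  have l1 : `|a + b| `^ k <= 3 `^ k * `|b| `^ k.
    rewrite -powRM//; apply: ge0_ler_powR; rewrite ?nnegrE ?mulr_ge0 ?(ltW k0)//.
    by apply: le_trans (ler_normD _ _) _; lra.
  have l2 : - (2 * k * 2 `^ (k - 2) * `|b| `^ k) <= k * `|a| `^ (k - 2) * a * b.
    have : `|k * `|a| `^ (k - 2) * a * b| <= 2 * k * 2 `^ (k - 2) * `|b| `^ k.
      rewrite !normrM (gtr0_norm k0) [X in _ * X * _ * _]ger0_norm//.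
      have -> : 2 * k * 2 `^ (k - 2) * `|b| `^ k = k * (2 `^ (k - 2) * `|b| `^ (k - 2)) * (2 * `|b|) * `|b|.
        by rewrite powR_norm2// -real_normK ?num_real//; ring.
      rewrite -powRM// ler_wpM2r// ler_pM ?mulr_ge0 ?(ltW k0)//.
      by rewrite ler_wpM2l ?(ltW k0)//; apply: ge0_ler_powR; rewrite ?nnegrE ?mulr_ge0.
    by rewrite ler_norml => /andP[].
  have pa0 := powR_ge0 `|a| k.
  have : C1 * `|b| `^ k = 3 `^ k * `|b| `^ k + 2 * k * 2 `^ (k - 2) * `|b| `^ k by rewrite /C1 mulrDl.
  have : 0 <= C1 * (`|a| `^ (k - 2) * b ^+ 2) by rewrite mulr_ge0// mulr_ge0.
  have : 0 <= C2 * (`|a| `^ (k - 2) * b ^+ 2 + `|b| `^ k).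
    by rewrite mulr_ge0// addr_ge0// mulr_ge0.
  by rewrite (mulrDl C1) (mulrDr C1); lra.
have a0 : 0 < `|a| by apply: le_lt_trans ab; rewrite mulr_ge0.
have an0 : a != 0 by rewrite -normr_gt0.
pose x := b / a; have bE : b = a * x by rewrite /x mulrCA divff ?mulr1.
have x2 : `|x| <= 2^-1.
  by rewrite normrM normfV ler_pdivrMr//; have := ab; lra.
have x1 : 0 < 1 + x by have := x2; rewrite ler_norml => /andP[? ?]; lra.
have -> : `|a + b| = `|a| * (1 + x).
  by rewrite bE -{1}(mulr1 a) -mulrDr normrM (gtr0_norm x1).
rewrite powRM// ?(ltW x1)//.
have lx : (1 + x) `^ k <= 1 + k * x + C2 * x ^+ 2.
  rewrite /powR gt_eqF//; apply: (@le_trans _ _ (expR (k * x))).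
    by rewrite ler_expR ler_wpM2l ?(ltW k0)// le_ln1Dx//; lra.
  apply: le_trans (expR_le_quad _) _; rewrite lerD2l exprMn /C2 mulrAC.
  rewrite ler_wpM2r ?sqr_ge0// ler_wpM2l ?sqr_ge0// ler_expR normrM (gtr0_norm k0).
  by rewrite ler_wpM2l// ltW.
have := ler_wpM2l (powR_ge0 `|a| k) lx.
have e1 : `|a| `^ k * (k * x) = k * `|a| `^ (k - 2) * a * b.
  by rewrite powR_norm2// bE; ring.
have e2 : `|a| `^ k * (C2 * x ^+ 2) = C2 * (`|a| `^ (k - 2) * b ^+ 2).
  by rewrite powR_norm2// bE; ring.
rewrite 2!mulrDr mulr1 e1 e2.
have : 0 <= C1 * (`|a| `^ (k - 2) * b ^+ 2 + `|b| `^ k).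
  by rewrite mulr_ge0// addr_ge0// mulr_ge0.
have : 0 <= C2 * `|b| `^ k by rewrite mulr_ge0.
by rewrite (mulrDl C1) (mulrDr C2); lra.
Qed.

(** Jensen's inequality for the power s and unnormalized weights, obtained from
Young's inequality at the weighted mean tau. *)
Lemma powR_jensen (I : eqType) (r : seq I) (p t : I -> R) s : 1 < s ->
  (forall i, 0 <= p i) -> (forall i, 0 <= t i) ->
  (\sum_(i <- r) p i * t i) `^ s <=
  (\sum_(i <- r) p i) `^ (s - 1) * \sum_(i <- r) p i * t i `^ s.
Proof.
move=> s1 p0 t0; set A := \sum_(i <- r) p i * t i; set W := \sum_(i <- r) p i.
set B := \sum_(i <- r) _.
have s0 : 0 < s by lra.
have W0 : 0 <= W by exact: sumr_ge0.
have A0 : 0 <= A by apply: sumr_ge0 => i _; exact: mulr_ge0.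
have B0 : 0 <= B by apply: sumr_ge0 => i _; rewrite mulr_ge0 ?powR_ge0.
have [Ap|] := ltP 0 A; last first.
  move=> Ale; have -> : A = 0 by apply/eqP; rewrite eq_le Ale.
  by rewrite powR0 ?gt_eqF// mulr_ge0 ?powR_ge0.
have Wp : 0 < W.
  rewrite lt_neqAle W0 andbT eq_sym; apply/eqP => WE; move: Ap.
  move: WE => /eqP; rewrite /W psumr_eq0// => /allP pz.
  rewrite /A big1_seq ?ltxx// => i /andP[_ ir].
  by have /eqP -> := pz i ir; rewrite mul0r.
pose tau := A / W.
have tau0 : 0 < tau by rewrite divr_gt0.
(* Young's inequality for t_i and tau^(s - 1), with exponents s and s / (s - 1) *)
have young i : t i * tau `^ (s - 1) <= t i `^ s / s + tau `^ s * ((s - 1) / s).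
  have := @conjugate_powR R (t i) (tau `^ (s - 1)) s (s / (s - 1)) (t0 i) (powR_ge0 _ _) s0 _ _.
  rewrite -powRrM invf_div (_ : (s - 1) * (s / (s - 1)) = s); last by field; lra.
  apply; first by rewrite divr_gt0//; lra.
  by field; lra.
have : A * tau `^ (s - 1) <= B / s + W * (tau `^ s * ((s - 1) / s)).
  rewrite /A /B /W !mulr_suml -big_split/=; apply: ler_sum => i _.
  by rewrite -!mulrA -mulrDr ler_wpM2l.
have AE : A = W * tau by rewrite /tau mulrCA divff ?mulr1// gt_eqF.
have -> : A * tau `^ (s - 1) = W * tau `^ s by rewrite AE -mulrA mulr_powRB1// ltW.
move=> le1; have {le1} : W * tau `^ s <= B.
  rewrite -(ler_pM2r (_ : 0 < s^-1)) ?invr_gt0//.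
  have : W * (tau `^ s * ((s - 1) / s)) = W * tau `^ s - W * tau `^ s * s^-1.
    by field; rewrite gt_eqF.
  by move: le1; lra.
move=> /(ler_wpM2l (powR_ge0 W (s - 1))); rewrite mulrA [W `^ _ * W]mulrC mulr_powRB1//.
by rewrite -powRM ?(ltW tau0)// -AE.
Qed.

End RealInequalities.

Section RealIntegrands.
Context (d : measure_display) (T : measurableType d) (R : realType)
  (P : {measure set T -> \bar R}).
Local Open Scope ereal_scope.

Lemma integralD_fun (f g : T -> R) : P.-integrable setT (EFin \o f) ->
  P.-integrable setT (EFin \o g) ->
  \int[P]_x (f x + g x)%:E = \int[P]_x (f x)%:E + \int[P]_x (g x)%:E.
Proof. by move=> fi gi; rewrite -(integralD_EFin measurableT fi gi). Qed.

Lemma integralZ_fun (c : R) (f : T -> R) : P.-integrable setT (EFin \o f) ->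
  \int[P]_x (c * f x)%:E = c%:E * \int[P]_x (f x)%:E.
Proof. by move=> fi; rewrite -(integralZl measurableT fi). Qed.

Lemma integral_probability_cst (Q : probability T R) (c : R) :
  \int[Q]_x c%:E = c%:E.
Proof. by rewrite integral_cst// [X in _ * X]probability_setT mule1. Qed.

End RealIntegrands.

Section Moments.
Context (d : measure_display) (E : measurableType d) (R : realType)
  (P : probability E R) (N : nat) (mu : probability (N.-tuple E) R).
Hypothesis hmu : is_product_law P mu.
Variable xi : E -> R.
Hypothesis mxi : measurable_fun setT xi.
Local Open Scope ereal_scope.

Let tsum (L : seq 'I_N) (t : N.-tuple E) : R := (\sum_(a <- L) xi (tnth t a))%R.

Lemma measurable_tsum L : measurable_fun [set: N.-tuple E] (tsum L).
Proof.
apply: measurable_sum => a; apply: measurableT_comp mxi _.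
exact: measurable_tnth.
Qed.

Lemma tsum_upd a L z t : a \notin L -> tsum (a :: L) (upd a z t) = (xi z + tsum L t)%R.
Proof.
move=> aL; rewrite /tsum big_cons tnth_upd eqxx; congr (_ + _)%R.
rewrite big_seq [RHS]big_seq; apply: eq_bigr => b bL; rewrite tnth_upd.
by case: eqP bL aL => [->->|].
Qed.

Lemma measurable_powR_norm d' (T : measurableType d') (f : T -> R) k :
  measurable_fun setT f -> measurable_fun setT (fun x => `|f x| `^ k)%R.
Proof.
move=> mf; apply: (measurableT_comp (measurable_powR k)).
exact: measurableT_comp.
Qed.

Section Power.
Variables (k M : R).
Hypotheses (k2 : (2 < k)%R) (M0 : (0 <= M)%R).
Hypothesis ixi : P.-integrable setT (EFin \o xi).
Hypothesis xi0 : \int[P]_z (xi z)%:E = 0.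
Hypothesis xi2 : \int[P]_z (xi z ^+ 2)%:E <= M%:E.
Hypothesis xik : \int[P]_z (`|xi z| `^ k)%:E <= M%:E.

Let ge0_integrable (f : E -> R) : measurable_fun setT f -> (forall x, 0 <= f x)%R ->
  \int[P]_z (f z)%:E <= M%:E -> P.-integrable setT (EFin \o f).
Proof.
move=> mf f0 fM; apply/integrableP; split; first exact/measurable_EFinP.
under eq_integral do rewrite /= ger0_norm//.
exact: le_lt_trans fM (ltry _).
Qed.

Let ix2 : P.-integrable setT (EFin \o (fun z => xi z ^+ 2)%R).
Proof.
apply: ge0_integrable => //; first exact: measurable_funX.
by move=> x; exact: sqr_ge0.
Qed.

Let ixk : P.-integrable setT (EFin \o (fun z => `|xi z| `^ k)%R).
Proof. by apply: ge0_integrable => //; exact: measurable_powR_norm.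
Qed.

(** The linear term of the Taylor bound vanishes since [xi] is centered. *)
Lemma moment_step (C s : R) : (0 <= C)%R -> (forall a b : R,
  `|a + b| `^ k <= `|a| `^ k + k * `|a| `^ (k - 2) * a * b +
    C * (`|a| `^ (k - 2) * b ^+ 2 + `|b| `^ k))%R ->
  \int[P]_z (`|xi z + s| `^ k)%:E <=
  (`|s| `^ k + C * (`|s| `^ (k - 2) * M + M))%:E.
Proof.
move=> C0 taylor.
pose c1 := (k * `|s| `^ (k - 2) * s)%R; pose c2 := (C * `|s| `^ (k - 2))%R.
have c20 : (0 <= c2)%R by rewrite mulr_ge0// powR_ge0.
pose g z := (`|s| `^ k + c1 * xi z + (c2 * xi z ^+ 2 + C * `|xi z| `^ k))%R.
have ic : P.-integrable setT (EFin \o (fun=> `|s| `^ k)%R).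
  exact: finite_measure_integrable_cst.
have i1 : P.-integrable setT (EFin \o (fun z => c1 * xi z)%R).
  have := @integrableZl _ _ _ P _ measurableT c1 _ ixi.
  by apply: eq_integrable => // z _; rewrite /= EFinM.
have i2 : P.-integrable setT (EFin \o (fun z => c2 * xi z ^+ 2)%R).
  have := @integrableZl _ _ _ P _ measurableT c2 _ ix2.
  by apply: eq_integrable => // z _; rewrite /= EFinM.
have i3 : P.-integrable setT (EFin \o (fun z => C * `|xi z| `^ k)%R).
  have := @integrableZl _ _ _ P _ measurableT C _ ixk.
  by apply: eq_integrable => // z _; rewrite /= EFinM.
have i01 : P.-integrable setT (EFin \o (fun z => `|s| `^ k + c1 * xi z)%R).
  have := integrableD measurableT ic i1.
  by apply: eq_integrable.
have i23 : P.-integrable setT (EFin \o (fun z => c2 * xi z ^+ 2 + C * `|xi z| `^ k)%R).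
  have := integrableD measurableT i2 i3.
  by apply: eq_integrable.
have mg : measurable_fun setT g.
  have := integrableD measurableT i01 i23 => /integrableP[mg _].
  by apply/measurable_EFinP; exact: mg.
have le1 : \int[P]_z (`|xi z + s| `^ k)%:E <= \int[P]_z (g z)%:E.
  apply: ge0_le_integral_any => z; first by rewrite lee_fin powR_ge0.
  rewrite lee_fin addrC; apply: le_trans (taylor s (xi z)) _.
  by rewrite /g /c1 /c2 (mulrDr C) (mulrA C).
apply: (le_trans le1); rewrite /g.
rewrite (integralD_fun i01 i23) (integralD_fun ic i1) (integralD_fun i2 i3).
rewrite (integralZ_fun _ ixi) (integralZ_fun _ ix2) (integralZ_fun _ ixk).
rewrite xi0 mule0 adde0.
rewrite integral_probability_cst EFinD leeD2l//.
rewrite mulrDr EFinD mulrA -/c2 (EFinM c2) (EFinM C M); apply: leeD.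
  by apply: lee_wpmul2l; rewrite ?lee_fin.
by apply: lee_wpmul2l; rewrite ?lee_fin.
Qed.

(** Induction on the number of summands, resampling the newest one. The term
|s|^(k-2) of [moment_step] is at most |s|^k / n + n^(k/2 - 1); the first part gives
the factor 1 + C M / n at each step and the second one the additive term. With n
summands this is O(n^(k/2)), as in the central limit theorem. *)
Lemma moment_sum (C n : R) L : (0 <= C)%R -> (forall a b : R,
  `|a + b| `^ k <= `|a| `^ k + k * `|a| `^ (k - 2) * a * b +
    C * (`|a| `^ (k - 2) * b ^+ 2 + `|b| `^ k))%R -> (1 <= n)%R -> uniq L ->
  \int[mu]_t (`|tsum L t| `^ k)%:E <=
  ((size L)%:R * (2 * C * M * n `^ (k / 2 - 1)) * (1 + C * M / n) ^+ size L)%:E.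
Proof.
move=> C0 taylor n1; have n0 : (0 < n)%R by lra.
pose B := (2 * C * M * n `^ (k / 2 - 1))%R.
have CM0 : (0 <= C * M)%R by rewrite mulr_ge0.
have CMn0 : (0 <= C * M / n)%R by rewrite mulr_ge0// invr_ge0 ltW.
have kh : (0 <= k / 2 - 1)%R by rewrite subr_ge0 ler_pdivlMr// mul1r ltW.
have np1 : (1 <= n `^ (k / 2 - 1))%R.
  by have := @ler_powR R n n1 0%R (k / 2 - 1)%R kh; rewrite powRr0.
elim: L => [_|a L IH /=/andP[aL uL]].
  rewrite mul0r mul0r; under eq_integral do rewrite /tsum big_nil normr0 powR0 ?gt_eqF ?(lt_trans _ k2)//.
  by rewrite integral0.
have mF : measurable_fun [set: N.-tuple E] (fun t => (`|tsum (a :: L) t| `^ k)%:E).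
  by apply/measurable_EFinP; apply: measurable_powR_norm; exact: measurable_tsum.
have mL : measurable_fun [set: N.-tuple E] (fun t => `|tsum L t| `^ k)%R.
  by apply: measurable_powR_norm; exact: measurable_tsum.
rewrite (resample hmu a)//.
apply: (@le_trans _ _ (\int[mu]_t ((1 + C * M / n)%:E * (`|tsum L t| `^ k)%:E + B%:E))).
  apply: ge0_le_integral_any => t; first by apply: integral_ge0 => z _; rewrite lee_fin powR_ge0.
  under eq_integral do rewrite tsum_upd//.
  apply: (le_trans (moment_step (tsum L t) C0 taylor)).
  rewrite -EFinM -EFinD lee_fin; set s := tsum L t.
  have sk0 : (0 <= `|s| `^ k)%R by exact: powR_ge0.
  (* according as s^2 is larger than n or not *)
  have key : (`|s| `^ (k - 2) <= `|s| `^ k / n + n `^ (k / 2 - 1))%R.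
    have [sn|sn] := leP (s ^+ 2)%R n.
      rewrite -[X in (X <= _)%R]add0r; apply: lerD; first by rewrite divr_ge0// ltW.
      rewrite (_ : k - 2 = 2 * (k / 2 - 1))%R; last by lra.
      rewrite powRrM powR_mulrn// real_normK ?num_real//.
      by apply: ge0_ler_powR; rewrite ?nnegrE ?sqr_ge0 ?(ltW n0)//.
    rewrite -[X in (X <= _)%R]addr0; apply: lerD; last exact: powR_ge0.
    by rewrite ler_pdivlMr// (powR_norm2 _ k2) ler_wpM2l ?powR_ge0// ltW.
  have /(ler_wpM2l CM0) := key.
  have -> : (C * M * (`|s| `^ k / n + n `^ (k / 2 - 1)) =
     C * M / n * `|s| `^ k + C * M * n `^ (k / 2 - 1))%R by field; rewrite gt_eqF.
  have := ler_wpM2l CM0 np1; rewrite /B mulr1; nra.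
rewrite ge0_integralD//; first last.
- by move=> t _; rewrite lee_fin !mulr_ge0// powR_ge0.
- by apply: measurable_funeM; exact/measurable_EFinP.
- by move=> t _; rewrite -EFinM lee_fin mulr_ge0 ?powR_ge0// addr_ge0.
rewrite ge0_integralZl_EFin//; first last.
- by rewrite addr_ge0.
- exact/measurable_EFinP.
rewrite integral_probability_cst.
apply: (@le_trans _ _ ((1 + C * M / n)%:E * ((size L)%:R * B * (1 + C * M / n) ^+ size L)%:E + B%:E)).
  by rewrite leeD2r// lee_wpmul2l ?lee_fin ?addr_ge0// IH.
rewrite -EFinM -EFinD lee_fin /= -/B -natr1 exprS.
set q := (1 + C * M / n)%R; set X := (q ^+ size L)%R.
have q1 : (1 <= q)%R by rewrite lerDl.
have -> : (((size L)%:R + 1) * B * (q * X) = q * ((size L)%:R * B * X) + B * (q * X))%R.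
  by ring.
rewrite lerD2l ler_peMr//; first by rewrite /B !mulr_ge0// powR_ge0.
by rewrite -exprS exprn_ege1.
Qed.

End Power.

Section Bounded.
Variables (B s : R).
Hypotheses (xiB : forall z, (`|xi z| <= B)%R) (sB : (`|s| * B <= 1)%R).
Hypothesis xi0 : \int[P]_z (xi z)%:E = 0.

Let ixi : P.-integrable setT (EFin \o xi).
Proof.
apply: measurable_bounded_integrable => //.
  by rewrite [X in X < _]probability_setT ltry.
exists B; split; first exact: num_real.
by move=> x Bx z _ /=; apply: le_trans (xiB z) (ltW Bx).
Qed.

(** The linear term of [expR_le_quad] vanishes since [xi] is centered. *)
Lemma mgf_step : \int[P]_z (expR (s * xi z))%:E <= (expR (expR 1 * (s * B) ^+ 2))%:E.
Proof.
pose c := (expR 1 * (s * B) ^+ 2)%R.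
apply: (@le_trans _ _ (\int[P]_z ((1 + c)%:E + s%:E * (xi z)%:E))).
  apply: ge0_le_integral_any => z; first by rewrite lee_fin expR_ge0.
  rewrite -EFinM -EFinD lee_fin; apply: le_trans (expR_le_quad _) _.
  rewrite addrAC lerD2r lerD2l /c mulrC; apply: ler_pM.
  - exact: expR_ge0.
  - exact: sqr_ge0.
  - rewrite ler_expR normrM; apply: le_trans sB; exact: ler_wpM2l.
  - rewrite -real_normK ?num_real// -[leRHS]real_normK ?num_real//.
    rewrite ler_sqr ?nnegrE// !normrM ler_wpM2l//.
    by apply: le_trans (xiB z) (ler_norm _).
have ic : P.-integrable setT (EFin \o (fun=> 1 + c)%R).
  exact: finite_measure_integrable_cst.
rewrite integralD//; last exact: integrableZl.
rewrite integralZl// xi0 mule0 adde0 integral_probability_cst.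
by rewrite lee_fin expR_ge1Dx.
Qed.

Lemma mgf_sum L : uniq L -> \int[mu]_t (expR (s * tsum L t))%:E <=
  (expR ((size L)%:R * (expR 1 * (s * B) ^+ 2)))%:E.
Proof.
elim: L => [_|a L IH /=/andP[aL uL]].
  rewrite mul0r expR0; under eq_integral do rewrite /tsum big_nil mulr0 expR0.
  by rewrite integral_probability_cst.
have mexp L' : measurable_fun [set: N.-tuple E] (fun t => (expR (s * tsum L' t))%:E).
  apply/measurable_EFinP; apply: measurableT_comp => //.
  by apply: measurable_funM => //; exact: measurable_tsum.
rewrite (resample hmu a)//.
apply: (@le_trans _ _ (\int[mu]_t ((expR (expR 1 * (s * B) ^+ 2))%:E * (expR (s * tsum L t))%:E))).
  apply: ge0_le_integral_any => t; first by apply: integral_ge0 => z _; rewrite lee_fin expR_ge0.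
  under eq_integral do rewrite tsum_upd// mulrDr expRD EFinM muleC.
  rewrite ge0_integralZl_EFin ?expR_ge0//.
  - by rewrite muleC; apply: lee_wpmul2r; [rewrite lee_fin expR_ge0|exact: mgf_step].
  - apply/measurable_EFinP; apply: measurableT_comp => //.
    exact: measurable_funM.
rewrite ge0_integralZl_EFin ?expR_ge0//.
rewrite -natr1 mulrDl mul1r addrC expRD EFinM; apply: lee_wpmul2l.
  by rewrite lee_fin expR_ge0.
exact: IH.
Qed.

End Bounded.

(** The elementary bound (s |x| / p)^p <= exp(s |x| - p) turns the p-th moment into the
moment generating functions at s and - s. *)
Lemma bounded_moment (B s p : R) L : (forall z, `|xi z| <= B)%R ->
  \int[P]_z (xi z)%:E = 0 -> (0 < s)%R -> (s * B <= 1)%R -> (0 < p)%R -> uniq L ->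
  \int[mu]_t (`|tsum L t| `^ p)%:E <=
  (2 * (p / s) `^ p * expR ((size L)%:R * (expR 1 * (s * B) ^+ 2) - p))%:E.
Proof.
move=> xiB xi0 s0 sB p0 uL.
have h (x : R) : (`|x| `^ p <= (p / s) `^ p * expR (- p) * (expR (s * x) + expR (- s * x)))%R.
  have [->|xn] := eqVneq x 0%R.
    by rewrite normr0 powR0 ?gt_eqF// !mulr_ge0 ?powR_ge0 ?expR_ge0// addr_ge0 ?expR_ge0.
  have ax : (0 < `|x|)%R by rewrite normr_gt0.
  have l1 : (s * `|x| / p <= expR (s * `|x| / p - 1))%R.
    by have := expR_ge1Dx (s * `|x| / p - 1)%R; lra.
  have {l1} : ((s * `|x| / p) `^ p <= expR (s * `|x| - p))%R.
    have -> : expR (s * `|x| - p) = (expR (s * `|x| / p - 1) `^ p)%R.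
      by rewrite /powR gt_eqF ?expR_gt0// expRK; congr expR; field; rewrite gt_eqF.
    apply: ge0_ler_powR; rewrite ?nnegrE ?expR_ge0 ?(ltW p0)//.
    by rewrite divr_ge0 ?mulr_ge0// ltW.
  move=> l1; have xE : `|x|%R = ((p / s) * (s * `|x| / p))%R by field; rewrite !gt_eqF.
  rewrite [in leLHS]xE powRM; last 2 first.
  - by rewrite divr_ge0 ?ltW.
  - by rewrite divr_ge0 ?mulr_ge0 ?ltW.
  rewrite -[leRHS]mulrA ler_wpM2l ?powR_ge0//; apply: (le_trans l1).
  rewrite [(s * `|x| - p)%R]addrC expRD ler_wpM2l ?expR_ge0//.
  have := expR_ge0 (s * x)%R; have := expR_ge0 (- s * x)%R.
  have [x0|x0] := leP 0%R x; first by rewrite ger0_norm//; lra.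
  by rewrite ltr0_norm// mulrN -mulNr; lra.
have K0 : (0 <= (p / s) `^ p * expR (- p))%R by rewrite mulr_ge0 ?powR_ge0 ?expR_ge0.
have mexp s' : measurable_fun [set: N.-tuple E] (fun t => (expR (s' * tsum L t))%:E).
  apply/measurable_EFinP; apply: measurableT_comp => //.
  by apply: measurable_funM => //; exact: measurable_tsum.
apply: (@le_trans _ _ (\int[mu]_t (((p / s) `^ p * expR (- p))%:E *
    ((expR (s * tsum L t))%:E + (expR (- s * tsum L t))%:E)))).
  apply: ge0_le_integral_any => t; first by rewrite lee_fin powR_ge0.
  by rewrite -EFinD -EFinM lee_fin; exact: h.
rewrite ge0_integralZl_EFin//; last 2 first.
- by move=> t _; rewrite -EFinD lee_fin addr_ge0 ?expR_ge0.
- by apply: emeasurable_funD; exact: mexp.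
rewrite ge0_integralD//.
have b1 : \int[mu]_t (expR (s * tsum L t))%:E <=
    (expR ((size L)%:R * (expR 1 * (s * B) ^+ 2)))%:E.
  by apply: mgf_sum => //; rewrite gtr0_norm.
have b2 : \int[mu]_t (expR (- s * tsum L t))%:E <=
    (expR ((size L)%:R * (expR 1 * (s * B) ^+ 2)))%:E.
  rewrite -[((s * B) ^+ 2)%R]sqrrN -mulNr.
  by apply: mgf_sum => //; rewrite normrN gtr0_norm.
apply: (@le_trans _ _ (((p / s) `^ p * expR (- p))%:E *
  ((expR ((size L)%:R * (expR 1 * (s * B) ^+ 2)))%:E + (expR ((size L)%:R * (expR 1 * (s * B) ^+ 2)))%:E))).
  apply: lee_wpmul2l; first by rewrite lee_fin.
  exact: leeD.
rewrite -EFinD -EFinM lee_fin expRD le_eqVlt; apply/orP; left; apply/eqP; ring.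
Qed.

End Moments.

(** * Probability of a badly conditioned design *)

Section BadDesign.
Context (d : measure_display) (T : measurableType d) (R : realType)
  (phi : nat -> T -> R) (ev : nat -> R) (N : nat) (S : {set 'I_N})
  (mu : probability (N.-tuple (T * R)%type) R).
Hypothesis mphi : forall j, measurable_fun setT (phi j).
Hypothesis ev0 : forall j, 0 <= ev j.
Hypothesis S0 : (0 < #|S|)%N.
Local Notation n := (#|S|%:R : R).
Variable l : R.
Hypothesis l0 : 0 < l.

Definition design (t : N.-tuple (T * R)) (a : 'I_N) : T := (tnth t a).1.

Definition bad_event : set (N.-tuple (T * R)) :=
  [set t | ~ good_design phi ev S l (design t)].

Let F J t := gram_dev_frob phi ev S l J (design t).
Let BJ J : set (N.-tuple (T * R)) := [set t | 4^-1 < F J t].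

Let n0 : 0 < n. Proof. by rewrite ltr0n. Qed.

Lemma measurable_design (f : T -> R) a : measurable_fun setT f ->
  measurable_fun [set: N.-tuple (T * R)] (fun t => f (design t a)).
Proof.
move=> mf; apply: (measurableT_comp mf).
apply: (measurableT_comp (@measurable_fst _ _ T R)).
exact: measurable_tnth.
Qed.

Let mdev i j : measurable_fun [set: N.-tuple (T * R)]
  (fun t => gram_dev phi S i j (design t)).
Proof.
apply: measurable_funM => //.
rewrite (_ : (fun t => _) = fun t : N.-tuple (T * R) => \sum_(a <- enum S)
  (phi i (design t a) * phi j (design t a) - (i == j)%:R)); last first.
  by apply/funext => t; rewrite big_enum.
apply: measurable_sum => a; apply: measurable_funB => //.
by apply: measurable_funM; exact: measurable_design.
Qed.

Let mF J : measurable_fun [set: N.-tuple (T * R)] (F J).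
Proof.
apply: measurable_sum => i; apply: measurable_sum => j.
by apply: measurable_funM => //; apply: measurable_funX.
Qed.

Let mBJ J : measurable (BJ J).
Proof.
rewrite (_ : BJ J = F J @^-1` `]4^-1, +oo[%classic); last first.
  by apply/seteqP; split => t /=; rewrite in_itv/= andbT.
by rewrite -[X in measurable X]setTI; exact: mF.
Qed.

Let badE : bad_event = \bigcup_J BJ J.
Proof.
apply/seteqP; split => t /=.
  by move/existsNP => [J /negP]; rewrite -ltNge => tJ; exists J.
by move=> [J _ /= tJ] /(_ J); rewrite leNgt tJ.
Qed.

Lemma measurable_bad : measurable bad_event.
Proof. by rewrite badE; exact: bigcup_measurable. Qed.

Let term0 i j t : 0 <= shrink ev l i * shrink ev l j * gram_dev phi S i j (design t) ^+ 2.
Proof. by rewrite mulr_ge0 ?sqr_ge0// mulr_ge0// shrink_ge0. Qed.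

Let F_nd t : {homo F ^~ t : J J' / (J <= J')%N >-> J <= J'}.
Proof.
move=> J J' JJ'; rewrite /F /gram_dev_frob.
have sub (f : nat -> R) : (forall j, 0 <= f j) ->
    \sum_(0 <= j < J) f j <= \sum_(0 <= j < J') f j.
  move=> f0; rewrite (big_cat_nat _ JJ')//= lerDl.
  exact: sumr_ge0.
apply: (@le_trans _ _ (\sum_(0 <= i < J) \sum_(0 <= j < J')
    shrink ev l i * shrink ev l j * gram_dev phi S i j (design t) ^+ 2)).
  by apply: ler_sum => i _; exact: sub.
by apply: sub => i; apply: sumr_ge0.
Qed.

Variables (s G m : R).
Hypotheses (s1 : 1 < s) (m0 : 0 <= m).
Hypothesis hG : forall J, \sum_(0 <= j < J) shrink ev l j <= G.
Hypothesis hm : forall i j, (\int[mu]_t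
  (`|\sum_(a in S) (phi i (design t a) * phi j (design t a) - (i == j)%:R)|
     `^ (2 * s))%:E <= m%:E)%E.

Let G0 : 0 <= G. Proof. by have := hG 0; rewrite big_geq. Qed.

(** Jensen's inequality over the pairs (i, j) with weights w_i w_j, whose total is at
most G^2, reduces the weighted Frobenius norm to single entries. *)
Let moment_F J : (\int[mu]_t (F J t `^ s)%:E <=
  ((G ^+ 2 / n ^+ 2) `^ s * m)%:E)%E.
Proof.
have s0 : 0 < s by exact: lt_trans s1.
pose r := [seq (i, j) | i <- index_iota 0 J, j <- index_iota 0 J].
pose p (q : nat * nat) := shrink ev l q.1 * shrink ev l q.2.
pose D t (q : nat * nat) := gram_dev phi S q.1 q.2 (design t).
have p0 q : 0 <= p q by rewrite mulr_ge0// shrink_ge0.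
have FE t : F J t = \sum_(q <- r) p q * D t q ^+ 2.
  by rewrite /r big_allpairs.
have WE : \sum_(q <- r) p q <= G ^+ 2.
  rewrite /r big_allpairs /=.
  under eq_bigr do rewrite /p /= -mulr_sumr.
  rewrite -mulr_suml expr2; have h : 0 <= \sum_(0 <= j < J) shrink ev l j.
    by apply: sumr_ge0 => j _; exact: shrink_ge0.
  by apply: ler_pM.
have W0 : 0 <= \sum_(q <- r) p q by exact: sumr_ge0.
have DE t q : (D t q ^+ 2) `^ s = (n ^+ 2) ^-1 `^ s *
   (`|\sum_(a in S) (phi q.1 (design t a) * phi q.2 (design t a) - (q.1 == q.2)%:R)| `^ (2 * s)).
  rewrite /D /gram_dev exprMn powRM ?sqr_ge0// exprVn; congr (_ * _).
  by rewrite powRrM powR_mulrn// real_normK ?num_real.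
have mD q : measurable_fun [set: N.-tuple (T * R)] (fun t => D t q ^+ 2).
  by apply: measurable_funX; exact: mdev.
have mDs q : measurable_fun [set: N.-tuple (T * R)] (fun t => (D t q ^+ 2) `^ s).
  exact: (measurableT_comp (measurable_powR s) (mD q)).
pose W := (\sum_(q <- r) p q) `^ (s - 1).
have Wp : 0 <= W by exact: powR_ge0.
apply: (@le_trans _ _ (\int[mu]_t (W%:E * \sum_(q <- r) ((p q)%:E * ((D t q ^+ 2) `^ s)%:E)))%E).
  apply: ge0_le_integral_any => t; first by rewrite lee_fin powR_ge0.
  under eq_bigr do rewrite -EFinM.
  rewrite sumEFin -EFinM lee_fin FE; apply: powR_jensen => // q.
  exact: sqr_ge0.
rewrite ge0_integralZl_EFin//; last 2 first.
- by move=> t _; apply: sume_ge0 => q _; rewrite -EFinM lee_fin mulr_ge0// powR_ge0.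
- apply: emeasurable_sum => q; apply: measurable_funeM.
  exact/measurable_EFinP.
rewrite ge0_integral_sum//; last 2 first.
- by move=> q; apply: measurable_funeM; exact/measurable_EFinP.
- by move=> q t _; rewrite -EFinM lee_fin mulr_ge0// powR_ge0.
pose c := (n ^+ 2)^-1 `^ s * m.
have c0 : 0 <= c by rewrite mulr_ge0// powR_ge0.
apply: (@le_trans _ _ (W%:E * \sum_(q <- r) ((p q)%:E * c%:E))%E).
  apply: lee_wpmul2l; rewrite ?lee_fin//; apply: lee_sum => q _.
  rewrite ge0_integralZl_EFin//; last 2 first.
  - by move=> t _; rewrite lee_fin powR_ge0.
  - exact/measurable_EFinP.
  apply: lee_wpmul2l; rewrite ?lee_fin//.
  under eq_integral do rewrite DE EFinM.
  rewrite ge0_integralZl_EFin ?powR_ge0//; last first.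
    apply/measurable_EFinP; apply: measurable_powR_norm.
    rewrite (_ : (fun t => _) = fun t : N.-tuple (T * R) => \sum_(a <- enum S)
      (phi q.1 (design t a) * phi q.2 (design t a) - (q.1 == q.2)%:R)); last first.
      by apply/funext => t; rewrite big_enum.
    apply: measurable_sum => a; apply: measurable_funB => //.
    by apply: measurable_funM; exact: measurable_design.
  rewrite /c EFinM; apply: lee_wpmul2l; first by rewrite lee_fin powR_ge0.
  exact: hm.
under eq_bigr do rewrite -EFinM.
rewrite sumEFin -EFinM lee_fin -mulr_suml mulrA /W [X in X * c]mulrC.
rewrite mulr_powRB1// /c mulrA powRM ?sqr_ge0 ?invr_ge0 ?sqr_ge0//.
rewrite ler_wpM2r// ler_wpM2r ?powR_ge0//.
by apply: ge0_ler_powR; rewrite ?nnegrE ?sqr_ge0 ?(ltW s0).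
Qed.

(** Markov's inequality for the power s of each finite section of the weighted
Frobenius norm; the sections increase with J, so the bound holds for their union. *)
Lemma bad_prob : (mu bad_event <= ((4 * (G ^+ 2 / n ^+ 2)) `^ s * m)%:E)%E.
Proof.
have s0 : 0 < s by exact: lt_trans s1.
have leJ J : (mu (BJ J) <= ((4 * (G ^+ 2 / n ^+ 2)) `^ s * m)%:E)%E.
  rewrite -[BJ J]setIT -integral_indic//.
  have F0 t : 0 <= F J t by apply: sumr_ge0 => i _; apply: sumr_ge0.
  apply: (@le_trans _ _ (\int[mu]_t ((4 `^ s)%:E * (F J t `^ s)%:E))%E).
    apply: ge0_le_integral_any => t; first by rewrite lee_fin.
    rewrite -EFinM lee_fin -powRM// indicE; case: (boolP (_ \in _)) => [|_]; last exact: powR_ge0.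
    rewrite inE /BJ /= => tJ; apply: (@le_trans _ _ (1 `^ s)); first by rewrite powR1.
    apply: ge0_ler_powR; rewrite ?nnegrE ?mulr_ge0 ?(ltW s0)//.
    by lra.
  rewrite ge0_integralZl_EFin ?powR_ge0//; first last.
  - by apply/measurable_EFinP; exact: (measurableT_comp (measurable_powR s) (mF J)).
  - by move=> t _; rewrite lee_fin powR_ge0.
  rewrite powRM ?mulr_ge0 ?invr_ge0 ?sqr_ge0// -mulrA EFinM.
  by apply: lee_wpmul2l; [rewrite lee_fin powR_ge0|exact: moment_F].
have cvg := @nondecreasing_cvg_mu _ _ _ mu BJ mBJ _ _.
rewrite badE; apply: cvge_le (cvg _ _); first by near=> J; exact: leJ.
  exact: bigcup_measurable.
move=> J J' JJ'; apply/subsetPset => t /= tJ.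
by apply: lt_le_trans tJ _; exact: F_nd.
Unshelve. all: by end_near. Qed.

End BadDesign.

Section GramMoments.
Context (d : measure_display) (T : measurableType d) (R : realType)
  (P : probability (T * R)%type R) (phi : nat -> T -> R).
Hypothesis hphi : is_orthonormal_basis (marginal P) phi.

Let mphi j : measurable_fun setT (phi j).
Proof. exact: Lfun_measurable (onb_L2 hphi j). Qed.

Lemma integral_marginal (f : T -> \bar R) : measurable_fun setT f ->
  (forall x, 0 <= f x)%E ->
  (\int[P]_z f z.1 = \int[marginal P]_x f x)%E.
Proof. by move=> mf f0; rewrite ge0_integral_pushforward. Qed.

Lemma integrable_marginal (f : T -> R) :
  (marginal P).-integrable setT (EFin \o f) ->
  P.-integrable setT (EFin \o (fun z => f z.1)).
Proof.
move=> /integrableP[mf ifin]; have mf' : measurable_fun setT f by exact/measurable_EFinP.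
apply/integrableP; split.
  apply/measurable_EFinP.
  exact: (measurableT_comp mf' (@measurable_fst _ _ T R)).
rewrite (integral_marginal (f := fun x => `|(f x)%:E|)%E)//.
by apply: measurableT_comp.
Qed.

Lemma integral_marginal_int (f : T -> R) :
  (marginal P).-integrable setT (EFin \o f) ->
  (\int[P]_z (f z.1)%:E = \int[marginal P]_x (f x)%:E)%E.
Proof.
move=> fi; have /integrableP[mf _] := fi.
rewrite [RHS]integral_pushforward//.
exact: integrable_marginal.
Qed.

Definition gram_entry (i j : nat) (z : T * R) : R :=
  phi i z.1 * phi j z.1 - (i == j)%:R.

Lemma measurable_gram_entry i j : measurable_fun setT (gram_entry i j).
Proof.
apply: measurable_funB => //; apply: measurable_funM.
  exact: (measurableT_comp (mphi i) (@measurable_fst _ _ T R)).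
exact: (measurableT_comp (mphi j) (@measurable_fst _ _ T R)).
Qed.

Let iphi i j : P.-integrable setT (EFin \o (fun z => phi i z.1 * phi j z.1)).
Proof.
apply: (integrable_marginal (f := fun x => phi i x * phi j x)).
by apply/Lfun1_integrable; exact: (Lfun2_mul_Lfun1 (onb_L2 hphi i) (onb_L2 hphi j)).
Qed.

Lemma integrable_gram_entry i j : P.-integrable setT (EFin \o gram_entry i j).
Proof.
have ic : P.-integrable setT (EFin \o (fun=> (i == j)%:R : R)).
  exact: finite_measure_integrable_cst.
by have := integrableB measurableT (iphi i j) ic; apply: eq_integrable.
Qed.

Lemma gram_entry_centered i j : (\int[P]_z (gram_entry i j z)%:E = 0)%E.
Proof.
have ic : P.-integrable setT (EFin \o (fun=> (i == j)%:R : R)).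
  exact: finite_measure_integrable_cst.
have := integralB_EFin measurableT (iphi i j) ic.
rewrite integral_probability_cst.
rewrite (integral_marginal_int (f := fun x => phi i x * phi j x)); last first.
  by apply/Lfun1_integrable; exact: (Lfun2_mul_Lfun1 (onb_L2 hphi i) (onb_L2 hphi j)).
by rewrite (onb_orthonormal hphi) subee.
Qed.

Lemma sum_gram_entry N (S : {set 'I_N}) i j (t : N.-tuple (T * R)) :
  \sum_(a in S) (phi i (design t a) * phi j (design t a) - (i == j)%:R) =
  \sum_(a <- enum S) gram_entry i j (tnth t a).
Proof. by rewrite big_enum. Qed.

(** An entry is at most 2 max(|phi_i|, |phi_j|, 1)^2 in absolute value, so its k-th
moment is bounded uniformly in i and j, and [moment_sum] applies. *)
Lemma gram_moment (k rho : R) : 2 < k ->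
  (forall j, (\int[marginal P]_x (`|phi j x| `^ (2 * k))%:E <= (rho `^ (2 * k))%:E)%E) ->
  exists2 M : R, 0 <= M & forall N (S : {set 'I_N}) (mu : probability (N.-tuple (T * R)%type) R),
    is_product_law P mu -> (0 < #|S|)%N -> forall i j,
    (\int[mu]_t (`|\sum_(a in S) (phi i (design t a) * phi j (design t a) - (i == j)%:R)| `^ k)%:E
     <= (M * #|S|%:R `^ (k / 2))%:E)%E.
Proof.
move=> k2 hmom; have k0 : 0 < k by lra.
pose r := rho `^ (2 * k); have r0 : 0 <= r by exact: powR_ge0.
pose M := 2 `^ k * (2 * r + 1) + 1.
have M0 : 0 <= M by rewrite addr_ge0// mulr_ge0 ?powR_ge0// addr_ge0// mulr_ge0.
have mpk j : measurable_fun setT (fun x => `|phi j x| `^ (2 * k)).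
  exact: measurable_powR_norm.
have mk : forall i j, (\int[P]_z (`|gram_entry i j z| `^ k)%:E <= (2 `^ k * (2 * r + 1))%:E)%E.
  move=> i j.
  have pt z : `|gram_entry i j z| `^ k <=
      2 `^ k * (`|phi i z.1| `^ (2 * k) + `|phi j z.1| `^ (2 * k) + 1).
    set u := `|phi i z.1|; set v := `|phi j z.1|.
    have u0 : 0 <= u := normr_ge0 _; have v0 : 0 <= v := normr_ge0 _.
    have le1 : `|gram_entry i j z| <= 2 * (Num.max (Num.max u v) 1) ^+ 2.
      apply: (@le_trans _ _ (u * v + 1)).
        apply: le_trans (ler_normB _ _) _; rewrite normrM -/u -/v lerD2l.
        by case: (i == j); rewrite ?normr1 ?normr0.
      set w := Num.max _ 1.
      have uw : u <= w by rewrite /w !le_max lexx.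
      have vw : v <= w by rewrite /w !le_max lexx orbT.
      have w1 : 1 <= w by rewrite /w le_max lexx orbT.
      by have := ler_pM u0 v0 uw vw; rewrite -expr2; nra.
    apply: (@le_trans _ _ ((2 * (Num.max (Num.max u v) 1) ^+ 2) `^ k)).
      have q0 : 0 <= 2 * Num.max (Num.max u v) 1 ^+ 2.
        by rewrite mulr_ge0// sqr_ge0.
      by apply: (ge0_ler_powR (ltW k0) _ _ le1); rewrite nnegrE.
    rewrite powRM ?sqr_ge0// ler_wpM2l ?powR_ge0//.
    have e w : 0 <= w -> (w ^+ 2) `^ k = w `^ (2 * k) by move=> w0; rewrite powRrM powR_mulrn.
    have := powR_ge0 u (2 * k); have := powR_ge0 v (2 * k) => ? ?.
    rewrite /Num.max; case: ifP => _; first by rewrite expr1n powR1; lra.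
    by case: ifP => _; rewrite e//; lra.
  apply: (@le_trans _ _ (\int[P]_z ((2 `^ k)%:E * ((`|phi i z.1| `^ (2 * k))%:E + (`|phi j z.1| `^ (2 * k))%:E + 1%:E)))%E).
    apply: ge0_le_integral_any => z; first by rewrite lee_fin powR_ge0.
    by rewrite -!EFinD -EFinM lee_fin.
  have mpf j' : measurable_fun setT (fun z : T * R => (`|phi j' z.1| `^ (2 * k))%:E).
    apply/measurable_EFinP.
    exact: (measurableT_comp (mpk j') (@measurable_fst _ _ T R)).
  have int1 j' : (\int[P]_z (`|phi j' z.1| `^ (2 * k))%:E <= r%:E)%E.
    rewrite (integral_marginal (f := fun x => (`|phi j' x| `^ (2 * k))%:E))//.
    exact/measurable_EFinP.
  rewrite ge0_integralZl_EFin ?powR_ge0//; first last.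
  - by do 2 (apply: emeasurable_funD => //).
  - by move=> z _; rewrite -!EFinD lee_fin !addr_ge0 ?powR_ge0.
  rewrite ge0_integralD//; last 2 first.
  - by move=> z _; rewrite -EFinD lee_fin addr_ge0 ?powR_ge0.
  - exact: emeasurable_funD.
  rewrite ge0_integralD// integral_probability_cst EFinM; apply: lee_wpmul2l.
    by rewrite lee_fin powR_ge0.
  apply: le_trans (leeD (leeD (int1 i) (int1 j)) (lexx 1%E)) _.
  by rewrite -!EFinD lee_fin; lra.
have mk' i j : (\int[P]_z (`|gram_entry i j z| `^ k)%:E <= M%:E)%E.
  by apply: le_trans (mk i j) _; rewrite lee_fin lerDl.
have m2 i j : (\int[P]_z (gram_entry i j z ^+ 2)%:E <= M%:E)%E.
  apply: (@le_trans _ _ (\int[P]_z ((`|gram_entry i j z| `^ k)%:E + 1%:E))%E).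
    apply: ge0_le_integral_any => z; first by rewrite lee_fin sqr_ge0.
    rewrite -EFinD lee_fin -real_normK ?num_real//; set w := `|_|.
    have w0 : 0 <= w := normr_ge0 _.
    have [w1|w1] := leP w 1; first by have := powR_ge0 w k; nra.
    have := ler_powR (ltW w1) (ltW k2); rewrite (powR_mulrn 2)//; lra.
  rewrite ge0_integralD//; last by apply/measurable_EFinP; apply: measurable_powR_norm; exact: measurable_gram_entry.
  rewrite integral_probability_cst EFinD leeD2r//; exact: mk.
have [C C0 taylor] := @powR_taylor R k k2.
have CM0 : 0 <= C * M by exact: mulr_ge0.
exists (2 * C * M * expR (C * M)) => [|N S mu hmu S0 i j].
  by rewrite mulr_ge0 ?expR_ge0// -mulrA mulr_ge0.
have n1 : 1 <= #|S|%:R :> R by rewrite ler1n.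
under eq_integral do rewrite sum_gram_entry.
apply: le_trans (moment_sum hmu (measurable_gram_entry i j) k2 M0 (integrable_gram_entry i j)
  (gram_entry_centered i j) (m2 i j) (mk' i j) C0 taylor n1 (enum_uniq _)) _.
rewrite -cardE lee_fin; set n := #|S|%:R.
have n0 : 0 < n by lra.
have -> : n * (2 * C * M * n `^ (k / 2 - 1)) = 2 * C * M * n `^ (k / 2).
  by rewrite -(mulr_powRB1 (ltW n0) (_ : 0 < k / 2)) ?divr_gt0//; ring.
rewrite -[leRHS]mulrA [expR _ * _]mulrC mulrA ler_wpM2l//.
  by rewrite mulr_ge0 ?powR_ge0// -mulrA mulr_ge0.
have CMn : 0 <= 1 + C * M / n by rewrite addr_ge0// divr_ge0// ltW.
apply: (@le_trans _ _ (expR (C * M / n) ^+ #|S|)).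
  by apply: lerXn2r; rewrite ?nnegrE ?expR_ge0// expR_ge1Dx.
by rewrite -expRM_natr -/n mulfVK ?gt_eqF.
Qed.

Lemma gram_moment_bounded (rho s p : R) : (forall j x, `|phi j x| <= rho) ->
  0 < s -> s * (rho ^+ 2 + 1) <= 1 -> 0 < p ->
  forall N (S : {set 'I_N}) (mu : probability (N.-tuple (T * R)%type) R),
    is_product_law P mu -> forall i j,
    (\int[mu]_t (`|\sum_(a in S) (phi i (design t a) * phi j (design t a) - (i == j)%:R)| `^ p)%:E
     <= (2 * (p / s) `^ p * expR (#|S|%:R * (expR 1 * (s * (rho ^+ 2 + 1)) ^+ 2) - p))%:E)%E.
Proof.
move=> hrho s0 sB p0 N S mu hmu i j.
under eq_integral do rewrite sum_gram_entry.
rewrite cardE; apply: (bounded_moment hmu (measurable_gram_entry i j)) => //.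
- move=> z; apply: le_trans (ler_normB _ _) _; rewrite normrM expr2; apply: lerD.
    exact: ler_pM.
  by case: (i == j); rewrite ?normr1 ?normr0.
- exact: gram_entry_centered.
- exact: enum_uniq.
Qed.

End GramMoments.

(** * Effective dimension under polynomial decay *)

Section EffectiveDimension.
Context (R : realType).
Implicit Types (nu x : R).

Lemma near_powR_ge (p X : R) : 0 < p -> \forall N \near \oo, X <= N%:R `^ p.
Proof.
move=> p0; have := nbhs_infty_ger (Num.max X 1 `^ p^-1); apply: filterS => N.
move=> /(ge0_ler_powR (ltW p0)); rewrite !nnegrE powR_ge0 ler0n => /(_ isT isT).
rewrite -powRrM mulVf ?gt_eqF// powRr1 ?le_max ?ler01 ?orbT//.
by apply: le_trans; rewrite le_max lexx.
Qed.

Lemma near_ln_ge (X : R) : \forall N \near \oo, X <= ln (N%:R : R).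
Proof.
have := nbhs_infty_ger (expR X); apply: filterS => N XN.
by rewrite -[leLHS]expRK ler_ln ?posrE ?expR_gt0// (lt_le_trans _ XN)// expR_gt0.
Qed.

(** Bernoulli's inequality for (1 - u)^(-a) with u = 1 / (j + 1); it bounds the terms of
a p-series by differences. *)
Lemma powR_tail_step (a : R) (j : nat) : 0 < a -> (0 < j)%N ->
  a * j.+1%:R `^ (- (a + 1)) <= j%:R `^ (- a) - j.+1%:R `^ (- a).
Proof.
move=> a0 j0; pose y : R := j.+1%:R; pose u := y^-1.
have y0 : 0 < y by rewrite ltr0n.
have u0 : 0 < u by rewrite invr_gt0.
have u1 : u < 1 by rewrite invf_lt1// ltr1n.
have jE : j%:R = y * (1 - u).
  by rewrite mulrBr mulr1 divff ?gt_eqF// /y -natr1 addrK.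
have l1 : 1 + a * u <= (1 - u) `^ (- a).
  rewrite /powR gt_eqF ?subr_gt0//; apply: le_trans _ (expR_ge1Dx _).
  rewrite lerD2l mulNr -mulrN ler_wpM2l ?(ltW a0)//.
  by have := @le_ln1Dx R (- u); lra.
rewrite jE powRM ?(ltW y0) ?subr_ge0 ?(ltW u1)//.
have -> : j.+1%:R `^ (- (a + 1)) = y `^ (- a) * u.
  rewrite opprD powRD; last by apply/implyP => _; rewrite pnatr_eq0.
  by rewrite powR_inv1// ltW.
have := ler_wpM2l (powR_ge0 y (- a)) l1; rewrite -/y mulrDr mulr1.
lra.
Qed.

Lemma powR_tail (a : R) (d J : nat) : 0 < a -> (0 < d)%N ->
  a * \sum_(d <= j < J) j.+1%:R `^ (- (a + 1)) <= d%:R `^ (- a).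
Proof.
move=> a0 d0; have [Jd|dJ] := leqP J d.
  by rewrite big_geq// mulr0 powR_ge0.
rewrite mulr_sumr; apply: (@le_trans _ _
    (\sum_(d <= j < J) (- (j.+1%:R `^ (- a)) - - (j%:R `^ (- a))))).
  rewrite !big_nat; apply: ler_sum => j /andP[dj _]; rewrite opprK [leRHS]addrC.
  by apply: powR_tail_step => //; exact: leq_trans dj.
rewrite (telescope_sumr (fun j => - (j%:R `^ (- a)))) ?(ltnW dJ)//.
by rewrite opprK addrC gerDl oppr_le0 powR_ge0.
Qed.

Definition krr_lam nu (N : nat) : R := (1 / N%:R) `^ (2 * nu / (2 * nu + 1)).
(** The order of the number of eigenvalues above the regularization level when
mu_j = j^(-2 nu). *)
Definition krr_dim nu (N : nat) : R := N%:R `^ (1 / (2 * nu + 1)).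

Lemma krr_lamE nu N : 0 < nu -> krr_lam nu N = krr_dim nu N `^ (- (2 * nu)).
Proof.
move=> nu0; rewrite /krr_lam /krr_dim -powRrM div1r -powR_inv1 ?ler0n// -powRrM.
by congr (_ `^ _); field; rewrite gt_eqF//; lra.
Qed.

(** The first kap D weights are at most 1 each and the others at most
mu_j / (t lambda), whose sum is of order C D (kap^(1 - 2 nu)) / t. With kap = e / 4 and
t large enough both parts are fractions of e D. *)
Lemma effective_dim nu (C : R) (mu : nat -> R) (e : R) : 1 / 2 < nu -> 0 < e ->
  (forall j, 0 <= mu j) -> (forall j, mu j <= C * j.+1%:R `^ (- (2 * nu))) ->
  exists2 t, 2 <= t & \forall N \near \oo, forall J,
    \sum_(0 <= j < J) shrink mu (t * krr_lam nu N) j <= e * krr_dim nu N.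
Proof.
move=> nu12 e0 mu0 muC; pose a := 2 * nu - 1.
have a0 : 0 < a by rewrite /a; lra.
have nu0 : 0 < nu by lra.
have C0 : 0 <= C.
  by have := le_trans (mu0 0%N) (muC 0%N); rewrite powR1 mulr1.
pose kap := e / 4; have kap0 : 0 < kap by rewrite divr_gt0.
(* beyond this value of t the weights of index at least kap D sum up to at most e D / 4 *)
pose t0 := 4 * C * kap `^ (- a) / (a * e).
exists (Num.max 2 t0); first by rewrite le_max lexx.
set t := Num.max _ _; have t2 : 2 <= t by rewrite le_max lexx.
have tt0 : t0 <= t by rewrite le_max lexx orbT.
have p0 : 0 < 1 / (2 * nu + 1) by rewrite divr_gt0//; lra.
have := near_powR_ge (4 / e) p0; apply: filterS => N; rewrite -/(krr_dim nu N).
set D := krr_dim nu N => De J.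
have D0 : 0 < D by apply: lt_le_trans De; rewrite divr_gt0.
pose lam := krr_lam nu N; have lamE : lam = D `^ (- (2 * nu)) by exact: krr_lamE.
have lam0 : 0 < lam by rewrite lamE powR_gt0.
have l0 : 0 < t * lam by rewrite mulr_gt0//; lra.
pose d := (Num.trunc (kap * D)).+1.
have kD0 : 0 <= kap * D by rewrite mulr_ge0 ?ltW.
have dge : kap * D <= d%:R by rewrite ltW// truncnS_gt.
have dle : d%:R <= kap * D + 1.
  by rewrite /d -natr1 lerD2r truncn_le.
have sle j : shrink mu (t * lam) j <= (t * lam)^-1 * (C * j.+1%:R `^ (- (a + 1))).
  rewrite /shrink mulrC; apply: ler_pM => //.
  - by rewrite invr_ge0 addr_ge0// ltW.
  - by rewrite lef_pV2 ?posrE ?ltr_wpDl// lerDr.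
  - by rewrite /a subrK.
have head K : \sum_(0 <= j < K) shrink mu (t * lam) j <= K%:R.
  apply: (@le_trans _ _ (\sum_(0 <= j < K) 1)).
    by apply: ler_sum => j _; exact: shrink_le1.
  by rewrite big_const_nat subn0 iter_addr_0.
have tail : (t * lam)^-1 * (C * (d%:R `^ (- a) / a)) <= e / 4 * D.
  have da : d%:R `^ (- a) <= kap `^ (- a) * D `^ (- a).
    rewrite -powRM ?(ltW kap0) ?(ltW D0)// !powRN lef_pV2 ?posrE ?powR_gt0 ?mulr_gt0 ?ltr0n//.
    by apply: ge0_ler_powR; rewrite ?nnegrE ?ler0n ?(ltW a0).
  have DE : D = lam^-1 * D `^ (- a).
    rewrite lamE -powRN opprK -powRD; last by apply/implyP => _; rewrite gt_eqF.
    rewrite /a (_ : 2 * nu - (2 * nu - 1) = 1); last by ring.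
    by rewrite powRr1// ltW.
  have tp : 0 < t by lra.
  apply: (@le_trans _ _ ((t * lam)^-1 * (C * (kap `^ (- a) * D `^ (- a) / a)))).
    by rewrite ler_wpM2l ?invr_ge0 ?(ltW l0)// ler_wpM2l// ler_wpM2r// invr_ge0 ltW.
  have -> : (t * lam)^-1 * (C * (kap `^ (- a) * D `^ (- a) / a)) =
     (t0 / t) * (e / 4 * (lam^-1 * D `^ (- a))).
    by rewrite /t0; field; rewrite ?gt_eqF.
  rewrite -DE ler_piMl ?mulr_ge0 ?divr_ge0 ?(ltW e0) ?(ltW D0)//.
  by rewrite ler_pdivrMr// mul1r.
have key : \sum_(0 <= j < J) shrink mu (t * lam) j <= d%:R + e / 4 * D.
  have [Jd|dJ] := leqP J d.
    apply: le_trans (head J) _; rewrite -[leLHS]addr0; apply: lerD; first by rewrite ler_nat.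
    by rewrite mulr_ge0 ?divr_ge0 ?(ltW e0) ?(ltW D0).
  rewrite (big_cat_nat (n := d))//= ?(ltnW dJ)//; apply: lerD => //.
  apply: le_trans tail.
  apply: (@le_trans _ _ (\sum_(d <= j < J) (t * lam)^-1 * (C * j.+1%:R `^ (- (a + 1))))).
    by apply: ler_sum => j _; exact: sle.
  rewrite -mulr_sumr ler_wpM2l ?invr_ge0 ?(ltW l0)// -mulr_sumr ler_wpM2l//.
  by rewrite ler_pdivlMr// mulrC; exact: powR_tail.
apply: (le_trans key); have : 1 <= e / 4 * D.
  by move: De; rewrite ler_pdivrMr // => De; lra.
by move=> h1; move: dle; rewrite /kap; move: h1; lra.
Qed.

End EffectiveDimension.

(** * The law of the sample, orthogonality, measurability of matrix inversion *)

Section SampleLaw.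
Context (d d' : measure_display) (Om : measurableType d) (E : measurableType d')
  (R : realType) (Q : probability Om R) (P : probability E R) (N : nat)
  (Z : 'I_N -> {RV Q >-> E}).
Hypothesis hZ : is_iid_sample P Z.

Definition sample_tuple (w : Om) : N.-tuple E := [tuple Z i w | i < N].

Lemma measurable_sample_tuple : measurable_fun setT sample_tuple.
Proof.
apply/measurable_fun_tnthP => i.
rewrite (_ : _ \o _ = Z i)//.
by apply/funext => w /=; rewrite tnth_mktuple.
Qed.

HB.instance Definition _ := isMeasurableFun.Build _ _ _ _ sample_tuple
  measurable_sample_tuple.

Definition sample_law : probability (N.-tuple E) R := distribution Q sample_tuple.

Lemma sample_law_product : is_product_law P sample_law.
Proof.
move=> B mB; transitivity (Q (\bigcap_(i in [set i | i \in [set: 'I_N]%SET]) Z i @^-1` B i)).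
  rewrite /sample_law /= /distribution /pushforward; congr (Q _).
  apply/seteqP; split => w /=.
    by move=> h i _; have := h i; rewrite tnth_mktuple.
  by move=> h i; rewrite tnth_mktuple; apply: h => /=; rewrite inE.
rewrite (iid_indep hZ)//; apply: eq_big => i; first by rewrite inE.
by move=> _; have := iid_law hZ i (mB i); rewrite /distribution /pushforward => ->.
Qed.

(** Here [f] is typically the squared error of the estimate, whose measurability is not
clear, and [g] a measurable bound for it. *)
Lemma integral_sample_le (f : Om -> \bar R) (g : N.-tuple E -> \bar R) :
  measurable_fun setT g -> (forall w, 0 <= f w)%E ->
  (forall w, f w <= g (sample_tuple w))%E -> (forall t, 0 <= g t)%E ->
  (\int[Q]_w f w <= \int[sample_law]_t g t)%E.
Proof.
move=> mg f0 fg g0; rewrite (ge0_integral_pushforward measurable_sample_tuple Q)//.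
by rewrite preimage_setT; exact: ge0_le_integral_any.
Qed.

End SampleLaw.

Section OrthogonalSums.
Context (d : measure_display) (X : measurableType d) (R : realType)
  (mu : probability X R).

Lemma integrable_prod_sqr (f g : X -> R) :
  measurable_fun setT f -> measurable_fun setT g ->
  mu.-integrable setT (EFin \o (fun x => f x ^+ 2)) ->
  mu.-integrable setT (EFin \o (fun x => g x ^+ 2)) ->
  mu.-integrable setT (EFin \o (fun x => f x * g x)).
Proof.
move=> mf mg f2 g2; apply: (le_integrable measurableT _ _ (integrableD measurableT f2 g2)).
  by apply/measurable_EFinP; exact: measurable_funM.
move=> x _ /=; rewrite lee_fin [leRHS]ger0_norm ?addr_ge0 ?sqr_ge0// normrM.
rewrite -(real_normK (num_real (f x))) -(real_normK (num_real (g x))).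
have := sqr_ge0 (`|f x| - `|g x|); have := sqr_ge0 `|f x|; have := sqr_ge0 `|g x|.
by rewrite !expr2; nra.
Qed.

Lemma integral_sqr_orthogonal (I : eqType) (r : seq I) (f : I -> X -> R) :
  uniq r -> (forall i, measurable_fun setT (f i)) ->
  (forall i, mu.-integrable setT (EFin \o (fun x => f i x ^+ 2))) ->
  {in r &, forall i j, i != j -> (\int[mu]_x (f i x * f j x)%:E = 0)%E} ->
  (\int[mu]_x ((\sum_(i <- r) f i x) ^+ 2)%:E =
   \sum_(i <- r) \int[mu]_x (f i x ^+ 2)%:E)%E.
Proof.
move=> ur mf f2 f0.
have fij i j := integrable_prod_sqr (mf i) (mf j) (f2 i) (f2 j).
transitivity (\int[mu]_x (\sum_(i <- r) \sum_(j <- r) (f i x * f j x)%:E))%E.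
  apply: eq_integral => x _; rewrite expr2 big_distrl/= -sumEFin.
  by apply: eq_bigr => i _; rewrite big_distrr/= -sumEFin.
rewrite integral_sum//; last by move=> i; apply: integrable_sum => // j _; exact: fij.
rewrite big_seq [RHS]big_seq; apply: eq_bigr => i ir.
rewrite integral_sum//; last by move=> j; exact: fij.
rewrite (bigD1_seq i)//= big_seq_cond big1 ?adde0 => [|j /andP[jr ji]].
  by apply: eq_integral => x _; rewrite expr2.
by rewrite f0// eq_sym.
Qed.

End OrthogonalSums.

Section MeasurableMatrix.
Context (d : measure_display) (X : measurableType d) (R : realType).

(** The inverse is x (x^2)^(-1), and real powers are measurable; the point 0 is
covered by the convention 0^-1 = 0. *)
Lemma measurable_inv_fun (f : X -> R) :
  measurable_fun setT f -> measurable_fun setT (fun x => (f x)^-1).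
Proof.
move=> mf; rewrite (_ : (fun x => _) = fun x => f x * (f x ^+ 2) `^ (-1)).
  apply: measurable_funM => //.
  by apply: (measurableT_comp (measurable_powR (-1))); exact: measurable_funX.
apply/funext => x; rewrite powR_inv1 ?sqr_ge0//.
have [->|fx] := eqVneq (f x) 0; first by rewrite invr0 mul0r.
by field.
Qed.

Lemma measurable_det n (A : X -> 'M[R]_n) :
  (forall i j, measurable_fun setT (fun x => A x i j)) ->
  measurable_fun setT (fun x => \det (A x)).
Proof.
move=> mA; apply: measurable_sum => s; apply: measurable_funM => //.
by apply: measurable_prod => i _; exact: mA.
Qed.

(** Cramer's rule expresses the entries of the inverse by determinants. *)
Lemma measurable_invmx n (A : X -> 'M[R]_n) :
  (forall i j, measurable_fun setT (fun x => A x i j)) ->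
  (forall x, A x \in unitmx) ->
  forall i j, measurable_fun setT (fun x => invmx (A x) i j).
Proof.
move=> mA uA i j.
rewrite (_ : (fun x => _) = fun x => (\det (A x))^-1 *
    ((-1) ^+ (j + i) * \det (row' j (col' i (A x))))).
  apply: measurable_funM.
    exact/measurable_inv_fun/measurable_det.
  apply: measurable_funM => //; apply: measurable_det => a b.
  rewrite (_ : (fun x => _) = fun x => A x (lift j a) (lift i b))//.
  by apply/funext => x; rewrite !mxE.
by apply/funext => x; rewrite /invmx uA !mxE.
Qed.

End MeasurableMatrix.

(** * The noise part of the estimate *)

Section NoiseEnergy.
Context (d : measure_display) (T : measurableType d) (R : realType)
  (P : probability (T * R)%type R) (fstar var : T -> R) (sigma : R)
  (phi : nat -> T -> R) (ev : nat -> R).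
Hypothesis mfstar : measurable_fun setT fstar.
Hypothesis hfstar : is_cond_exp (P := P) (@fst T R) snd fstar.
Hypothesis hvar :
  is_cond_exp (P := P) (@fst T R) (fun w => (w.2 - fstar w.1) ^+ 2) var.
Hypothesis hsigma : forall x, var x <= sigma ^+ 2.
Hypothesis hphi : is_orthonormal_basis (marginal P) phi.
Hypothesis ev0 : forall j, 0 <= ev j.
Context (N : nat) (S : {set 'I_N}) (mu : probability (N.-tuple (T * R)%type) R).
Hypothesis hmu : is_product_law P mu.
Hypothesis S0 : (0 < #|S|)%N.
Local Notation n := (#|S|%:R : R).
Local Notation eps := (noise fstar).

Let mphi j : measurable_fun setT (phi j).
Proof. exact: Lfun_measurable (onb_L2 hphi j). Qed.

Let n0 : 0 < n. Proof. by rewrite ltr0n. Qed.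

Definition noise_at (t : N.-tuple (T * R)) (a : 'I_N) : R := eps (tnth t a).

Lemma measurable_noise_at a :
  measurable_fun [set: N.-tuple (T * R)] (fun t => noise_at t a).
Proof. by apply: measurable_tnth_comp; exact: measurable_noise. Qed.

Lemma integral_noise_sqr a : (\int[mu]_t (noise_at t a ^+ 2)%:E <= (sigma ^+ 2)%:E)%E.
Proof.
have := noise_variance_tuple mfstar hvar hsigma hmu (a := a) (G := fun=> 1).
under eq_integral do rewrite mulr1.
by rewrite integral_probability_cst mule1; apply.
Qed.

Lemma integrable_noise_at a : mu.-integrable setT (EFin \o (fun t => noise_at t a ^+ 2)).
Proof.
apply/integrableP; split.
  by apply/measurable_EFinP; apply: measurable_funX; exact: measurable_noise_at.
under eq_integral do rewrite /= ger0_norm ?sqr_ge0//.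
exact: le_lt_trans (integral_noise_sqr a) (ltry _).
Qed.

Let f j a t := noise_at t a * phi j (design t a).

Let mf j a : measurable_fun [set: N.-tuple (T * R)] (f j a).
Proof. by apply: measurable_funM; [exact: measurable_noise_at|exact: measurable_design]. Qed.

Let f2le j a : (\int[mu]_t (f j a t ^+ 2)%:E <= (sigma ^+ 2)%:E)%E.
Proof.
under eq_integral do rewrite /f exprMn.
have mg : measurable_fun [set: N.-tuple (T * R)] (fun t => phi j (design t a) ^+ 2).
  by apply: measurable_funX; exact: measurable_design.
apply: le_trans.
  apply: (noise_variance_tuple mfstar hvar hsigma hmu (a := a) mg).
    by move=> z z' t zz'; rewrite /design !tnth_upd eqxx zz'.
  by move=> t; exact: sqr_ge0.
have m2 : measurable_fun setT (fun x => (phi j x ^+ 2)%:E).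
  by apply/measurable_EFinP; apply: measurable_funX.
rewrite /design (integral_tnth hmu a (F := fun z => (phi j z.1 ^+ 2)%:E)); last 2 first.
- exact: (measurableT_comp m2 (@measurable_fst _ _ T R)).
- by move=> z; rewrite lee_fin sqr_ge0.
rewrite (@integral_marginal _ _ _ P (fun x => (phi j x ^+ 2)%:E))//; last first.
  by move=> x; rewrite lee_fin sqr_ge0.
have := onb_orthonormal hphi j j; rewrite eqxx => e1.
have -> : (\int[marginal P]_x (phi j x ^+ 2)%:E = 1)%E.
  by rewrite -e1; apply: eq_integral => x _; rewrite expr2.
by rewrite mule1.
Qed.

Let if2 j a : mu.-integrable setT (EFin \o (fun t => f j a t ^+ 2)).
Proof.
apply/integrableP; split.
  by apply/measurable_EFinP; exact: measurable_funX.
under eq_integral do rewrite /= ger0_norm ?sqr_ge0//.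
exact: le_lt_trans (f2le j a) (ltry _).
Qed.

Let ieps_phi j : P.-integrable setT (EFin \o (fun z => eps z * phi j z.1)).
Proof.
have me := measurable_noise mfstar.
have mp : measurable_fun setT (fun z : T * R => phi j z.1).
  exact: (measurableT_comp (mphi j) (@measurable_fst _ _ T R)).
apply: integrable_prod_sqr => //; first exact: integrable_noise_sqr hvar.
apply: (@integrable_marginal _ _ _ P (fun x => phi j x ^+ 2)).
exact: Lfun2_integrable_sqr (onb_L2 hphi j).
Qed.

(** The summands are uncorrelated, because the residual at one index is centered
given all inputs and the other residuals. *)
Lemma integral_noise_coef_sqr j :
  (\int[mu]_t (noise_coef phi S (design t) (noise_at t) j ^+ 2)%:E <=
   (n^-1 * sigma ^+ 2)%:E)%E.
Proof.
have E t : noise_coef phi S (design t) (noise_at t) j ^+ 2 =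
    n^-1 ^+ 2 * (\sum_(a <- enum S) f j a t) ^+ 2.
  by rewrite /noise_coef exprMn big_enum.
under eq_integral do rewrite E EFinM.
rewrite ge0_integralZl_EFin ?sqr_ge0//; last 2 first.
- by move=> t _; rewrite lee_fin sqr_ge0.
- by apply/measurable_EFinP; apply: measurable_funX; apply: measurable_sum => a.
rewrite (integral_sqr_orthogonal (enum_uniq _) (mf j) (if2 j)); last first.
  move=> a b _ _ ab.
  pose g t := phi j (design t a) * f j b t.
  have mg : measurable_fun setT g by apply: measurable_funM => //; exact: measurable_design.
  have gE z t : g (upd a z t) = phi j z.1 * f j b t.
    by rewrite /g /f /noise_at /design !tnth_upd eqxx eq_sym (negbTE ab).
  transitivity (\int[mu]_t (eps (tnth t a) * g t)%:E)%E.
    by apply: eq_integral => t _; rewrite /g mulrA.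
  apply: (noise_centered_tuple mfstar hfstar hmu mg).
  - by move=> z z' t zz'; rewrite !gE zz'.
  - move=> t; have := @integrableZl _ _ _ P _ measurableT (f j b t) _ (ieps_phi j).
    by apply: eq_integrable => // z _; rewrite /= -EFinM gE; congr EFin; ring.
  - have := integrable_prod_sqr (mf j a) (mf j b) (if2 j a) (if2 j b).
    by apply: eq_integrable => // t _; rewrite /= /g mulrA.
apply: (@le_trans _ _ ((n^-1 ^+ 2)%:E * \sum_(a <- enum S) (sigma ^+ 2)%:E)%E).
  apply: lee_wpmul2l; first by rewrite lee_fin sqr_ge0.
  by apply: lee_sum => a _; exact: f2le.
rewrite sumEFin -EFinM lee_fin big_enum sumr_const -[_ *+ _]mulr_natr.
rewrite le_eqVlt; apply/orP; left; apply/eqP; field.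
by rewrite gt_eqF.
Qed.

Variables (l G : R).
Hypotheses (l0 : 0 < l) (hG : forall J, \sum_(0 <= j < J) shrink ev l j <= G).

(** An extended real, because the series is only known to converge almost surely. *)
Definition noise_energy (t : N.-tuple (T * R)) : \bar R :=
  (\sum_(j <oo) (shrink ev l j * noise_coef phi S (design t) (noise_at t) j ^+ 2)%:E)%E.

Let mcoef j : measurable_fun [set: N.-tuple (T * R)]
  (fun t => noise_coef phi S (design t) (noise_at t) j).
Proof.
apply: measurable_funM => //.
rewrite (_ : (fun t => _) = fun t => \sum_(a <- enum S) f j a t).
  by apply: measurable_sum => a; exact: mf.
by apply/funext => t; rewrite big_enum.
Qed.

Let mterm j : measurable_fun [set: N.-tuple (T * R)]
  (fun t => shrink ev l j * noise_coef phi S (design t) (noise_at t) j ^+ 2).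
Proof. by apply: measurable_funM => //; apply: measurable_funX. Qed.

Let term0 j t :
  0 <= shrink ev l j * noise_coef phi S (design t) (noise_at t) j ^+ 2.
Proof. by rewrite mulr_ge0 ?sqr_ge0// shrink_ge0. Qed.

Lemma noise_energy_ge0 t : (0 <= noise_energy t)%E.
Proof. by apply: nneseries_ge0 => j _ _; rewrite lee_fin. Qed.

Lemma noise_energy_ge t J :
  ((\sum_(0 <= j < J) shrink ev l j * noise_coef phi S (design t) (noise_at t) j ^+ 2)%:E
   <= noise_energy t)%E.
Proof.
rewrite -sumEFin; apply: nneseries_lim_ge => j _ _.
by rewrite lee_fin.
Qed.

Lemma measurable_noise_energy : measurable_fun setT noise_energy.
Proof.
apply: ge0_emeasurable_sum; first by move=> j t _ _; rewrite lee_fin.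
by move=> j _; apply/measurable_EFinP.
Qed.

Lemma integral_noise_energy :
  (\int[mu]_t noise_energy t <= (G * (n^-1 * sigma ^+ 2))%:E)%E.
Proof.
rewrite integral_nneseries//; last 2 first.
- by move=> j; apply/measurable_EFinP.
- by move=> j t _; rewrite lee_fin.
have c0 : 0 <= n^-1 * sigma ^+ 2 by rewrite mulr_ge0 ?sqr_ge0// invr_ge0 ltW.
apply: (@le_trans _ _ (\sum_(j <oo) (shrink ev l j * (n^-1 * sigma ^+ 2))%:E)%E).
  apply: lee_nneseries => j _.
    by move=> _; apply: integral_ge0 => t _; rewrite lee_fin.
  under eq_integral do rewrite EFinM.
  rewrite ge0_integralZl_EFin ?shrink_ge0//; last 2 first.
  - by move=> t _; rewrite lee_fin sqr_ge0.
  - by apply/measurable_EFinP; apply: measurable_funX.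
  by rewrite [leRHS]EFinM; apply: lee_wpmul2l; [rewrite lee_fin shrink_ge0|exact: integral_noise_coef_sqr].
apply: lime_le; first by apply: is_cvg_nneseries => j _ _; rewrite lee_fin mulr_ge0// shrink_ge0.
near=> J; rewrite sumEFin lee_fin -mulr_suml ler_wpM2r//.
Unshelve. all: by end_near. Qed.

End NoiseEnergy.

Section NoiseRidge.
Context (d : measure_display) (T : measurableType d) (R : realType)
  (P : probability (T * R)%type R) (fstar var : T -> R) (sigma : R)
  (phi : nat -> T -> R) (ev : nat -> R)
  (K : T -> T -> R) (H : set (T -> R)) (ip : (T -> R) -> (T -> R) -> R).
Hypotheses (hphi : is_orthonormal_basis (marginal P) phi) (hH : is_rkhs K H ip)
  (hpsd : psd_kernel K) (hL2 : forall f, H f -> f \in Lfun (marginal P) 2%:E)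
  (hK : has_mercer_expansion K ev phi) (ev0 : forall j, 0 <= ev j)
  (evdec : forall j, ev j.+1 <= ev j).
Hypothesis mfstar : measurable_fun setT fstar.
Hypothesis hfstar : is_cond_exp (P := P) (@fst T R) snd fstar.
Hypothesis hvar :
  is_cond_exp (P := P) (@fst T R) (fun w => (w.2 - fstar w.1) ^+ 2) var.
Hypothesis hsigma : forall x, var x <= sigma ^+ 2.
Context (N : nat) (mu : probability (N.-tuple (T * R)%type) R).
Hypothesis hmu : is_product_law P mu.
Variable lam : R.
Hypothesis lam0 : 0 < lam.

Let mphi j : measurable_fun setT (phi j).
Proof. exact: Lfun_measurable (onb_L2 hphi j). Qed.

(** The kernel is a pointwise limit of Mercer sums. *)
Lemma measurable_kernel : measurable_fun setT (fun p : T * T => K p.1 p.2).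
Proof.
have mfst := @measurable_fst _ _ T T; have msnd := @measurable_snd _ _ T T.
apply: (measurable_fun_cvg
  (h := fun J (p : T * T) => series (fun j => ev j * phi j p.1 * phi j p.2) J)).
  move=> J; apply: measurable_sum => j; apply: measurable_funM.
    by apply: measurable_funM => //; exact: (measurableT_comp (mphi j) mfst).
  exact: (measurableT_comp (mphi j) msnd).
by move=> p _; exact: hK.
Qed.

Definition noise_ridge (S : {set 'I_N}) (t : N.-tuple (T * R)) : T -> R :=
  ridge K S lam (design t) (noise_at fstar t).

Section Part.
Variable S : {set 'I_N}.
Hypothesis S0 : (0 < #|S|)%N.
Local Notation n := (#|S|%:R : R).

Let n0 : 0 < n. Proof. by rewrite ltr0n. Qed.
Let nlam0 : 0 < n * lam. Proof. by rewrite mulr_gt0. Qed.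

Let mdesign a : measurable_fun [set: N.-tuple (T * R)] (fun t => design t a).
Proof. exact: (measurableT_comp (@measurable_fst _ _ T R) (measurable_tnth a)). Qed.

Lemma measurable_ridge_coef (y : N.-tuple (T * R) -> 'I_N -> R) b :
  (forall a, measurable_fun setT (fun t => y t a)) ->
  measurable_fun setT (fun t => ridge_coef K S lam (design t) (y t) b).
Proof.
move=> my; apply: measurable_sum => a; apply: measurable_funM.
  apply: measurable_invmx; last by move=> t; exact: ridge_mx_unit.
  move=> i j; rewrite (_ : (fun t => _) = fun t => (i \in S)%:R * (j \in S)%:R *
      K (design t i) (design t j) + #|S|%:R * lam * (i == j)%:R).
    apply: measurable_funD => //; apply: measurable_funM => //.
    have := measurableT_comp measurable_kernel (measurable_fun_pair (mdesign i) (mdesign j)).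
    exact.
  by apply/funext => t; rewrite mxE.
by apply: measurable_funM.
Qed.

Lemma measurable_ridge (y : N.-tuple (T * R) -> 'I_N -> R) :
  (forall a, measurable_fun setT (fun t => y t a)) ->
  measurable_fun setT (fun p : N.-tuple (T * R) * T => ridge K S lam (design p.1) (y p.1) p.2).
Proof.
move=> my; rewrite (_ : (fun p => _) = fun p : N.-tuple (T * R) * T => \sum_(b <- enum S)
    ridge_coef K S lam (design p.1) (y p.1) b * K (design p.1 b) p.2); last first.
  by apply/funext => p; rewrite ridgeE big_enum.
have mfst := @measurable_fst _ _ (N.-tuple (T * R)%type) T.
have msnd := @measurable_snd _ _ (N.-tuple (T * R)%type) T.
apply: measurable_sum => b; apply: measurable_funM.
  exact: (measurableT_comp (measurable_ridge_coef b my) mfst).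
have := measurableT_comp measurable_kernel
  (measurable_fun_pair (measurableT_comp (mdesign b) mfst) msnd).
exact.
Qed.

Lemma measurable_noise_ridge :
  measurable_fun setT (fun p : N.-tuple (T * R) * T => noise_ridge S p.1 p.2).
Proof. by apply: measurable_ridge => a; exact: measurable_noise_at. Qed.

Let delta (a c : 'I_N) : R := (c == a)%:R.

Lemma ridge_linear x y u :
  ridge K S lam x y u = \sum_(a in S) y a * ridge K S lam x (delta a) u.
Proof.
under [RHS]eq_bigr do rewrite ridgeE mulr_sumr.
rewrite exchange_big/= ridgeE; apply: eq_bigr => b _.
under [RHS]eq_bigr do rewrite mulrA.
rewrite -mulr_suml; congr (_ * _); rewrite [RHS]big_mkcond/=.
apply: eq_bigr => a _; rewrite /ridge_coef (bigD1 a)//= big1 => [|c ca].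
  by rewrite /delta eqxx; case: (a \in S); rewrite ?(mulr1, mul1r, mul0r, mulr0, addr0)// mulrC.
by rewrite /delta (negbTE ca) !mulr0.
Qed.

(** Point evaluation costs K(u, u), and [ridge_norm_le] applies to a unit response. The
bound does not depend on the design, which gives integrability. *)
Lemma ridge_delta_le x a u : ridge K S lam x (delta a) u ^+ 2 <= (n * lam)^-1 * K u u.
Proof.
apply: le_trans (rkhs_eval_le hH u (ridgeH hH _ _ _ _)) _.
have K0 : 0 <= K u u.
  by rewrite -(rkhs_reproducing hH u (rkhs_kernel hH u)) (rkhs_ip_ge0 hH)//; exact: (rkhs_kernel hH).
rewrite ler_wpM2r// -(ler_pM2l nlam0) mulfV ?gt_eqF//.
apply: le_trans (ridge_norm_le hH hpsd lam0 S0 x (delta a)) _.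
rewrite big_mkcond (bigD1 a)//= big1 ?addr0 => [|c /negbTE ca].
  by rewrite /delta eqxx expr1n; case: ifP.
by rewrite /delta ca expr0n/=; case: ifP.
Qed.

Lemma noise_ridge_sqr_le t u :
  noise_ridge S t u ^+ 2 <= (n * lam)^-1 * K u u * \sum_(a in S) noise_at fstar t a ^+ 2.
Proof.
apply: le_trans (rkhs_eval_le hH u (ridgeH hH _ _ _ _)) _.
have K0 : 0 <= K u u.
  by rewrite -(rkhs_reproducing hH u (rkhs_kernel hH u)) (rkhs_ip_ge0 hH)//; exact: (rkhs_kernel hH).
rewrite mulrAC ler_wpM2r// ler_pdivlMl//.
exact: (ridge_norm_le hH hpsd lam0 S0).
Qed.

Let isum (c : R) : mu.-integrable setT
  (EFin \o (fun t => c * \sum_(a in S) noise_at fstar t a ^+ 2)).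
Proof.
have := @integrable_sum _ _ _ mu setT measurableT _ (enum S) xpredT
  (fun a t => (noise_at fstar t a ^+ 2)%:E) (fun a _ => integrable_noise_at mfstar hvar hsigma hmu a).
move=> /(@integrableZl _ _ _ mu _ measurableT c).
by apply: eq_integrable => // t _; rewrite /= sumEFin -EFinM big_enum.
Qed.

Lemma measurable_noise_ridge_at u :
  measurable_fun [set: N.-tuple (T * R)] (fun t => noise_ridge S t u).
Proof. exact: (measurable_fun_pair1 u measurable_noise_ridge). Qed.

Lemma integrable_noise_ridge u :
  mu.-integrable setT (EFin \o (fun t => noise_ridge S t u ^+ 2)).
Proof.
apply: (le_integrable measurableT _ _ (isum ((n * lam)^-1 * K u u))).
  by apply/measurable_EFinP; apply: measurable_funX; exact: measurable_noise_ridge_at.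
move=> t _ /=; rewrite lee_fin ger0_norm ?sqr_ge0//.
exact: le_trans (noise_ridge_sqr_le t u) (ler_norm _).
Qed.

End Part.

Lemma noise_ridge_input (S : {set 'I_N}) a u : a \notin S -> forall z t,
  noise_ridge S (upd a z t) u = noise_ridge S t u.
Proof.
move=> aS z t; rewrite /noise_ridge !ridgeE.
have xE b : b \in S -> tnth (upd a z t) b = tnth t b.
  by move=> bS; rewrite tnth_upd; case: eqP => // ba; move: aS; rewrite -ba bS.
have MxE : ridge_mx K S lam (design (upd a z t)) = ridge_mx K S lam (design t).
  apply/matrixP => i j; rewrite !mxE /design.
  case: (boolP (i \in S)) => iS; rewrite ?mul0r//.
  by case: (boolP (j \in S)) => jS; rewrite ?(mulr0, mul0r)// !xE.
apply: eq_bigr => b bS; rewrite /design xE//; congr (_ * _).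
rewrite /ridge_coef MxE; apply: eq_bigr => c _.
by rewrite /noise_at; case: (boolP (c \in S)) => cS; rewrite ?mul0r// xE.
Qed.

(** The noise term of [S] is linear in the residuals at its indices, with coefficients
depending on the inputs in [S]; the noise term of a part that avoids the index [a]
is unaffected by the residual at [a], so that each product is centered. *)
Lemma noise_ridge_cross (S S' : {set 'I_N}) u : (0 < #|S|)%N -> (0 < #|S'|)%N -> {in S, forall a, a \notin S'} ->
  (\int[mu]_t (noise_ridge S t u * noise_ridge S' t u)%:E = 0)%E.
Proof.
move=> S0 S'0 dis; have nlam0 : 0 < #|S|%:R * lam by rewrite mulr_gt0// ltr0n.
pose delta (a c : 'I_N) : R := (c == a)%:R.
pose beta (a : 'I_N) (t : N.-tuple (T * R)) := ridge K S lam (design t) (delta a) u.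
have mbeta a : measurable_fun [set: N.-tuple (T * R)] (beta a).
  exact: (measurable_fun_pair1 u (measurable_ridge S0 (y := fun=> delta a) _)).
pose g (a : 'I_N) (t : N.-tuple (T * R)) := beta a t * noise_ridge S' t u.
have mr' := measurable_noise_ridge_at S'0 u.
have mg a : measurable_fun setT (g a) by exact: measurable_funM.
have i2 := integrable_noise_ridge S'0 u.
pose c := ((#|S|%:R * lam)^-1 * K u u).
have beta2 a t : beta a t ^+ 2 <= c by exact: ridge_delta_le.
have c0 : 0 <= c.
  apply: mulr_ge0; first by rewrite invr_ge0 ltW.
  by rewrite -(rkhs_reproducing hH u (rkhs_kernel hH u)) (rkhs_ip_ge0 hH)//; exact: (rkhs_kernel hH).
have ib a : mu.-integrable setT (EFin \o (fun t => (noise_at fstar t a * beta a t) ^+ 2)).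
  have := @integrableZl _ _ _ mu _ measurableT c _ (integrable_noise_at mfstar hvar hsigma hmu a).
  apply: le_integrable => //.
    apply/measurable_EFinP; apply: measurable_funX; apply: measurable_funM => //.
    exact: measurable_noise_at.
  move=> t _ /=; rewrite lee_fin ger0_norm ?sqr_ge0// ger0_norm; last first.
    by rewrite mulr_ge0// sqr_ge0.
  by rewrite exprMn mulrC ler_wpM2r// sqr_ge0.
have mnb a : measurable_fun [set: N.-tuple (T * R)] (fun t => noise_at fstar t a * beta a t).
  by apply: measurable_funM => //; exact: measurable_noise_at.
have iprod a : mu.-integrable setT (EFin \o (fun t => noise_at fstar t a * g a t)).
  have := integrable_prod_sqr (mnb a) mr' (ib a) i2.
  by apply: eq_integrable => // t _; rewrite /= /g mulrA.
transitivity (\int[mu]_t (\sum_(a <- enum S) (noise_at fstar t a * g a t)%:E))%E.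
  apply: eq_integral => t _; rewrite sumEFin; congr EFin.
  rewrite {1}/noise_ridge ridge_linear mulr_suml big_enum/=.
  by apply: eq_bigr => a _; rewrite /g mulrA.
rewrite integral_sum//; rewrite big_seq big1// => a; rewrite mem_enum => aS.
have aS' := dis a aS.
have betaE z z' t : z.1 = z'.1 -> beta a (upd a z t) = beta a (upd a z' t).
  move=> zz'; rewrite /beta; congr (ridge K S lam _ _ u).
  by apply/funext => b; rewrite /design !tnth_upd; case: eqP.
apply: (noise_centered_tuple mfstar hfstar hmu (mg a)) => //.
  by move=> z z' t zz'; rewrite /g (betaE z z')// !noise_ridge_input.
move=> t; set r := noise_ridge S' t u.
have ie := integrable_noise mfstar hfstar.
have := @integrableZl _ _ _ P _ measurableT (Num.sqrt c * `|r|) _ ie.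
apply: le_integrable => //.
  apply/measurable_EFinP; apply: measurable_funM; first exact: measurable_noise.
  apply: (measurableT_comp (mg a)).
  exact: (measurable_fun_pair2 t (measurable_upd (E := (T * R)%type) a)).
move=> z _ /=; rewrite lee_fin /g noise_ridge_input// -/r.
rewrite !normrM normr_id (ger0_norm (sqrtr_ge0 _)) [leRHS]mulrC ler_wpM2l// ler_wpM2r//.
  by rewrite -sqrtr_sqr ler_wsqrtr.
exact: iprod.
Qed.

Section Average.
Context (m : nat) (S : 'I_m -> {set 'I_N}).
Hypothesis S0 : forall i, (0 < #|S i|)%N.
Hypothesis Sdis : forall i j, i != j -> {in S i, forall a, a \notin S j}.
Local Open Scope ereal_scope.

Let sq i (p : N.-tuple (T * R) * T) : \bar R := (noise_ridge (S i) p.1 p.2 ^+ 2)%:E.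

Let msq i : measurable_fun setT (sq i).
Proof.
by apply/measurable_EFinP; apply: measurable_funX; exact: measurable_noise_ridge.
Qed.

Let sq0 i p : 0 <= sq i p. Proof. by rewrite lee_fin sqr_ge0. Qed.

Definition avg_noise_ridge (t : N.-tuple (T * R)) (u : T) : R :=
  (m%:R^-1 * \sum_(i < m) noise_ridge (S i) t u)%R.

Lemma measurable_avg_noise_ridge :
  measurable_fun setT (fun p : N.-tuple (T * R) * T => avg_noise_ridge p.1 p.2).
Proof.
apply: measurable_funM => //; apply: measurable_sum => i.
exact: measurable_noise_ridge.
Qed.

(** Tonelli's theorem brings the expectation inside the integral over the test point,
where the noise terms of different parts are orthogonal. *)
Lemma integral_avg_noise_ridge :
  \int[mu]_t \int[marginal P]_u (avg_noise_ridge t u ^+ 2)%:E =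
  (m%:R^-1 ^+ 2)%:E *
  \sum_(i < m) \int[mu]_t \int[marginal P]_u (noise_ridge (S i) t u ^+ 2)%:E.
Proof.
have mavg : measurable_fun setT (fun p : N.-tuple (T * R) * T => (avg_noise_ridge p.1 p.2 ^+ 2)%:E).
  by apply/measurable_EFinP; apply: measurable_funX; exact: measurable_avg_noise_ridge.
have := @fubini_tonelli _ _ _ _ _ mu (marginal P) _ mavg
  (fun p => ltac:(by rewrite lee_fin sqr_ge0)).
move=> /= ->.
have inner u : \int[mu]_t (avg_noise_ridge t u ^+ 2)%:E =
    (m%:R^-1 ^+ 2)%:E * \sum_(i < m) fubini_G mu (sq i) u.
  have mr i : measurable_fun [set: N.-tuple (T * R)] (fun t => noise_ridge (S i) t u).
    exact: measurable_noise_ridge_at.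
  have ir i := integrable_noise_ridge (S0 i) u.
  have := integral_sqr_orthogonal (index_enum_uniq _) mr ir _.
  move=> <-; last by move=> i j _ _ ij; apply: noise_ridge_cross => //; exact: Sdis.
  under eq_integral do rewrite /avg_noise_ridge exprMn EFinM.
  rewrite ge0_integralZl_EFin ?sqr_ge0//.
  - by move=> t _; rewrite lee_fin sqr_ge0.
  - by apply/measurable_EFinP; apply: measurable_funX; apply: measurable_sum.
under eq_integral do rewrite inner.
have mG i : measurable_fun setT (fubini_G mu (sq i)).
  exact: measurable_fun_fubini_tonelli_G.
have G0 i u : 0 <= fubini_G mu (sq i) u by exact: integral_ge0.
rewrite ge0_integralZl_EFin ?sqr_ge0//; last 2 first.
- by move=> u _; exact: sume_ge0.
- exact: emeasurable_sum.
rewrite ge0_integral_sum//; congr (_ * _); apply: eq_bigr => i _.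
by have := @fubini_tonelli _ _ _ _ _ mu (marginal P) _ (msq i) (sq0 i) => /= <-.
Qed.

Variables (tau G b : R) (n : nat).
Hypothesis Sn : forall i, #|S i| = n.
Hypothesis tau2 : (2 <= tau)%R.
Hypothesis hG : forall J, (\sum_(0 <= j < J) shrink ev (tau * lam) j <= G)%R.
Hypothesis hb : forall i, mu (bad_event phi ev (S i) (tau * lam)) <= b%:E.

(** On a good design the noise term is controlled by the noise energy. On a bad one it
is controlled by its RKHS norm, hence by the sum of the squared residuals over
n lambda; given the inputs each squared residual has mean at most sigma^2, so that
the probability of the bad event factors out. *)
Lemma integral_noise_ridge i :
  \int[mu]_t \int[marginal P]_u (noise_ridge (S i) t u ^+ 2)%:E <=
  (2 * tau ^+ 2 * (G * (n%:R^-1 * sigma ^+ 2)) + ev 0%N / lam * sigma ^+ 2 * b)%:E.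
Proof.
have tau0 : (0 < tau)%R by apply: lt_le_trans tau2.
have l0 : (0 < tau * lam)%R by rewrite mulr_gt0.
have n0 : (0 < n%:R :> R)%R by rewrite -(Sn i) ltr0n.
pose bad := bad_event phi ev (S i) (tau * lam).
have mbad : measurable bad by exact: measurable_bad.
pose c := (ev 0%N / (n%:R * lam))%R.
have c0 : (0 <= c)%R by rewrite divr_ge0// mulr_ge0 ?ltW.
pose E2 a (t : N.-tuple (T * R)) := (noise_at fstar t a ^+ 2 * \1_bad t)%R.
have mE2 a : measurable_fun [set: N.-tuple (T * R)] (E2 a).
  apply: measurable_funM; last exact: measurable_indic.
  by apply: measurable_funX; exact: measurable_noise_at.
have E20 a t : (0 <= E2 a t)%R by rewrite mulr_ge0 ?sqr_ge0.
have mNE : measurable_fun setT (noise_energy fstar phi ev (S i) (tau * lam)).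
  exact: (measurable_noise_energy mfstar hphi ev0 _ l0).
have NE0 t : 0 <= noise_energy fstar phi ev (S i) (tau * lam) t.
  exact: noise_energy_ge0.
have pt t : \int[marginal P]_u (noise_ridge (S i) t u ^+ 2)%:E <=
    (2 * tau ^+ 2)%:E * noise_energy fstar phi ev (S i) (tau * lam) t +
    c%:E * \sum_(a <- enum (S i)) (E2 a t)%:E.
  have t20 : (0 <= 2 * tau ^+ 2)%R by rewrite mulr_ge0 ?sqr_ge0.
  have [good|bt] := pselect (good_design phi ev (S i) (tau * lam) (design t)).
    apply: (@le_trans _ _ ((2 * tau ^+ 2)%:E * noise_energy fstar phi ev (S i) (tau * lam) t)); last first.
      rewrite leeDl// mule_ge0 ?lee_fin//; apply: sume_ge0 => a _.
      by rewrite lee_fin.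
    have := NE0 t; have ge J := noise_energy_ge fstar phi ev0 (S i) l0 t J.
    move: ge; case: (noise_energy _ _ _ _ _ t) => [X| |] ge; last by [].
      move=> _; rewrite -EFinM.
      apply: (good_ridge_noise hphi hH hpsd hL2 hK ev0 (S0 i) lam0 tau2 good) => J.
      by have := ge J; rewrite lee_fin.
    by move=> _; rewrite gt0_muley ?leey// lte_fin mulr_gt0// exprn_gt0.
  apply: (@le_trans _ _ (c%:E * \sum_(a <- enum (S i)) (E2 a t)%:E)); last first.
    by rewrite leeDr// mule_ge0 ?lee_fin.
  apply: le_trans (rkhs_L2_le_norm hphi hH hL2 hK ev0 evdec (ridgeH hH _ _ _ _)) _.
  have -> : (\sum_(a <- enum (S i)) (E2 a t)%:E = (\sum_(a in S i) noise_at fstar t a ^+ 2)%:E).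
    rewrite sumEFin big_enum/=; congr EFin; apply: eq_bigr => a _.
    by rewrite /E2 indicE mem_set// mulr1.
  rewrite -EFinM lee_fin /c -[leRHS]mulrA ler_wpM2l// mulrC ler_pdivlMr; last first.
    by rewrite mulr_gt0.
  rewrite mulrC -(Sn i).
  exact: (ridge_norm_le hH hpsd lam0 (S0 i)).
apply: (@le_trans _ _ (\int[mu]_t ((2 * tau ^+ 2)%:E * noise_energy fstar phi ev (S i) (tau * lam) t +
    c%:E * \sum_(a <- enum (S i)) (E2 a t)%:E))).
  apply: ge0_le_integral_any => // t; apply: integral_ge0 => u _.
  by rewrite lee_fin sqr_ge0.
have ms : measurable_fun [set: N.-tuple (T * R)] (fun t => \sum_(a <- enum (S i)) (E2 a t)%:E).
  by apply: emeasurable_sum => a; exact/measurable_EFinP.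
have s0 t : 0 <= \sum_(a <- enum (S i)) (E2 a t)%:E.
  by apply: sume_ge0 => a _; rewrite lee_fin.
have t20 : (0 <= 2 * tau ^+ 2)%R by rewrite mulr_ge0 ?sqr_ge0.
rewrite ge0_integralD//; first last.
- exact: measurable_funeM.
- by move=> t _; rewrite mule_ge0 ?lee_fin.
- exact: measurable_funeM.
- by move=> t _; rewrite mule_ge0 ?lee_fin.
rewrite ge0_integralZl_EFin// ge0_integralZl_EFin// ge0_integral_sum//; last 2 first.
- by move=> a; exact/measurable_EFinP.
- by move=> a t _; rewrite lee_fin.
rewrite EFinD; apply: leeD.
  rewrite [leRHS]EFinM; apply: lee_wpmul2l => //.
  rewrite -(Sn i); exact: (integral_noise_energy mfstar hfstar hvar hsigma hphi ev0 hmu (S0 i) l0 hG).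
apply: (@le_trans _ _ (c%:E * \sum_(a <- enum (S i)) (sigma ^+ 2 * b)%:E)).
  apply: lee_wpmul2l => //; apply: lee_sum => a _.
  have mI : measurable_fun [set: N.-tuple (T * R)] (\1_bad : _ -> R) by exact: measurable_indic.
  have bin : thru_input a (\1_bad : N.-tuple (T * R) -> R).
    move=> z z' t zz'; rewrite !indicE; congr (_ %:R); congr nat_of_bool.
    have E : design (upd a z t) = design (upd a z' t).
      by apply/funext => a'; rewrite /design !tnth_upd; case: eqP.
    by apply/idP/idP; rewrite !inE /bad /bad_event /= E.
  apply: le_trans (noise_variance_tuple mfstar hvar hsigma hmu mI bin _) _.
    by move=> t; rewrite indicE.
  rewrite [leRHS]EFinM; apply: lee_wpmul2l; first by rewrite lee_fin sqr_ge0.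
  by rewrite integral_indic// setIT; exact: hb.
rewrite sumEFin -EFinM lee_fin big_enum sumr_const (Sn i) -[(_ *+ _)%R]mulr_natr.
rewrite le_eqVlt; apply/orP; left; apply/eqP; rewrite /c; field.
by rewrite !gt_eqF.
Qed.

End Average.

End NoiseRidge.

(** * Mean squared error for a fixed partition *)

Section Partition.
Context (d : measure_display) (T : measurableType d) (R : realType)
  (P : probability (T * R)%type R) (fstar var : T -> R) (sigma : R)
  (phi : nat -> T -> R) (ev : nat -> R)
  (K : T -> T -> R) (H : set (T -> R)) (ip : (T -> R) -> (T -> R) -> R).
Hypotheses (hphi : is_orthonormal_basis (marginal P) phi) (hH : is_rkhs K H ip)
  (hpsd : psd_kernel K) (hL2 : forall f, H f -> f \in Lfun (marginal P) 2%:E)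
  (hK : has_mercer_expansion K ev phi) (ev0 : forall j, 0 <= ev j)
  (evdec : forall j, ev j.+1 <= ev j).
Hypothesis Hfstar : H fstar.
Hypothesis hfstar : is_cond_exp (P := P) (@fst T R) snd fstar.
Hypothesis hvar :
  is_cond_exp (P := P) (@fst T R) (fun w => (w.2 - fstar w.1) ^+ 2) var.
Hypothesis hsigma : forall x, var x <= sigma ^+ 2.
Variables (N : nat) (lam tau : R).
Hypotheses (lam0 : 0 < lam) (tau2 : 2 <= tau).

Let mphi j : measurable_fun setT (phi j).
Proof. exact: Lfun_measurable (onb_L2 hphi j). Qed.

Let mH f : H f -> measurable_fun setT f.
Proof. by move=> /hL2; exact: Lfun_measurable. Qed.

Let taulam0 : 0 < tau * lam.
Proof. by rewrite mulr_gt0//; apply: lt_le_trans tau2. Qed.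

Let B0 : 0 <= ip fstar fstar. Proof. exact: (rkhs_ip_ge0 hH Hfstar). Qed.

Definition ridge_bias (S : {set 'I_N}) (t : N.-tuple (T * R)) (u : T) : R :=
  ridge K S lam (design t) (fun a => fstar (design t a)) u - fstar u.

Let Hbias S t : H (ridge_bias S t).
Proof. by apply: (rkhsB hH) Hfstar; exact: (ridgeH hH). Qed.

(** [ridge_bias_le] bounds both the empirical and the RKHS norm of the bias; for a good
design they control its L2 norm, and for a bad one the RKHS norm alone does. *)
Lemma integral_ridge_bias (S : {set 'I_N}) t : (0 < #|S|)%N ->
  (\int[marginal P]_u (ridge_bias S t u ^+ 2)%:E <=
   ((1 + tau) * lam * ip fstar fstar +
    ev 0%N * ip fstar fstar * \1_(bad_event phi ev S (tau * lam)) t)%:E)%E.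
Proof.
move=> S0; have n0 : 0 < #|S|%:R :> R by rewrite ltr0n.
have tau0 : 0 < tau by apply: lt_le_trans tau2.
have := ridge_bias_le hH hpsd lam0 S0 (x := design t) Hfstar (erefl (ridge_bias S t)).
set V := \sum_(a in S) _; set e2 := ip (ridge_bias S t) _ => bnd.
have V0 : 0 <= V by apply: sumr_ge0 => a _; rewrite sqr_ge0.
have e0 : 0 <= e2 by exact: (rkhs_ip_ge0 hH (Hbias S t)).
have nl : 0 < #|S|%:R * lam by rewrite mulr_gt0.
have eB : e2 <= ip fstar fstar.
  by rewrite -(ler_pM2l nl); apply: le_trans bnd; rewrite lerDr mulr_ge0.
have VB : 2 / #|S|%:R * V <= lam * ip fstar fstar.
  rewrite mulrAC ler_pdivrMr// [leRHS]mulrC mulrA; apply: le_trans bnd.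
  by rewrite lerDl mulr_ge0// ltW.
have [good|bt] := pselect (good_design phi ev S (tau * lam) (design t)).
  apply: le_trans (good_L2_le hphi hH hL2 hK ev0 S0 taulam0 good (Hbias S t)) _.
  rewrite lee_fin -/V -/e2; apply: (@le_trans _ _ ((1 + tau) * lam * ip fstar fstar)).
    rewrite [leRHS](_ : _ = lam * ip fstar fstar + tau * lam * ip fstar fstar); last by ring.
    apply: lerD => //.
    by rewrite ler_wpM2l// ltW.
  by rewrite lerDl !mulr_ge0.
apply: le_trans (rkhs_L2_le_norm hphi hH hL2 hK ev0 evdec (Hbias S t)) _.
rewrite lee_fin indicE mem_set// mulr1; apply: (@le_trans _ _ (ev 0%N * ip fstar fstar)).
  by rewrite ler_wpM2l.
by rewrite lerDr mulr_ge0// mulr_ge0 ?addr_ge0 ?ltW.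
Qed.

Section Split.
Context (d' : measure_display) (Om : measurableType d') (Q : probability Om R)
  (Z : 'I_N -> {RV Q >-> (T * R)%type}).
Hypothesis hZ : is_iid_sample P Z.
Context (m n : nat) (s : {ffun 'I_N -> 'I_m}).
Hypotheses (m0 : (0 < m)%N) (n0 : (0 < n)%N)
  (hs : forall i, #|[set j | s j == i]%SET| = n).
Variables (G b : R).
Hypothesis hG : forall J, \sum_(0 <= j < J) shrink ev (tau * lam) j <= G.
Hypothesis hb : forall i, (sample_law Z
  (bad_event phi ev [set j | s j == i]%SET (tau * lam)) <= b%:E)%E.

Let S i := [set j | s j == i]%SET.
Let S0 i : (0 < #|S i|)%N. Proof. by rewrite hs. Qed.

Lemma dc_krrE w u :
  dc_krr H ip s (fun i => Z i w) lam u - fstar u =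
  m%:R^-1 * \sum_(i < m) ridge_bias (S i) (sample_tuple Z w) u +
  avg_noise_ridge fstar K lam S (sample_tuple Z w) u.
Proof.
have m0' : m%:R != 0 :> R by rewrite pnatr_eq0 -lt0n.
rewrite /dc_krr /avg_noise_ridge -mulrDr -big_split/=.
rewrite -[fstar u in LHS](mulKf m0') -mulrBr; congr (_ * _).
have -> : m%:R * fstar u = \sum_(i < m) fstar u by rewrite sumr_const card_ord mulr_natl.
rewrite -sumrB.
apply: eq_bigr => i _; rewrite (krrE hH hpsd lam0 (S0 i)).
rewrite /ridge_bias addrAC; congr (_ - _).
rewrite /noise_ridge -ridgeD; congr (ridge K (S i) lam _ _ u); apply/funext => a.
  by rewrite /design tnth_mktuple.
by rewrite /design /noise_at /noise !tnth_mktuple addrC subrK.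
Qed.

Lemma sqr_avg_le (x : 'I_m -> R) (y : R) :
  (m%:R^-1 * \sum_(i < m) x i + y) ^+ 2 <=
  2 * m%:R^-1 * (\sum_(i < m) x i ^+ 2) + 2 * y ^+ 2.
Proof.
have m0' : 0 < m%:R :> R by rewrite ltr0n.
set a := _ * \sum_(i < m) x i.
have ha : a ^+ 2 <= m%:R^-1 * \sum_(i < m) x i ^+ 2.
  have : 0 <= m%:R^-1 * \sum_(i < m) (x i - a) ^+ 2.
    by apply: mulr_ge0; [rewrite invr_ge0|apply: sumr_ge0 => i _; exact: sqr_ge0].
  under eq_bigr do rewrite sqrrB -mulr_natr -mulrA.
  rewrite big_split/= sumrB -mulr_suml sumr_const card_ord -[a ^+ 2 *+ _]mulr_natl.
  rewrite mulrDr mulrBr mulKf ?gt_eqF// [m%:R^-1 * (_ * _)]mulrA -/a.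
  move: (_ * \sum_(i < m) x i ^+ 2) => W h.
  by rewrite -subr_ge0 (_ : W - _ = W - a * (a * 2) + a ^+ 2)//; ring.
have := sqr_ge0 (a - y); nra.
Qed.

(** (x + y)^2 <= 2 x^2 + 2 y^2 separates biases and noise. The average of the biases is
bounded by convexity of the square, so that only the noise profits from averaging. *)
Lemma integral_dc_krr :
  (\int[Q]_w (L2norm (marginal P) (fun u =>
     dc_krr H ip s (fun i => Z i w) lam u - fstar u)%R ^+ 2) <=
   (2 * ((1 + tau) * lam * ip fstar fstar + ev 0%N * ip fstar fstar * b) +
    2 * (m%:R^-1 * (2 * tau ^+ 2 * (G * (n%:R^-1 * sigma ^+ 2)) +
       ev 0%N / lam * sigma ^+ 2 * b)))%:E)%E.
Proof.
have hmu := sample_law_product hZ.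
have mfstar := mH Hfstar.
set mu := sample_law Z in hmu |- *.
set B := ip fstar fstar.
have tau0 : 0 < tau by apply: lt_le_trans tau2.
have mi0 : (0 <= m%:R^-1 :> R) by rewrite invr_ge0.
pose X := fun t : N.-tuple (T * R) =>
  (\int[marginal P]_u (avg_noise_ridge fstar K lam S t u ^+ 2)%:E)%E.
pose A := fun t : N.-tuple (T * R) => \sum_(i < m) ((1 + tau) * lam * B +
  ev 0%N * B * \1_(bad_event phi ev (S i) (tau * lam)) t).
have A0 t : 0 <= A t.
  apply: sumr_ge0 => i _; apply: addr_ge0; first by rewrite mulr_ge0// mulr_ge0 ?addr_ge0 ?ltW.
  by rewrite !mulr_ge0.
have X0 t : (0 <= X t)%E by apply: integral_ge0 => u _; rewrite lee_fin sqr_ge0.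
have mbad i : measurable (bad_event phi ev (S i) (tau * lam)) by exact: measurable_bad.
have mA1 i : measurable_fun [set: N.-tuple (T * R)]
    (fun t => (1 + tau) * lam * B + ev 0%N * B * \1_(bad_event phi ev (S i) (tau * lam)) t : R).
  by apply: measurable_funD => //; apply: measurable_funM => //; exact: measurable_indic.
have mA : measurable_fun setT A by exact: measurable_sum.
have mav := measurable_avg_noise_ridge hphi hpsd hK mfstar lam0 S0.
have mX : measurable_fun setT X.
  pose f := fun p : N.-tuple (T * R) * T => (avg_noise_ridge fstar K lam S p.1 p.2 ^+ 2)%:E.
  have mf : measurable_fun setT f by apply/measurable_EFinP; apply: measurable_funX.
  have f0 p : (0 <= f p)%E by rewrite lee_fin sqr_ge0.
  exact: (@measurable_fun_fubini_tonelli_F _ _ _ _ _ (marginal P) f mf f0).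
have c0 : 0 <= 2 * m%:R^-1 :> R by rewrite mulr_ge0.
apply: (@le_trans _ _ (\int[mu]_t ((2 * m%:R^-1 * A t)%:E + 2%:E * X t))%E).
  apply: integral_sample_le.
  - apply: emeasurable_funD; first by apply/measurable_EFinP; exact: measurable_funM.
    exact: measurable_funeM.
  - by move=> w; rewrite sqr_L2norm; apply: integral_ge0 => u _; rewrite lee_fin sqr_ge0.
  - move=> w; rewrite sqr_L2norm; set t := sample_tuple Z w.
    have mb i : measurable_fun setT (ridge_bias (S i) t) by exact: (mH (Hbias _ _)).
    have mavt : measurable_fun setT (avg_noise_ridge fstar K lam S t).
      exact: (measurable_fun_pair2 t mav).
    apply: (@le_trans _ _ (\int[marginal P]_u ((2 * m%:R^-1)%:E *
        (\sum_(i < m) (ridge_bias (S i) t u ^+ 2)%:E) +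
        2%:E * (avg_noise_ridge fstar K lam S t u ^+ 2)%:E))%E).
      apply: ge0_le_integral_any => u; first by rewrite lee_fin sqr_ge0.
      by rewrite dc_krrE sumEFin lee_fin; exact: sqr_avg_le.
    have m1 : measurable_fun setT (fun u => (\sum_(i < m) (ridge_bias (S i) t u ^+ 2)%:E)%E).
      by apply: emeasurable_sum => i; apply/measurable_EFinP; exact: measurable_funX.
    have m2 : measurable_fun setT (fun u => (avg_noise_ridge fstar K lam S t u ^+ 2)%:E).
      by apply/measurable_EFinP; exact: measurable_funX.
    rewrite ge0_integralD//; first last.
    + exact: measurable_funeM.
    + by move=> u _; rewrite mule_ge0// lee_fin ?sqr_ge0.
    + exact: measurable_funeM.
    + by move=> u _; rewrite mule_ge0 ?lee_fin//; apply: sume_ge0 => i _; rewrite lee_fin sqr_ge0.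
    rewrite ge0_integralZl_EFin//; last by move=> u _; apply: sume_ge0 => i _; rewrite lee_fin sqr_ge0.
    rewrite ge0_integralZl_EFin//; last by move=> u _; rewrite lee_fin sqr_ge0.
    apply: leeD => //; rewrite [leRHS]EFinM; apply: lee_wpmul2l => //.
    rewrite ge0_integral_sum//; last 2 first.
    + by move=> i; apply/measurable_EFinP; exact: measurable_funX.
    + by move=> i u _; rewrite lee_fin sqr_ge0.
    rewrite /A -sumEFin; apply: lee_sum => i _.
    exact: integral_ridge_bias.
  - by move=> t; rewrite adde_ge0// ?mule_ge0// lee_fin mulr_ge0.
rewrite ge0_integralD//; first last.
- exact: measurable_funeM.
- by move=> t _; rewrite mule_ge0.
- by apply/measurable_EFinP; exact: measurable_funM.
- by move=> t _; rewrite lee_fin mulr_ge0.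
rewrite [leRHS]EFinD; apply: leeD.
  under eq_integral do rewrite EFinM.
  rewrite ge0_integralZl_EFin//; last 2 first.
  - by move=> t _; rewrite lee_fin.
  - exact/measurable_EFinP.
  have p1 : 0 <= (1 + tau) * lam * B by rewrite mulr_ge0// mulr_ge0 ?addr_ge0 ?ltW.
  have iA : (\int[mu]_t (A t)%:E <= (m%:R * ((1 + tau) * lam * B + ev 0%N * B * b))%:E)%E.
    under eq_integral do rewrite /A -sumEFin.
    rewrite ge0_integral_sum//; last 2 first.
    - by move=> i; exact/measurable_EFinP.
    - by move=> i t _; rewrite lee_fin addr_ge0// !mulr_ge0.
    have -> (y : R) : m%:R * y = \sum_(i < m) y by rewrite sumr_const card_ord mulr_natl.
    rewrite -sumEFin; apply: lee_sum => i _.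
    under eq_integral do rewrite EFinD.
    rewrite ge0_integralD//; first last.
    - by apply/measurable_EFinP; apply: measurable_funM => //; exact: measurable_indic.
    - by move=> t _; rewrite lee_fin !mulr_ge0.
    rewrite integral_probability_cst EFinD; apply: leeD => //.
    under eq_integral do rewrite EFinM.
    rewrite ge0_integralZl_EFin//; last 2 first.
    - by apply/measurable_EFinP; exact: measurable_indic.
    - by rewrite mulr_ge0.
    rewrite [leRHS]EFinM; apply: lee_wpmul2l; first by rewrite lee_fin mulr_ge0.
    by rewrite integral_indic// setIT; exact: hb.
  apply: (@le_trans _ _ ((2 * m%:R^-1)%:E *
      (m%:R * ((1 + tau) * lam * B + ev 0%N * B * b))%:E)%E).
    by apply: lee_wpmul2l.
  rewrite -EFinM lee_fin -(mulrA 2) mulKf//.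
  by rewrite pnatr_eq0 -lt0n.
rewrite ge0_integralZl_EFin// [leRHS]EFinM; apply: lee_wpmul2l => //.
have dis i j : i != j -> {in S i, forall a, a \notin S j}.
  by move=> ij a; rewrite !inE => /eqP ->.
rewrite (integral_avg_noise_ridge hphi hH hpsd hK mfstar hfstar hvar hsigma hmu lam0 S0 dis).
set X1 := 2 * tau ^+ 2 * _ + _.
apply: (@le_trans _ _ ((m%:R^-1 ^+ 2)%:E * \sum_(i < m) X1%:E)%E).
  apply: lee_wpmul2l; first by rewrite lee_fin sqr_ge0.
  apply: lee_sum => i _.
  exact: (integral_noise_ridge hphi hH hpsd hL2 hK ev0 evdec mfstar hfstar hvar
    hsigma hmu lam0 S0 hs tau2 hG hb).
rewrite sumEFin sumr_const card_ord -EFinM lee_fin -[X1 *+ _]mulr_natl.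
by rewrite expr2 -mulrA mulKf// pnatr_eq0 -lt0n.
Qed.

End Split.
End Partition.

(** * Bad designs are rare in both regimes *)

Section Tails.
Context (R : realType).
Implicit Types (nu N m n k rho : R).

(** Once the factor ln N is bounded below by 1, the assumption on m and both
conclusions are linear inequalities between ln m, ln N and ln rho; the first
conclusion is then the assumption raised to the power (k - 2) / 2. *)
Lemma moment_tail_le nu k rho N m : 1 / 2 < nu -> 2 < k -> 0 < rho -> 0 < N ->
  1 <= ln N -> 0 < m ->
  m <= (N `^ ((2 * (k - 4) * nu - k) / (2 * nu + 1)) /
        (rho `^ (4 * k) * ln N `^ k)) `^ (1 / (k - 2)) ->
  let D := N `^ (1 / (2 * nu + 1)) in let lam := D `^ (- (2 * nu)) in
  let A := expR (ln 2 * k - 2 * k * ln rho) in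
  (4 * (D ^+ 2 / (N / m) ^+ 2)) `^ (k / 2) * (N / m) `^ (k / 2) <=
    A * (m * lam ^+ 2) /\
  m * lam <= expR (- (4 * k * ln rho) / (k - 2)).
Proof.
move=> hnu k2 rho0 N0 N1 m0.
have nu0 : 0 < 2 * nu + 1 by lra.
have k20 : 0 < k - 2 by rewrite subr_gt0.
pose d := ln N / (2 * nu + 1); pose y := ln m; pose r := ln rho.
have d0 : 0 <= d by rewrite divr_ge0 ?(le_trans _ N1)// ltW.
have NE : N = expR ((2 * nu + 1) * d).
  by rewrite /d mulrC divfK ?gt_eqF// lnK ?posrE.
clearbody d.
have mE : m = expR y by rewrite lnK ?posrE.
have rE : rho = expR r by rewrite lnK ?posrE.
have powE (a b : R) : expR a `^ b = expR (a * b) by rewrite expRM.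
move=> hm; have {}hm : y * (k - 2) <= (2 * (k - 4) * nu - k) * d - 4 * k * r.
  have l1 : 1 <= ln N `^ k.
    by rewrite -[leLHS](powRr0 (ln N)); apply: (ler_powR N1); exact: (le_trans _ (ltW k2)).
  rewrite -ler_expR.
  apply: (@le_trans _ _ (N `^ ((2 * (k - 4) * nu - k) / (2 * nu + 1)) /
        (rho `^ (4 * k) * ln N `^ k))).
    rewrite -powE -mE; move: hm; set X := _ / (_ * _) => hm.
    have X0 : 0 <= X by rewrite divr_ge0 ?mulr_ge0 ?powR_ge0.
    apply: le_trans (ge0_ler_powR (ltW k20) _ _ hm) _; rewrite ?nnegrE ?powR_ge0 ?(ltW m0)//.
    by rewrite -powRrM div1r mulVf ?gt_eqF// powRr1.
  rewrite expRD expRN ler_pM ?invr_ge0 ?powR_ge0 ?mulr_ge0 ?powR_ge0//.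
    by rewrite NE powE ler_expR le_eqVlt; apply/orP; left; apply/eqP; field; rewrite gt_eqF.
  rewrite lef_pV2 ?posrE ?expR_gt0 ?mulr_gt0 ?powR_gt0//; last exact: (lt_le_trans _ N1).
  rewrite rE powE [leLHS](_ : _ = expR (r * (4 * k)) * 1).
    by rewrite ler_wpM2l// expR_ge0.
  by rewrite mulr1 mulrC.
move=> D lam A.
have DE : D = expR d.
  by rewrite /D NE powE; congr expR; field; rewrite gt_eqF.
have lamE : lam = expR (- (2 * nu * d)).
  by rewrite /lam DE powE mulrN mulrC.
have n0 : 0 < N / m by rewrite divr_gt0.
split; last first.
  rewrite mE lamE -expRD ler_expR ler_pdivlMr//.
  rewrite -/r; have h : 0 <= (4 * nu + k) * d by rewrite mulr_ge0//; lra.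
  lra.
rewrite -powRM ?(ltW n0)//; last by rewrite mulr_ge0// divr_ge0 ?sqr_ge0.
rewrite (_ : 4 * _ * _ = expR (2 * ln 2 + 2 * d + y - (2 * nu + 1) * d)); last first.
  rewrite !expRD expRN -NE -mE ![2 * _]mulrC !expRM !powR_mulrn ?expR_ge0//.
  rewrite -DE lnK ?posrE//; field.
  by rewrite !gt_eqF.
rewrite powE /A mE lamE -/r -expRM_natl -!expRD ler_expR.
nra.
Qed.

(** [s'] is the parameter of the exponential moment for which s' B = sqrt(p / n). The
expression is then 2 q^s for the number q that is assumed to be at most exp(- 1),
and s = 3 ln N gives the power N^(-3). *)
Lemma exp_tail_le N n (G B p e s s' E : R) : 0 < n -> 0 < p -> p <= n -> 1 <= B -> 0 < N ->
  s = 3 * ln N -> p = 2 * s -> s' = Num.sqrt (p / n) / B -> E = expR (2 * (e - 1)) ->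
  4 * G ^+ 2 * B ^+ 2 * p * E / n <= expR (- 1) ->
  (4 * (G ^+ 2 / n ^+ 2)) `^ s *
  (2 * (p / s') `^ p * expR (n * (e * (s' * B) ^+ 2) - p)) <= 2 * (N ^+ 3)^-1.
Proof.
move=> n0 p0 pn B1 N0 sE pE s'E EE hq.
have B0 : 0 < B by apply: lt_le_trans B1.
have s0 : 0 <= s by lra.
have pn0 : 0 < p / n by rewrite divr_gt0.
have s'0 : 0 < s' by rewrite s'E divr_gt0 ?sqrtr_gt0.
have -> : s' * B = Num.sqrt (p / n) by rewrite s'E divfK ?gt_eqF.
rewrite sqr_sqrtr ?(ltW pn0)//.
have -> : (p / s') `^ p = (p * n * B ^+ 2) `^ s.
  rewrite pE powRrM powR_mulrn -pE ?divr_ge0 ?(ltW p0) ?(ltW s'0)//; congr (_ `^ _).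
  rewrite s'E !expr_div_n sqr_sqrtr ?(ltW pn0)//; field.
  by rewrite !gt_eqF.
have -> : expR (n * (e * (p / n)) - p) = E `^ s.
  by rewrite EE -expRM pE; congr expR; field; rewrite gt_eqF.
have E0 : 0 <= E by rewrite EE expR_ge0.
have -> : (4 * (G ^+ 2 / n ^+ 2)) `^ s * (2 * (p * n * B ^+ 2) `^ s * E `^ s) =
    2 * (4 * G ^+ 2 * B ^+ 2 * p * E / n) `^ s.
  rewrite mulrCA -(mulrA 2); congr (_ * _).
  have a0 : 0 <= 4 * (G ^+ 2 / n ^+ 2) by rewrite mulr_ge0// divr_ge0 ?sqr_ge0.
  have b0 : 0 <= p * n * B ^+ 2 by rewrite mulr_ge0 ?sqr_ge0// mulr_ge0 ?ltW.
  rewrite -(powRM _ a0 E0) -(powRM _ b0 (mulr_ge0 a0 E0)).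
  congr (_ `^ _); field; by rewrite gt_eqF.
rewrite ler_wpM2l//; apply: le_trans (ge0_ler_powR s0 _ _ hq) _; rewrite ?nnegrE ?expR_ge0//.
  rewrite divr_ge0 ?(ltW n0)// mulr_ge0// mulr_ge0 ?(ltW p0)// mulr_ge0 ?sqr_ge0//.
  by rewrite mulr_ge0 ?sqr_ge0.
rewrite -expRM sE mulN1r expRN mulrC expRM lnK ?posrE//.
by rewrite powR_mulrn// ltW.
Qed.

End Tails.

Section GoodDesigns.
Context (d : measure_display) (T : measurableType d) (R : realType)
  (P : probability (T * R)%type R) (phi : nat -> T -> R) (ev : nat -> R)
  (nu C : R).
Hypotheses (hphi : is_orthonormal_basis (marginal P) phi) (hnu : 1 / 2 < nu)
  (ev0 : forall j, 0 <= ev j) (evC : forall j, ev j <= C * j.+1%:R `^ (- (2 * nu))).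

Let mphi j : measurable_fun setT (phi j).
Proof. exact: Lfun_measurable (onb_L2 hphi j). Qed.

(** The first bound on the probability of a bad design is for the bias, which is at most
a constant there. The second one is for the noise, whose mean square on the bad event
is O(1 / lambda) times the probability, and is divided by m by averaging. *)
Definition mostly_good (mmax : nat -> R) : Prop :=
  exists tau e A : R, [/\ 2 <= tau, 0 <= A &
  \forall N \near \oo,
    [/\ (0 < N)%N,
        forall J, \sum_(0 <= j < J) shrink ev (tau * krr_lam nu N) j <= e * krr_dim nu N &
        forall (mu : probability (N.-tuple (T * R)%type) R) (m : nat) (S : {set 'I_N}),
          is_product_law P mu -> (0 < m)%N -> (#|S| * m)%N = N -> m%:R <= mmax N ->
          exists b, [/\ (mu (bad_event phi ev S (tau * krr_lam nu N)) <= b%:E)%E,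
            b <= A * krr_lam nu N & b <= A * (m%:R * krr_lam nu N ^+ 2)]]].

Let nu0 : 0 < nu. Proof. have := hnu; lra. Qed.
Let nu1 : 0 < 2 * nu + 1. Proof. have := nu0; lra. Qed.

Let lam_gt0 N : (0 < N)%N -> 0 < krr_lam nu N.
Proof. by move=> N0; rewrite powR_gt0// div1r invr_gt0 ltr0n. Qed.

Let ln_ge1_gt0 N : 1 <= ln (N%:R : R) -> (0 < N)%N.
Proof. by case: N => // h; exfalso; move: h; rewrite ln0// ler10. Qed.

(** Moments of order k call for s = k / 2 in [bad_prob]. A constant factor in the
probability is harmless here, hence e = 1. *)
Lemma mostly_good_moment (k rho : R) (mmax : nat -> R) : 2 < k -> 0 < rho ->
  (forall j, (\int[marginal P]_x (`|phi j x| `^ (2 * k))%:E <= (rho `^ (2 * k))%:E)%E) ->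
  (forall N : nat, mmax N = (N%:R `^ ((2 * (k - 4) * nu - k) / (2 * nu + 1))
      / (rho `^ (4 * k) * ln N%:R `^ k)) `^ (1 / (k - 2))) ->
  mostly_good mmax.
Proof.
move=> k2 rho0 hrho hmmax.
have [tau tau2 hdim] := effective_dim hnu ltr01 ev0 evC.
have [M M0 hM] := gram_moment hphi k2 hrho.
pose A1 := expR (ln 2 * k - 2 * k * ln rho).
pose A2 := expR (- (4 * k * ln rho) / (k - 2)).
have A10 : 0 <= A1 by exact: expR_ge0.
have A20 : 0 <= A2 by exact: expR_ge0.
exists tau, 1, (M * A1 * (1 + A2)); split=> //.
  by rewrite !mulr_ge0// addr_ge0.
apply: filterS2 hdim (near_ln_ge (1 : R)) => N dimN lnN.
have N0 := ln_ge1_gt0 lnN.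
split=> // mu m S hmu m0 Sm mm.
have tl0 : 0 < tau * krr_lam nu N by rewrite mulr_gt0 ?lam_gt0//; apply: lt_le_trans tau2.
have S0 : (0 < #|S|)%N by have : (0 < #|S| * m)%N; [rewrite Sm | rewrite muln_gt0 => /andP[]].
have nE : #|S|%:R = N%:R / m%:R :> R.
  have -> : N%:R = (#|S| * m)%:R :> R by rewrite Sm.
  by rewrite natrM mulfK// pnatr_eq0 -lt0n.
have s1 : 1 < k / 2 by lra.
have hk : 2 * (k / 2) = k by field.
have hm (i j : nat) : (\int[mu]_t (`|\sum_(a in S) (phi i (design t a) * phi j (design t a)
    - (i == j)%:R)| `^ (2 * (k / 2)))%:E <= (M * #|S|%:R `^ (k / 2))%:E)%E.
  by rewrite hk; exact: hM.
have Mo0 : 0 <= M * #|S|%:R `^ (k / 2) by rewrite mulr_ge0// powR_ge0.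
have N0' : 0 < N%:R :> R by rewrite ltr0n.
have m0' : 0 < m%:R :> R by rewrite ltr0n.
rewrite hmmax in mm.
have := moment_tail_le hnu k2 rho0 N0' lnN m0' mm.
cbv zeta; rewrite -/(krr_dim nu N) -krr_lamE// -/A1 -/A2 -nE; move=> [h1 h2].
have := bad_prob mphi ev0 tl0 s1 Mo0 dimN hm.
set b := (X in (_ <= X%:E)%E) => hb; exists b; split=> //; rewrite /b {b hb}.
  rewrite mul1r mulrCA -2!(mulrA M) -(mulrA A1) ler_wpM2l//; apply: le_trans h1 _.
  rewrite ler_wpM2l// expr2 mulrA ler_wpM2r ?(ltW (lam_gt0 N0))//.
  by apply: le_trans h2 _; rewrite lerDr.
rewrite mul1r mulrCA -2!(mulrA M) -(mulrA A1) ler_wpM2l//; apply: le_trans h1 _.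
rewrite ler_wpM2l// ler_peMl ?lerDl//.
by rewrite mulr_ge0 ?sqr_ge0// ltW.
Qed.

(** [bad_prob] with s = 3 ln N. The assumption on m amounts to
D^2 m rho^4 ln N <= N, so that n dominates the order 6 ln N of the moment and the
base of the power in [exp_tail_le] is a constant multiple of (e / rho^2)^2, which
is small for a suitable e. *)
Lemma mostly_good_bounded (rho : R) (mmax : nat -> R) :
  (forall j x, `|phi j x| <= rho) ->
  (forall N : nat, mmax N =
     N%:R `^ ((2 * nu - 1) / (2 * nu + 1)) / (rho ^+ 4 * ln N%:R)) ->
  mostly_good mmax.
Proof.
move=> hrho hmmax.
have rho0 : 0 < rho.
  rewrite ltNge; apply/negP => rho0.
  have p0 x : phi 0%N x = 0.
    by apply/eqP; rewrite -normr_le0; exact: le_trans (hrho 0%N x) rho0.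
  have := onb_orthonormal hphi 0%N 0%N.
  under eq_integral do rewrite p0 mulr0.
  by rewrite integral0 eqxx => -[] /esym/eqP; rewrite oner_eq0.
pose e1 : R := expR 1; pose B := rho ^+ 2 + 1; pose E : R := expR (2 * (e1 - 1)).
have E0 : 0 < E by exact: expR_gt0.
have B1 : 1 <= B by rewrite lerDr sqr_ge0.
have B0 : 0 < B by apply: lt_le_trans B1.
(* chosen so that the base of the power in [exp_tail_le] is at most exp(- 1); see [hq] *)
pose c2 := 24 * E * e1.
have c20 : 0 < c2 by rewrite !mulr_gt0 ?expR_gt0.
pose e := rho ^+ 2 / (B * Num.sqrt c2).
have e0 : 0 < e by rewrite divr_gt0 ?exprn_gt0// mulr_gt0 ?sqrtr_gt0.
have eE : e ^+ 2 = rho ^+ 4 / (B ^+ 2 * c2).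
  by rewrite expr_div_n [(B * _) ^+ 2]exprMn sqr_sqrtr ?(ltW c20)// -exprM.
have [tau tau2 hdim] := effective_dim hnu e0 ev0 evC.
exists tau, e, 2; split=> //.
have q0 : 0 < 1 / (2 * nu + 1) by rewrite divr_gt0.
apply: filterS3 hdim (near_ln_ge (1 : R)) (near_powR_ge (6 / rho ^+ 4 + 1) q0) => N dimN lnN Dbig.
have N0 := ln_ge1_gt0 lnN.
split=> // mu m S hmu m0 Sm mm.
have tl0 : 0 < tau * krr_lam nu N by rewrite mulr_gt0 ?lam_gt0//; apply: lt_le_trans tau2.
have S0 : (0 < #|S|)%N by have : (0 < #|S| * m)%N; [rewrite Sm | rewrite muln_gt0 => /andP[]].
have nE : #|S|%:R = N%:R / m%:R :> R.
  have -> : N%:R = (#|S| * m)%:R :> R by rewrite Sm.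
  by rewrite natrM mulfK// pnatr_eq0 -lt0n.
have N0' : 0 < N%:R :> R by rewrite ltr0n.
have m0' : 0 < m%:R :> R by rewrite ltr0n.
have ln0' : 0 < ln N%:R :> R by apply: lt_le_trans lnN.
have n0 : 0 < #|S|%:R :> R by rewrite ltr0n.
have r40 : 0 < rho ^+ 4 by rewrite exprn_gt0.
set D := krr_dim nu N in dimN.
have key : D ^+ 2 * m%:R * (rho ^+ 4 * ln N%:R) <= N%:R.
  have NE : N%:R = D ^+ 2 * N%:R `^ ((2 * nu - 1) / (2 * nu + 1)) :> R.
    rewrite /D /krr_dim -powR_mulrn ?powR_ge0// -powRrM -powRD; last by rewrite (gt_eqF N0') implybT.
    rewrite -[LHS]powRr1 ?ltW//; congr (_ `^ _); field.
    by rewrite gt_eqF.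
  rewrite [leRHS]NE -mulrA ler_wpM2l ?sqr_ge0//.
  by move: mm; rewrite hmmax ler_pdivlMr//; apply: mulr_gt0.
have D1 : 6 / rho ^+ 4 <= D ^+ 2.
  have D6 : 6 / rho ^+ 4 + 1 <= D by [].
  have r6 : 0 <= 6 / rho ^+ 4 by rewrite divr_ge0// ltW.
  nra.
pose s := 3 * ln (N%:R : R); pose p := 2 * s.
have s1 : 1 < s by rewrite /s; lra.
have p0 : 0 < p by rewrite /p; lra.
have pn : p <= #|S|%:R.
  rewrite nE ler_pdivlMr//; apply: le_trans key.
  rewrite -mulrA [D ^+ 2 * _](_ : _ = (D ^+ 2 * rho ^+ 4) * (m%:R * ln N%:R)); last by ring.
  rewrite (_ : p * _ = 6 * (m%:R * ln N%:R)); last by rewrite /p /s; ring.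
  by rewrite ler_wpM2r ?mulr_ge0 ?(ltW m0') ?(ltW ln0')// -ler_pdivrMr.
have pn0 : 0 < p / #|S|%:R by rewrite divr_gt0.
pose s' := Num.sqrt (p / #|S|%:R) / B.
have s'0 : 0 < s' by rewrite divr_gt0 ?sqrtr_gt0.
have s'1 : s' * (rho ^+ 2 + 1) <= 1.
  by rewrite divfK ?gt_eqF// -[leRHS]sqrtr1 ler_wsqrtr// ler_pdivrMr// mul1r.
pose Mo := 2 * (p / s') `^ p * expR (#|S|%:R * (expR 1 * (s' * (rho ^+ 2 + 1)) ^+ 2) - p).
have Mo0 : 0 <= Mo by rewrite mulr_ge0 ?expR_ge0// mulr_ge0 ?powR_ge0.
have hm (i j : nat) : (\int[mu]_t (`|\sum_(a in S) (phi i (design t a) * phi j (design t a)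
    - (i == j)%:R)| `^ (2 * s))%:E <= Mo%:E)%E.
  exact: (gram_moment_bounded hphi hrho s'0 s'1 p0 S hmu).
have hq : 4 * (e * D) ^+ 2 * B ^+ 2 * p * E / #|S|%:R <= expR (- 1).
  rewrite nE invf_div mulrA ler_pdivrMr// exprMn eE.
  have -> : 4 * (rho ^+ 4 / (B ^+ 2 * c2) * D ^+ 2) * B ^+ 2 * p * E * m%:R =
      expR (- 1) * (D ^+ 2 * m%:R * (rho ^+ 4 * ln N%:R)).
    rewrite /c2 /p /s expRN -/e1; field.
    by rewrite !gt_eqF ?expR_gt0.
  by rewrite ler_wpM2l ?expR_ge0.
have hb : (4 * ((e * D) ^+ 2 / #|S|%:R ^+ 2)) `^ s * Mo <= 2 * (N%:R ^+ 3)^-1.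
  by apply: (exp_tail_le (e := e1) n0 p0 pn B1 N0') hq.
exists (2 * (N%:R ^+ 3)^-1).
have N1 : 1 <= N%:R :> R by rewrite ler1n.
have m1 : 1 <= m%:R :> R by rewrite ler1n.
pose x : R := N%:R^-1.
have x0 : 0 < x by rewrite invr_gt0.
have x1 : x <= 1 by rewrite invf_le1.
have xlam : x <= krr_lam nu N.
  rewrite /krr_lam div1r -/x; apply: ger1_powR; first by rewrite x0.
  by rewrite ler_pdivrMr// mul1r lerDl.
rewrite -exprVn -/x.
have l0 := lam_gt0 N0.
have xx : x * x <= x by rewrite ger_pMr.
have xl : x * x <= krr_lam nu N ^+ 2 by rewrite expr2 ler_pM// ltW.
have x3 : x ^+ 3 <= x * x by rewrite exprS expr2 ler_wpM2l// ltW.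
split.
- by apply: le_trans (bad_prob mphi ev0 tl0 s1 Mo0 dimN hm) _; rewrite lee_fin /x exprVn.
- by rewrite ler_wpM2l//; apply: le_trans x3 _; apply: le_trans xx _.
- rewrite ler_wpM2l//; apply: le_trans x3 _; apply: le_trans xl _.
  by rewrite ler_peMl// sqr_ge0.
Qed.

End GoodDesigns.

(** * Conclusion *)

Section MeanSquaredError.
Context (d : measure_display) (T : measurableType d) (R : realType)
  (P : probability (T * R)%type R) (fstar var : T -> R) (sigma nu : R)
  (phi : nat -> T -> R) (ev : nat -> R)
  (K : T -> T -> R) (H : set (T -> R)) (ip : (T -> R) -> (T -> R) -> R).
Hypotheses (hphi : is_orthonormal_basis (marginal P) phi) (hH : is_rkhs K H ip)
  (hpsd : psd_kernel K) (hL2 : forall f, H f -> f \in Lfun (marginal P) 2%:E)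
  (hK : has_mercer_expansion K ev phi) (ev0 : forall j, 0 <= ev j)
  (evdec : forall j, ev j.+1 <= ev j).
Hypothesis Hfstar : H fstar.
Hypothesis hfstar : is_cond_exp (P := P) (@fst T R) snd fstar.
Hypothesis hvar :
  is_cond_exp (P := P) (@fst T R) (fun w => (w.2 - fstar w.1) ^+ 2) var.
Hypothesis hsigma : forall x, var x <= sigma ^+ 2.

(** Insert the bounds of [mostly_good] into [integral_dc_krr] for each partition, and
use D / (m n) = lambda. The average over partitions does not exceed the common
bound, even when there is no equal partition. *)
Lemma dc_krr_mse_le (mmax : nat -> R) : 1 / 2 < nu -> mostly_good P phi ev nu mmax ->
  exists A : R, \forall N \near \oo,
    forall (d' : measure_display) (Om : measurableType d')
      (Q : probability Om R) (Z : 'I_N -> {RV Q >-> (T * R)%type}),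
    is_iid_sample P Z ->
    forall m : nat, (0 < m)%N -> (m %| N)%N -> m%:R <= mmax N ->
    (dc_krr_mse Q (marginal P) H ip fstar m (fun i => Z i) (krr_lam nu N)
     <= (A * krr_lam nu N)%:E)%E.
Proof.
move=> hnu [tau [e [A [tau2 A0 hgood]]]].
set B := ip fstar fstar.
have B0 : 0 <= B by exact: (rkhs_ip_ge0 hH Hfstar).
exists (2 * ((1 + tau) * B + ev 0%N * B * A) +
   2 * (2 * tau ^+ 2 * e * sigma ^+ 2 + ev 0%N * sigma ^+ 2 * A)).
move: hgood; apply: filterS => N [N0 dimN hb] d' Om Q Z hZ m m0 mN mm.
have l0 : 0 < krr_lam nu N by rewrite powR_gt0// div1r invr_gt0 ltr0n.
set lam := krr_lam nu N in dimN hb l0 *.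
set D := krr_dim nu N in dimN.
pose n := (N %/ m)%N.
have nm : (n * m)%N = N by exact: divnK.
have n0 : (0 < n)%N by rewrite divn_gt0// dvdn_leq.
have N0' : 0 < N%:R :> R by rewrite ltr0n.
have m0' : 0 < m%:R :> R by rewrite ltr0n.
have n0' : 0 < n%:R :> R by rewrite ltr0n.
have mnE : m%:R^-1 * n%:R^-1 = N%:R^-1 :> R by rewrite -nm natrM invfM mulrC.
have DE : D / N%:R = lam.
  have nu1 : 2 * nu + 1 != 0 by rewrite gt_eqF//; lra.
  have -> : lam = N%:R `^ (-1 * (2 * nu / (2 * nu + 1))).
    by rewrite powRrM powR_inv1 ?ler0n// /lam /krr_lam div1r.
  rewrite /D /krr_dim -[N%:R^-1]powR_inv1 ?ler0n// -powRD.
    by congr (_ `^ _); field.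
  by rewrite (gt_eqF N0') implybT.
set X := (_ * lam)%:E.
have X0 : (0 <= X)%E.
  have e0 : 0 <= e.
    have D0 : 0 < D by rewrite powR_gt0.
    by have := dimN 0%N; rewrite big_geq// pmulr_lge0.
  rewrite lee_fin; apply: mulr_ge0; last exact: ltW.
  have tau0 : 0 <= tau by apply: le_trans tau2.
  have t1 : 0 <= 1 + tau by rewrite addr_ge0.
  have s2 := sqr_ge0 sigma; have t2 := sqr_ge0 tau; have evz := ev0 0%N.
  apply: addr_ge0; apply: mulr_ge0 => //; apply: addr_ge0.
  - exact: mulr_ge0.
  - by apply: mulr_ge0 => //; exact: mulr_ge0.
  - by apply: mulr_ge0 => //; apply: mulr_ge0 => //; exact: mulr_ge0.
  - by apply: mulr_ge0 => //; exact: mulr_ge0.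
have part (s : {ffun 'I_N -> 'I_m}) : s \in equal_partitions N m ->
    (\int[Q]_w (L2norm (marginal P) (fun x =>
       dc_krr H ip s (fun i => Z i w) lam x - fstar x)%R ^+ 2) <= X)%E.
  rewrite inE => /forallP hs.
  have hs' i : #|[set j | s j == i]%SET| = n by exact/eqP.
  pose S i := [set j | s j == i]%SET.
  have hmu := sample_law_product hZ.
  have Sm i : (#|S i| * m)%N = N by rewrite hs'.
  have bi i : exists b, [/\ (sample_law Z (bad_event phi ev (S i) (tau * lam)) <= b%:E)%E,
      b <= A * lam & b <= A * (m%:R * lam ^+ 2)] by exact: (hb _ _ _ hmu m0 (Sm i) mm).
  pose b := Num.min (A * lam) (A * (m%:R * lam ^+ 2)).
  have hbb i : (sample_law Z (bad_event phi ev (S i) (tau * lam)) <= b%:E)%E.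
    have [c [c1 c2 c3]] := bi i; apply: le_trans c1 _.
    by rewrite lee_fin le_min c2.
  apply: le_trans (integral_dc_krr hphi hH hpsd hL2 hK ev0 evdec Hfstar hfstar hvar
    hsigma l0 tau2 hZ m0 n0 hs' dimN hbb) _.
  have b1 : b <= A * lam by rewrite ge_min lexx.
  have b2 : b <= A * (m%:R * lam ^+ 2) by rewrite ge_min lexx orbT.
  rewrite lee_fin [leRHS]mulrDl; apply: lerD.
    rewrite -[leRHS]mulrA ler_wpM2l// [leRHS]mulrDl; apply: lerD; first by rewrite mulrAC.
    by rewrite -[leRHS]mulrA ler_wpM2l// mulr_ge0.
  rewrite -[leRHS]mulrA ler_wpM2l// [leRHS]mulrDl [leLHS]mulrDr; apply: lerD.
    rewrite le_eqVlt; apply/orP; left; apply/eqP.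
    rewrite -DE -mnE; ring.
  have -> : ev 0%N * sigma ^+ 2 * A * lam =
      m%:R^-1 * (ev 0%N / lam * sigma ^+ 2 * (A * (m%:R * lam ^+ 2))).
    by field; rewrite !gt_eqF.
  rewrite ler_wpM2l ?invr_ge0 ?ler0n// ler_wpM2l// mulr_ge0 ?sqr_ge0//.
  by rewrite divr_ge0// ltW.
have [Y XE] : exists Y, X = Y%:E by exists (fine X).
move: X0 part; rewrite /dc_krr_mse {}XE lee_fin => Y0 part.
set k := #|equal_partitions N m|.
apply: (@le_trans _ _ ((k%:R^-1)%:E * \sum_(s in equal_partitions N m) Y%:E)%E).
  by apply: lee_wpmul2l; [rewrite lee_fin invr_ge0|apply: lee_sum].
rewrite sumEFin sumr_const -/k -EFinM lee_fin -[Y *+ k]mulr_natl mulrA.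
rewrite ler_piMl//.
have [->|k0] := posnP k; first by rewrite mulr0.
by rewrite mulVf// pnatr_eq0 -lt0n.
Qed.

End MeanSquaredError.

Theorem corollary2 (R : realType) (nu : R) (hnu : 1 / 2 < nu) :
  exists2 c : R, 0 < c &
  forall (d : measure_display) (T : measurableType d)
    (P : probability (T * R)%type R)
    (K : T -> T -> R) (H : set (T -> R)) (ip : (T -> R) -> (T -> R) -> R)
    (mu : nat -> R) (phi : nat -> T -> R)
    (C : R) (fstar var : T -> R) (sigma : R),
  psd_kernel K ->
  is_rkhs K H ip ->
  (forall f, H f -> f \in Lfun (marginal P) 2%:E) ->
  is_orthonormal_basis (marginal P) phi ->
  has_mercer_expansion K mu phi ->
  (forall j, mu j.+1 <= mu j) ->
  (forall j, 0 <= mu j) ->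
  (forall j, mu j <= C * j.+1%:R `^ (- (2 * nu))) ->
  is_cond_exp (P := P) (@fst T R) snd fstar ->
  H fstar ->
  0 < sigma ->
  is_cond_exp (P := P) (@fst T R) (fun w => (w.2 - fstar w.1) ^+ 2) var ->
  (forall x, var x <= sigma ^+ 2) ->
  forall mmax : nat -> R,
  (exists k rho : R,
     [/\ 2 < k, 0 < rho,
         forall j, (\int[marginal P]_x (`|phi j x| `^ (2 * k))%:E
                    <= (rho `^ (2 * k))%:E)%E &
         forall N : nat, mmax N =
           c * (N%:R `^ ((2 * (k - 4) * nu - k) / (2 * nu + 1))
                / (rho `^ (4 * k) * ln N%:R `^ k)) `^ (1 / (k - 2))])
  \/
  (exists rho : R,
     (forall j x, `|phi j x| <= rho) /\
     (forall N : nat, mmax N =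
        c * (N%:R `^ ((2 * nu - 1) / (2 * nu + 1)) / (rho ^+ 4 * ln N%:R)))) ->
  exists A : R, \forall N \near \oo,
    forall (d' : measure_display) (Om : measurableType d')
      (Q : probability Om R) (Z : 'I_N -> {RV Q >-> (T * R)%type}),
    is_iid_sample P Z ->
    forall m : nat, (0 < m)%N -> (m %| N)%N -> m%:R <= mmax N ->
    (dc_krr_mse Q (marginal P) H ip fstar m (fun i => Z i)
       ((1 / N%:R) `^ (2 * nu / (2 * nu + 1)))
     <= (A * (sigma ^+ 2 / N%:R) `^ (2 * nu / (2 * nu + 1)))%:E)%E.
Proof.
exists 1 => // d T P K H ip mu phi C fstar var sigma hpsd hH hL2 hphi hK mudec mu0 muC
  hfstar Hfstar sigma0 hvar hsigma mmax hmmax.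
have good : mostly_good P phi mu nu mmax.
  case: hmmax => [[k [rho [k2 rho0 hrho hm]]]|[rho [hrho hm]]].
    by apply: (mostly_good_moment hphi hnu mu0 muC k2 rho0 hrho) => N; rewrite hm mul1r.
  by apply: (mostly_good_bounded hphi hnu mu0 muC hrho) => N; rewrite hm mul1r.
have [A hA] := dc_krr_mse_le hphi hH hpsd hL2 hK mu0 mudec Hfstar hfstar hvar hsigma hnu good.
pose g : R := 2 * nu / (2 * nu + 1).
have s0 : 0 < (sigma ^+ 2) `^ g by rewrite powR_gt0// exprn_gt0.
exists (A / (sigma ^+ 2) `^ g).
move: hA; apply: filterS => N hA d' Om Q Z hZ m m0 mN mm.
apply: le_trans (hA _ _ _ _ hZ _ m0 mN mm) _.
rewrite lee_fin -/g [X in _ <= _ / _ * X](_ : _ = (sigma ^+ 2) `^ g * krr_lam nu N).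
  by rewrite mulrA divfK ?gt_eqF.
by rewrite /krr_lam -powRM ?sqr_ge0 ?divr_ge0// div1r.
Qed.
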